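(* Let $D$ be a digraph on $p\ge 5$ vertices with minimum degree at least $p-1$ and minimum semi-degree at least $p/2-1$. Then $D$ contains a (directed) cycle of length $p-1$, unless one of the following holds: for some positive integer $n$, $D\in H(n,n)$, or $D$ is isomorphic to one of $[(K_n\cup K_n)+K_1]^*$, $H(2n)$, $H'(2n)$, $C^*(5)$; or else $p=2n$ and $D\subseteq K^*_{n,n}$.
   Context: Digraphs are finite, without loops or multiple arcs. For a vertex $x$, $O(x)$ and $I(x)$ are the sets of vertices dominated by $x$ (out-neighbours) and dominating $x$ (in-neighbours); $od(x)=|O(x)|$, $id(x)=|I(x)|$, and the degree is $d(x)=od(x)+id(x)$. The minimum semi-degree of $D$ is $\min_x\min\{od(x),id(x)\}$. Cycles are directed and simple. For a subset $S$, $\langle S\rangle$ is the induced subdigraph; $A\rightarrow B$ means every vertex of $A$ dominates every vertex of $B$. For an undirected graph $G$, $G^*$ is the symmetric digraph obtained by replacing each edge $xy$ by the two arcs $xy,yx$. $K_n$ is the complete graph, $K_{n,m}$ the complete bipartite graph, $G_1\cup G_2$ the disjoint union, and $G_1+G_2$ the join (disjoint union plus all edges between $G_1$ and $G_2$). $C^*(5)$ is the symmetric digraph of the undirected 5-cycle. $D\subseteq K^*_{n,n}$ means $D$ is isomorphic to a spanning subdigraph of $K^*_{n,n}$. $H(n,n)$ is the set of digraphs $D$ on $2n$ vertices with $V(D)=A\cup B$ (disjoint), $\langle A\rangle$ and $\langle B\rangle$ both complete symmetric digraphs $K_n^*$, no arc from $B$ to $A$, every vertex of $A$ dominates some vertex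 of $B$, and every vertex of $B$ is dominated by some vertex of $A$. For $n\ge 2$, $H(2n)$ is the digraph with vertex set $A\cup B\cup\{x,y\}$ where $\langle A\rangle$ and $\langle B\rangle$ are copies of $K_{n-1}^*$, there are no arcs between $A$ and $B$, $O(x)=\{y\}\cup A$, $I(x)=O(y)=A\cup B$, and $I(y)=\{x\}\cup B$. $H'(2n)$ is obtained from $H(2n)$ by adding the arc $yx$. *)

(* Defs.v *)
From mathcomp Require Import all_boot.

Set Implicit Arguments.
Unset Strict Implicit.
Unset Printing Implicit Defensive.

Record digraph (V : finType) := Digraph {
  arc :> rel V;
  arc_irr : irreflexive arc
}.

Record sgraph (V : finType) := SGraph {
  edge :> rel V;
  edge_sym : symmetric edge;
  edge_irr : irreflexive edge
}.

Section Digraphs.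
Variables (V : finType) (D : digraph V).

Definition outn (x : V) : {set V} := [set y | D x y].
Definition inn (x : V) : {set V} := [set y | D y x].
Definition outdeg (x : V) : nat := #|outn x|.
Definition indeg (x : V) : nat := #|inn x|.
Definition deg (x : V) : nat := outdeg x + indeg x.

(* Without loops, deg x <= 2 * #|V| and outdeg x, indeg x <= #|V|, so the initial
   values below are never smaller than a term of the minimum and only matter
   for the empty digraph. *)
Definition min_degree : nat := \big[minn/(2 * #|V|)%N]_(x : V) deg x.
Definition min_semidegree : nat :=
  \big[minn/#|V|]_(x : V) minn (outdeg x) (indeg x).

Definition has_cycle (k : nat) : Prop :=
  exists c : seq V, size c = k /\ ucycle D c.

Definition induced_rel (S : {set V}) : rel {x : V | x \in S} :=
  fun u v => D (val u) (val v).

Lemma induced_irr (S : {set V}) : irreflexive (@induced_rel S).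
Proof. by move=> u; exact: arc_irr. Qed.

Definition induced (S : {set V}) : digraph {x : V | x \in S} :=
  Digraph (@induced_irr S).

End Digraphs.

Definition isomorphic (V W : finType) (D : digraph V) (E : digraph W) : Prop :=
  exists2 f : V -> W, bijective f & forall x y, E (f x) (f y) = D x y.

Definition spanning_subdigraph (V : finType) (D E : digraph V) : Prop :=
  subrel D E.

(* The relation usually written D \subseteq E for unlabelled D, as in
   D \subseteq K*_{n,n}. *)
Definition embeds_spanning (V W : finType) (D : digraph V) (E : digraph W) :
    Prop :=
  exists2 E' : digraph W, spanning_subdigraph E' E & isomorphic D E'.

Definition symdigraph (V : finType) (G : sgraph V) : digraph V :=
  Digraph (@edge_irr V G).

Section CompleteGraph.
Variable n : nat.

Definition complete_rel : rel 'I_n := fun i j => i != j.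

Lemma complete_sym : symmetric complete_rel.
Proof. by move=> i j; rewrite /complete_rel eq_sym. Qed.

Lemma complete_irr : irreflexive complete_rel.
Proof. by move=> i; rewrite /complete_rel eqxx. Qed.

Definition complete : sgraph 'I_n := SGraph complete_sym complete_irr.

End CompleteGraph.

Section CompleteBipartite.
Variables n m : nat.

Definition complete_bip_rel : rel ('I_n + 'I_m)%type := fun u v =>
  match u, v with
  | inl _, inr _ | inr _, inl _ => true
  | _, _ => false
  end.

Lemma complete_bip_sym : symmetric complete_bip_rel.
Proof. by case=> i [] j. Qed.

Lemma complete_bip_irr : irreflexive complete_bip_rel.
Proof. by case. Qed.

Definition complete_bip : sgraph ('I_n + 'I_m)%type :=
  SGraph complete_bip_sym complete_bip_irr.

End CompleteBipartite.

Section UnionJoin.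
Variables (V W : finType) (G : sgraph V) (H : sgraph W).

(* b is the adjacency between the two parts: disjoint union for false, join
   for true. *)
Definition sum_rel (b : bool) : rel (V + W)%type := fun u v =>
  match u, v with
  | inl x, inl y => G x y
  | inr x, inr y => H x y
  | _, _ => b
  end.

Lemma sum_sym b : symmetric (sum_rel b).
Proof. by case=> x [] y //=; apply: edge_sym. Qed.

Lemma sum_irr b : irreflexive (sum_rel b).
Proof. by case=> x /=; apply: edge_irr. Qed.

Definition gunion : sgraph (V + W)%type :=
  SGraph (sum_sym false) (sum_irr false).
Definition gjoin : sgraph (V + W)%type :=
  SGraph (sum_sym true) (sum_irr true).

End UnionJoin.

Definition C5_rel : rel 'I_5 := fun i j =>
  (i.+1 %% 5 == j) || (j.+1 %% 5 == i).

Lemma C5_sym : symmetric C5_rel.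
Proof. by move=> i j; rewrite /C5_rel orbC. Qed.

Lemma C5_irr : irreflexive C5_rel.
Proof. by case; do 5?[case=> //]. Qed.

Definition C5 : sgraph 'I_5 := SGraph C5_sym C5_irr.

Definition in_Hnn (V : finType) (n : nat) (D : digraph V) : Prop :=
  #|V| = 2 * n /\
  exists A B : {set V},
    [/\ A :|: B = [set: V] /\ [disjoint A & B],
        isomorphic (induced D A) (symdigraph (complete n)) /\
        isomorphic (induced D B) (symdigraph (complete n)),
        forall b a, b \in B -> a \in A -> ~~ D b a,
        forall a, a \in A -> exists2 b, b \in B & D a b
      & forall b, b \in B -> exists2 a, a \in A & D a b].

Section H2n.
Variable n : nat.

(* inA and inB carry n.-1 vertices each, so the order is 2 * n for n >= 1. *)
Definition H2n_vertex : finType := ('I_n.-1 + 'I_n.-1 + bool)%type.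

Notation inA i := (inl (inl i)).
Notation inB i := (inl (inr i)).
Notation vx := (inr true).
Notation vy := (inr false).

(* yx tells whether the arc from y to x is present. *)
Definition H2n_rel (yx : bool) : rel H2n_vertex := fun u v =>
  match u, v with
  | inA i, inA j => i != j
  | inB i, inB j => i != j
  | inA _, inB _ | inB _, inA _ => false
  | vx, vy => true
  | vx, inA _ => true
  | vx, inB _ => false
  | inA _, vx | inB _, vx => true
  | vy, inA _ | vy, inB _ => true
  | inA _, vy => false
  | inB _, vy => true
  | vy, vx => yx
  | vx, vx | vy, vy => false
  end.

Lemma H2n_irr yx : irreflexive (H2n_rel yx).
Proof. by case=> [[i|i]|[]] //=; rewrite eqxx. Qed.

Definition H2n : digraph H2n_vertex := Digraph (H2n_irr false).
Definition H2n' : digraph H2n_vertex := Digraph (H2n_irr true).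

End H2n.

(* Main.v *)
Require Import Defs.
From mathcomp Require Import all_boot all_order all_algebra.
From mathcomp Require Import zify ring lra.
From Stdlib Require Import Classical_Prop.

(** Let s = (p-1)/2 rounded down; a longest path shows that some cycle is longer
    than s.  If only Hamiltonian cycles are, their backward chords force C*(5).
    Otherwise let C = x_0 ... x_(M-1) be a longest cycle of length M < p, with
    M <= p-2, and let k = p-M.  A path from y to z outside C cannot replace a
    stretch of C having fewer vertices unless it closes a Hamiltonian cycle, so
    the in-neighbours of y on C avoid the out-neighbours of z by a whole window
    of shifts, which bounds their number from above; the degree condition bounds
    it from below.
    If k >= 3, either the outside of C has no arcs from C (or none to C), which
    gives H(n,n), or it is complete and all outside vertices have the same
    in-neighbours and out-neighbours on C, each forming an interval.  In the
    latter case exchanging the outside with the k cycle vertices not adjacent to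
    it gives a second such decomposition, and comparing both leaves only
    [(K_n u K_n) + K_1]*, H(2n) and H'(2n).
    If k = 2 and a, b are the outside vertices, then exchanging vertices of C
    with a or b and inserting the path ab into C shows that the neighbours of a
    alternate on C, so that D is bipartite, unless the previous case applies. *)

(** Let S be the in-neighbours on C of the first vertex, and T the out-neighbours of the last
    vertex, of an outside path on l vertices. Replacing the t-1 cycle vertices strictly between x_i
    and x_(i+t) by this path gives length M+1-t+l, excluded when strictly between M and p. So l = k
    excludes the shifts 2,...,k but not 1, which closes a Hamiltonian cycle; a path with the same
    ends and l = k-1 excludes 1 as well. With both paths, |S|+|T| <= M+1-k, while the degree bound
    gives an outside vertex at least M+1-k arcs to and from C. So everything is tight if both paths
    exist, and one unit is missing otherwise. Getting the shorter path is the main difficulty for k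
    >= 3. For k = 2 distinct ends have no path on k-1 vertices at all: a and b may be insertable
    together at some place of C, and this becomes useful only with a chord skipping one vertex of C,
    which brings the length back to p-1. The bound M > s gives k <= s+1, so an outside vertex
    without in-neighbours on C needs all other outside vertices as in-neighbours; H(n,n) comes from
    this borderline. *)

Set Implicit Arguments.
Unset Strict Implicit.
Unset Printing Implicit Defensive.

Import GRing.Theory.
Local Open Scope ring_scope.

(* Types such as [{set 'I_n}] elaborate with [reverse_coercion] markers that
   make convertible cardinals look different to [lia]. *)
Ltac rlia :=
  cbv beta delta [reverse_coercion] in *; simpl Finite.sort in *; lia.

(** * Windows of shifts in cyclic index sets *)

Section CyclicIndices.
Variable m : nat.
Implicit Types (i j : 'I_m.+2) (P : pred 'I_m.+2) (S T : {set 'I_m.+2}).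

Lemma natr_size : m.+2%:R = 0 :> 'I_m.+2.
Proof. by apply/val_inj; rewrite Zp_nat /= modnn. Qed.

Lemma natr_pred : m.+1%:R = -1 :> 'I_m.+2.
Proof. by apply/eqP; rewrite -addr_eq0 natr1 natr_size. Qed.

Lemma natr_ord_inj (t u : nat) :
  (t < m.+2)%N -> (u < m.+2)%N -> (t%:R == u%:R :> 'I_m.+2) = (t == u).
Proof. by move=> lt_t lt_u; rewrite -val_eqE !Zp_nat /= !modn_small. Qed.

Lemma shift_neq (c : nat) i j :
  (0 < c < m.+2)%N -> i - j = c%:R -> i != j.
Proof.
move=> /andP[c0 cM] ij; rewrite -subr_eq0 ij -[0]/(0%:R) natr_ord_inj //.
by rewrite -lt0n.
Qed.

Lemma ord_shift i j : exists2 t : nat, (t < m.+2)%N & j = i + t%:R.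
Proof. by exists (j - i); [exact: ltn_ord | rewrite natr_Zp; ring]. Qed.

Lemma cyclic_change P i j : P i -> ~~ P j -> exists h, P h && ~~ P (h + 1).
Proof.
move=> Pi; have [t _ ->] := ord_shift i j.
elim: t => [|t IH]; first by rewrite addr0 Pi.
case Pt: (P (i + t%:R)); last by move=> _; apply: IH; rewrite Pt.
by move=> nP; exists (i + t%:R); rewrite Pt -addrA natr1.
Qed.

Lemma cyclic_ind P i : P i -> (forall j, P j -> P (j + 1)) -> forall j, P j.
Proof.
move=> Pi stepP j; apply/negPn/negP => nPj.
by have [h /andP[/stepP ->]] := cyclic_change Pi nPj.
Qed.

Lemma neq_setT S : reflect (exists j, j \notin S) (S != setT).
Proof.
apply: (iffP idP) => [|[j nSj]]; last first.
  by apply: contraNneq nSj => ->; rewrite inE.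
by rewrite -subTset => /subsetPn[j _]; exists j.
Qed.

Definition shift_set (t : nat) S : {set 'I_m.+2} :=
  [set i : 'I_m.+2 | i - t%:R \in S].

Lemma in_shift_set t S i : (i \in shift_set t S) = (i - t%:R \in S).
Proof. by rewrite /shift_set inE. Qed.

Lemma card_shift_set t S : #|shift_set t S| = #|S|.
Proof.
rewrite -[RHS](card_imset _ (addIr t%:R)); congr #|pred_of_set _|.
apply/setP=> i; rewrite in_shift_set; apply/idP/imsetP => [Si|[j Sj ->]].
  by exists (i - t%:R); rewrite ?subrK.
by rewrite addrK.
Qed.

(** The sumset S + {1,...,w}. *)
Definition window (w : nat) S : {set 'I_m.+2} :=
  [set i : 'I_m.+2 | [exists t : 'I_w, i - t.+1%:R \in S]].

Lemma windowP w S i :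
  reflect (exists2 t : nat, (0 < t <= w)%N & i - t%:R \in S)
          (i \in window w S).
Proof.
rewrite /window inE; apply: (iffP existsP) => [[t St]|[[|t] // tw St]].
  by exists t.+1 => //; rewrite /= ltn_ord.
by exists (Ordinal (tw : (t < w)%N)).
Qed.

Lemma windowS w S :
  (0 < w)%N -> window w.+1 S = window w S :|: shift_set 1 (window w S).
Proof.
move=> w0; apply/setP=> i; rewrite in_setU in_shift_set.
apply/windowP/orP => [[t tw St]|[]/windowP[t tw St]].
- have [tw'|wt] := leqP t w; first by left; apply/windowP; exists t => //; lia.
  right; apply/windowP; exists w; first lia.
  by rewrite -[X in X \in S](_ : i - t%:R = _) // (_ : t = w.+1); [ring|lia].
- by exists t => //; lia.
- exists t.+1; first lia.
  by rewrite -[X in X \in S](_ : i - 1%:R - t%:R = _) // -natr1; ring.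
Qed.

Lemma window1 S : window 1 S = shift_set 1 S.
Proof.
apply/setP=> i; rewrite in_shift_set; apply/windowP/idP => [[t t1 St]|Si].
  by rewrite (_ : 1%N = t) //; lia.
by exists 1%N.
Qed.

(** A nonempty proper subset of a cyclic group has an element whose successor is missing; that
    successor is gained. *)
Lemma window_grows w S :
    (0 < w)%N -> window w S != set0 -> window w S != setT ->
  (#|window w S| < #|window w.+1 S|)%N.
Proof.
move=> w0 /set0Pn[i Wi] WnT; rewrite windowS //; apply: proper_card.
apply/properP; split; first exact: subsetUl.
have /neq_setT[j nWj] := WnT.
have [h /andP[Wh nWh]] :
    exists h, (h \in window w S) && (h + 1 \notin window w S).
  exact: (cyclic_change (P := mem (window w S)) Wi nWj).
by exists (h + 1) => //; rewrite in_setU in_shift_set addrK Wh orbT.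
Qed.

Lemma leq_window w w' S : (w <= w')%N -> window w S \subset window w' S.
Proof.
move=> ww'; apply/subsetP=> i /windowP[t tw St]; apply/windowP.
by exists t => //; lia.
Qed.

Lemma window_neq0 w S : (0 < w)%N -> S != set0 -> window w S != set0.
Proof.
move=> w0 /set0Pn[i Si]; apply/set0Pn; exists (i + 1%:R); apply/windowP.
by exists 1%N => //; rewrite addrK.
Qed.

(** The Cauchy-Davenport bound, valid for every modulus because one summand is an interval: each
    further shift gains an element until everything is covered. *)
Lemma card_window w S :
    (0 < w)%N -> S != set0 -> window w S != setT ->
  (#|S| + w <= #|window w S|.+1)%N.
Proof.
move=> + S0; elim: w => // -[_ _ _|w IH _ WT].
  by rewrite window1 card_shift_set addn1.
have WT' : window w.+1 S != setT.
  apply: contraNneq WT => eqT; rewrite eqEsubset subsetT -eqT.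
  exact: leq_window.
have := IH isT WT'.
have := window_grows (ltn0Sn w) (window_neq0 (ltn0Sn w) S0) WT'; lia.
Qed.

Definition misses w S T :=
  forall i t, i \in S -> (0 < t <= w)%N -> i + t%:R \notin T.

Lemma misses_window w S T : misses w S T -> T \subset ~: window w S.
Proof.
move=> mST; apply/subsetP=> j Tj; rewrite inE; apply/negP=> /windowP[t tw Sj].
by move: (mST _ _ Sj tw); rewrite subrK Tj.
Qed.

(** An element of T lies outside the sumset, so the sumset is proper and [card_window] applies. *)
Lemma misses_card w S T :
    (0 < w)%N -> S != set0 -> T != set0 -> misses w S T ->
  (#|S| + #|T| + w <= m.+3)%N.
Proof.
move=> w0 S0 /set0Pn[j Tj] mST; have TW := misses_window mST.
have WT : window w S != setT.
  by apply/neq_setT; exists j; rewrite -in_setC; apply: (subsetP TW).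
have := card_window w0 S0 WT; have := subset_leq_card TW.
have := cardsC (window w S); rewrite card_ord; rlia.
Qed.

Lemma misses_tight w S T :
    (0 < w)%N -> S != set0 -> T != set0 -> misses w S T ->
    (#|S| + #|T| + w = m.+3)%N ->
  T = ~: window w S.
Proof.
move=> w0 S0 /set0Pn[j Tj] mST cST; have TW := misses_window mST.
have WT : window w S != setT.
  by apply/neq_setT; exists j; rewrite -in_setC; apply: (subsetP TW).
apply/eqP; rewrite eqEcard TW /=.
have := card_window w0 S0 WT.
have := cardsC (window w S); rewrite card_ord; rlia.
Qed.

Lemma window_chain v d S :
    (0 < v)%N -> S != set0 -> window (v + d) S != setT ->
  (#|window v S| + d <= #|window (v + d) S|)%N.
Proof.
move=> v0 S0; elim: d => [|d IH]; first by rewrite !addn0.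
rewrite addnS => WT; have vd0 : (0 < v + d)%N by rewrite ltn_addr.
have WT' : window (v + d) S != setT.
  apply: contraNneq WT => eqT; rewrite eqEsubset subsetT -eqT.
  exact: leq_window.
have := IH WT'; have := window_grows vd0 (window_neq0 vd0 S0) WT'; lia.
Qed.

(* [window 2 S] exceeds [window 1 S] by one element per maximal run of S, so
   tightness leaves a single run. *)
Lemma misses_tight_run w S T :
    (1 < w)%N -> S != set0 -> T != set0 -> misses w S T ->
    (#|S| + #|T| + w = m.+3)%N ->
  exists h : 'I_m.+2, (forall t : nat, (t < m.+2)%N -> (h - t%:R \in S) = (t < #|S|)%N)
    /\ (forall t : nat, (0 < t <= m.+2)%N ->
          (h + t%:R \in T) = (w < t)%N && (t + #|S| <= m.+3)%N).
Proof.
move=> w1 S0 T0 mST cST.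
have [i Si] := set0Pn _ S0; have [j Tj] := set0Pn _ T0.
have defT := misses_tight (ltnW w1) S0 T0 mST cST.
have nSw u : (0 < u <= w)%N -> j - u%:R \notin S.
  by move=> uw; apply: contraL Tj => /mST/(_ uw); rewrite subrK.
have c2 : (#|window 2 S| <= #|S|.+1)%N.
  have WT : window (2 + (w - 2)) S != setT.
    by rewrite subnKC //; apply/neq_setT; exists j; rewrite -in_setC -defT.
  have := @window_chain 2 (w - 2) S isT S0 WT; rewrite subnKC //.
  have := cardsC (window w S); rewrite card_ord -defT; rlia.
have [h /andP[Sh nSh]] : exists h, (h \in S) && (h + 1 \notin S).
  exact: (cyclic_change (P := mem S) Si (nSw 1%N (ltnW w1))).
have runE g : g \in S -> g + 1 \notin S -> g = h.
  move=> Sg nSg; apply/eqP/negPn/negP => gh.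
  pose nxt (f : 'I_m.+2) : 'I_m.+2 := f + 2%:R.
  (* Both [nxt h] and [nxt g] lie in S + 2 but not in S + 1, so two ends of runs would gain two
     elements at once, against [c2]. *)
  suff: (#|window 1 S :|: [set nxt h; nxt g]| <= #|window 2 S|)%N.
    rewrite cardsU window1 card_shift_set cards2.
    rewrite (inj_eq (addIr _)) eq_sym gh.
    rewrite (_ : _ :&: _ = set0) ?cards0; first by move: c2; lia.
    apply/setP=> f; rewrite !inE; apply/negP=> /andP[Sf /orP[]/eqP ef].
      by case/negP: nSh; rewrite -[X in X \in S](_ : f - 1%:R = _) // ef /nxt; ring.
    by case/negP: nSg; rewrite -[X in X \in S](_ : f - 1%:R = _) // ef /nxt; ring.
  apply/subset_leq_card; rewrite subUset leq_window //=.
  apply/subsetP=> f /set2P[]->; apply/windowP; exists 2%N => //;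
  by rewrite addrK.
have down t : (t.+1 < m.+2)%N -> h - t.+1%:R \in S -> h - t%:R \in S.
  move=> tM St; apply/negPn/negP=> nSt.
  have e1 : h - t.+1%:R + 1 = h - t%:R by rewrite -natr1; ring.
  have := runE _ St; rewrite e1 => /(_ nSt)/eqP; apply/negP; rewrite eq_sym.
  by apply: (@shift_neq t.+1); [lia | ring].
have down' t u : (u <= t)%N -> (t < m.+2)%N -> h - t%:R \in S ->
    h - u%:R \in S.
  move=> + + ; elim: t => [|t IH]; first by rewrite leqn0 => /eqP->.
  rewrite leq_eqVlt => /orP[/eqP->//|ut] tM /(down _ tM).
  by apply: IH => //; apply: ltnW.
have cS : #|S| = #|[set t : 'I_m.+2 | h - (t : nat)%:R \in S]|.
  have inj : injective (fun t : 'I_m.+2 => h - t) by move=> t u /addrI/oppr_inj.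
  rewrite -(card_imset _ inj); apply: eq_card => f.
  apply/idP/imsetP => [Sf|[t]]; last by rewrite inE natr_Zp => St ->.
  by exists (h - f); rewrite ?inE ?natr_Zp; [move: Sf; congr in_mem|]; ring.
(* By [down'] the t with h - t in S form an initial segment, so their number decides membership. *)
have memS t : (t < m.+2)%N -> (h - t%:R \in S) = (t < #|S|)%N.
  move=> tM; rewrite cS; set P := [set u : 'I_m.+2 | _].
  have cP v : (v <= m.+2)%N -> #|[set u : 'I_m.+2 | (u < v)%N]| = v.
    move=> vM; rewrite -sum1_card -[RHS](card_ord v) -sum1_card.
    by rewrite (big_ord_widen _ (fun=> 1%N) vM); apply: eq_bigl => u; rewrite inE.
  have [St|nSt] := boolP (h - t%:R \in S); apply/esym.
    rewrite -[t.+1](cP _ tM); apply/subset_leq_card/subsetP=> u.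
    by rewrite !inE ltnS => ut; apply: down' St.
  apply/negbTE; rewrite -leqNgt -[leqRHS](cP t (ltnW tM)).
  apply/subset_leq_card/subsetP=> u; rewrite !inE => Su; rewrite ltnNge.
  by apply: contra nSt => tu; apply: down' Su.
exists h; split=> // t tM.
rewrite {1}defT inE; case: windowP => [[u uw Su]|nW]; apply/esym.
  apply/negP=> /andP[wt tS]; move: Su.
  have -> : h + t%:R - u%:R = h - (m.+2 - t + u)%N%:R.
    by rewrite natrD natrB ?natr_size; [ring|lia].
  by rewrite memS; lia.
have wt: (w < t)%N.
  by rewrite ltnNge; apply/negP=> tw; apply: nW; exists t; [lia|rewrite addrK].
rewrite wt /= leqNgt; apply/negP=> tS; apply: nW.
exists 1%N; first lia.
have -> : h + t%:R - 1%:R = h - (m.+2 - t + 1)%N%:R.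
  by rewrite natrD natrB ?natr_size; [ring|lia].
by rewrite memS; rlia.
Qed.

End CyclicIndices.

(** * Walks, cycles and detours *)

Section Walks.
Variables (V : finType) (e : rel V).
Implicit Types (y z : V) (s : seq V).

Definition walk y z s :=
  if s is y0 :: q then [&& y0 == y, path e y0 q & last y0 q == z] else false.

Lemma walkP y z s :
  reflect (exists q, [/\ s = y :: q, path e y q & last y q = z]) (walk y z s).
Proof.
case: s => [|y0 q] /=; first by constructor=> -[q []].
apply: (iffP and3P) => [[/eqP-> pq /eqP lq]|[_ [[-> <-]] pq lq]].
  by exists q.
by rewrite eqxx pq lq.
Qed.

Lemma walk1 y : walk y y [:: y].
Proof. by rewrite /= !eqxx. Qed.

Lemma walk_cat y z s y' z' s' :
  walk y z s -> e z y' -> walk y' z' s' -> walk y z' (s ++ s').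
Proof.
move=> /walkP[q [-> pq lq]] ezy /walkP[q' [-> pq' lq']]; apply/walkP.
by exists (q ++ y' :: q'); rewrite cat_path last_cat pq lq /= ezy.
Qed.

Lemma walk_cons y y' z s : e y y' -> walk y' z s -> walk y z (y :: s).
Proof. by move=> eyy' ws; apply: (walk_cat (walk1 y) eyy' ws). Qed.

Lemma walk_rcons y z s z' : walk y z s -> e z z' -> walk y z' (rcons s z').
Proof. by move=> ws ezz'; rewrite -cats1; apply: walk_cat ws ezz' (walk1 _). Qed.

Lemma walk_cycle y z s : walk y z s -> e z y -> cycle e s.
Proof. by move=> /walkP[q [-> pq lq]] ezy; rewrite /= rcons_path pq lq. Qed.

Lemma walk_head y z s : walk y z s -> y \in s.
Proof. by case/walkP=> q [-> _ _]; rewrite mem_head. Qed.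

Lemma walk_last y z s : walk y z s -> z \in s.
Proof. by case/walkP=> q [-> _ <-]; rewrite mem_last. Qed.

Lemma longest_walk (R : {set V}) v : v \in R -> exists a b l,
  [/\ walk a b l, uniq l, {subset l <= R}
    & forall a' b' l', walk a' b' l' -> uniq l' -> {subset l' <= R} ->
        (size l' <= size l)%N].
Proof.
move=> Rv; pose P n := [exists t : n.-tuple V,
  [&& uniq t, all (mem R) t & sorted e t]].
have PP a b l : walk a b l -> uniq l -> {subset l <= R} -> P (size l).
  move=> /walkP[q [el pq lq]] ul lR; apply/existsP; exists (in_tuple l).
  by apply/and3P; split=> //; [apply/allP => z /lR | rewrite /= el].
have P1 : P 1%N.
  by apply: (PP v v [:: v]); rewrite ?walk1 // => z; rewrite inE => /eqP->.
have Pb n : P n -> (n <= #|R|)%N.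
  case/existsP=> t /and3P[ut /allP aR _]; rewrite -(size_tuple t).
  by rewrite -(card_uniqP ut); apply/subset_leq_card/subsetP.
have [n Pn maxn] := ex_maxnP (ex_intro P _ P1) Pb.
case/existsP: Pn => t /and3P[ut /allP aR st].
have [a [q eq]] : exists a q, tval t = a :: q.
  by case: (tval t) (size_tuple t) (maxn _ P1) => [<-//|a q _ _]; exists a, q.
exists a, (last a q), t; split=> //.
  by apply/walkP; exists q; split=> //; move: st; rewrite eq.
by move=> a' b' l' w' u' /(PP _ _ _ w' u')/maxn; rewrite size_tuple.
Qed.

(** [has_cycle] for a bare relation, so that it also applies to the converse. *)
Definition cyc (L : nat) := exists c : seq V, size c = L /\ ucycle e c.

Lemma walk_cyc y z s : walk y z s -> e z y -> uniq s -> cyc (size s).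
Proof.
by move=> ws ezy us; exists s; split=> //; apply/andP; rewrite (walk_cycle ws).
Qed.

Section CycleFun.
Variable m : nat.
Implicit Types x : 'I_m.+2 -> V.

Definition cycle_fun x := injective x /\ forall i, e (x i) (x (i + 1)).

Definition pts x (i : 'I_m.+2) (l : seq nat) := [seq x (i + t%:R) | t <- l].

Lemma size_pts x i l : size (pts x i l) = size l.
Proof. exact: size_map. Qed.

Lemma walk_pts x i u n :
    cycle_fun x ->
  walk (x (i + u%:R)) (x (i + (u + n)%:R)) (pts x i (iota u n.+1)).
Proof.
move=> [_ ex]; elim: n u => [|n IH] u; first by rewrite addn0 walk1.
rewrite -addSnnS; apply: walk_cons (IH u.+1).
by rewrite -natr1 addrA; apply: ex.
Qed.

Lemma uniq_pts x i l :
  cycle_fun x -> uniq l -> all (fun t => t < m.+2)%N l -> uniq (pts x i l).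
Proof.
move=> [injx _] ul /allP lM; rewrite map_inj_in_uniq // => t u lt lu.
move/injx/addrI => tu; apply/eqP; rewrite -(natr_ord_inj (lM t lt) (lM u lu)).
exact/eqP.
Qed.

Lemma fun_of_ucycle c :
    size c = m.+2 -> ucycle e c ->
  exists2 x, cycle_fun x & codom x =i c.
Proof.
move=> sc /andP[cc uc]; have [v0 v0c] : exists v, v \in c.
  by case: c sc {cc uc} => // v c _; exists v; rewrite mem_head.
exists (fun i => nth v0 c i); first split.
- by move=> i j /eqP; rewrite nth_uniq ?sc // => /eqP/val_inj.
- case: c sc cc uc v0c => // w c [sc] /(pathP v0) cc _ _ i.
  have -> : (i + 1)%R = (i.+1 %% m.+2)%N :> nat.
    by rewrite /= (modn_small (_ : 1 < m.+2)%N) ?addn1.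
  have := cc i; rewrite size_rcons sc ltn_ord => /(_ isT).
  rewrite -rcons_cons !nth_rcons /= sc ltn_ord.
  have := ltn_ord i; rewrite ltnS leq_eqVlt => /orP[/eqP ei|lt_i].
    by rewrite ei modnn ltnn eqxx.
  by rewrite lt_i modn_small.
move=> v; apply/codomP/idP => [[i ->]|vc]; first by rewrite mem_nth ?sc.
have vM : (index v c < m.+2)%N by rewrite -sc index_mem.
by exists (Ordinal vM); rewrite nth_index.
Qed.

Lemma notin_codom x z i : z \notin codom x -> (x i == z) = false.
Proof.
by move=> zx; apply: contraNF zx => /eqP<-; apply: codom_f.
Qed.

Lemma pts_disjoint x i l s :
  {in s, forall z, z \notin codom x} -> ~~ has (mem (pts x i l)) s.
Proof.
move=> sx; apply/hasPn=> z /sx; apply: contra => /mapP[t _ ->].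
exact: codom_f.
Qed.

(* Replaces the d - 1 vertices strictly between x_i and x_(i+d) by s. *)
Lemma detour x i (d : nat) y z s :
    cycle_fun x -> (0 < d <= m.+2)%N -> walk y z s -> uniq s ->
    {in s, forall v, v \notin codom x} -> e (x i) y -> e z (x (i + d%:R)) ->
  cyc (m.+3 - d + size s).
Proof.
move=> cx dM ws us sx exy ezx.
(* The kept part runs from x_(i+d) to x_i. Counted from i + 1, its offsets are d.-1,...,m.+1 and do
   not wrap around. *)
have ed : i + d%:R = i + 1 + (d.-1)%:R.
  by rewrite -addrA nat1r prednK //; lia.
have ei : i = i + 1 + (d.-1 + (m.+2 - d))%N%:R.
  rewrite (_ : (d.-1 + _)%N = m.+1); last lia.
  by rewrite natr_pred addrK.
have := walk_pts (i + 1) d.-1 (m.+2 - d) cx; rewrite -ed -ei => wp.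
have -> : (m.+3 - d + size s)%N =
          size (pts x (i + 1) (iota d.-1 (m.+2 - d).+1) ++ s).
  by rewrite size_cat size_pts size_iota; lia.
apply: (walk_cyc (walk_cat wp exy ws) ezx).
rewrite cat_uniq us andbT pts_disjoint // andbT; apply: uniq_pts => //.
  exact: iota_uniq.
by apply/allP=> t; rewrite mem_iota; lia.
Qed.

Lemma walk_around x i : cycle_fun x ->
  exists l, [/\ walk (x (i + 1)) (x i) l, uniq l, size l = m.+2
               & {subset l <= codom x}].
Proof.
move=> cx; exists (pts x (i + 1) (iota 0 m.+2)); split.
- have := walk_pts (i + 1) 0 m.+1 cx.
  by rewrite addr0 add0n natr_pred addrK.
- by apply: uniq_pts; rewrite ?iota_uniq //; apply/allP=> t; rewrite mem_iota.
- by rewrite size_pts size_iota.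
- by move=> v /mapP[t _ ->]; apply: codom_f.
Qed.

(** Serves two purposes: on C it makes room for an insertion, and on a Hamiltonian cycle of the
    outside it gives the walk that is one vertex shorter than [walk_around] with the same ends. *)
Lemma walk_skip x i j :
    cycle_fun x -> j != i -> j != i + 1 -> e (x (j - 1)) (x (j + 1)) ->
  exists l, [/\ walk (x (i + 1)) (x i) l, uniq l, size l = m.+1
               & {subset l <= codom x}].
Proof.
move=> cx ji ji1 ej; have [t tM ejt] := ord_shift (i + 1) j.
have t0 : (0 < t)%N.
  by rewrite lt0n; apply: contraNneq ji1 => t0; rewrite ejt t0 addr0.
have tM1 : (t < m.+1)%N.
  rewrite ltn_neqAle -ltnS tM andbT; apply: contraNneq ji => et.
  by rewrite ejt et natr_pred addrK.
have w1 := walk_pts (i + 1) 0 t.-1 cx; rewrite addr0 in w1.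
have w2 := walk_pts (i + 1) t.+1 (m - t) cx.
have e1 : i + 1 + (0 + t.-1)%N%:R = j - 1.
  by rewrite ejt add0n -{2}(prednK t0) -natr1; ring.
have e2 : i + 1 + t.+1%:R = j + 1 by rewrite ejt -natr1; ring.
have e3 : i + 1 + (t.+1 + (m - t))%N%:R = i.
  rewrite (_ : (t.+1 + _)%N = m.+1); last by move: tM1; clear; lia.
  by rewrite natr_pred addrK.
rewrite e1 in w1; rewrite e2 e3 in w2.
exists (pts x (i + 1) (iota 0 t.-1.+1 ++ iota t.+1 (m - t).+1)); split.
- by rewrite /pts map_cat; apply: walk_cat w1 ej w2.
- apply: uniq_pts => //; move: t0 tM1; clear => t0 tM1.
    rewrite cat_uniq !iota_uniq andbT andTb; apply/hasPn=> u.
    by rewrite !mem_iota; lia.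
  by apply/allP=> u; rewrite mem_cat !mem_iota; lia.
- by rewrite size_pts size_cat !size_iota; move: t0 tM1; clear; lia.
- by move=> v /mapP[u _ ->]; apply: codom_f.
Qed.

(* Omits x_j and inserts s between x_i and x_(i+1). *)
Lemma skip_insert x i j y z s :
    cycle_fun x -> j != i -> j != i + 1 -> e (x (j - 1)) (x (j + 1)) ->
    walk y z s -> uniq s -> {in s, forall v, v \notin codom x} ->
    e (x i) y -> e z (x (i + 1)) ->
  cyc (m.+1 + size s).
Proof.
move=> cx ji ji1 ej ws us sx exy ezx.
have [l [wl ul sl lx]] := walk_skip cx ji ji1 ej.
rewrite -sl -size_cat; apply: (walk_cyc (walk_cat wl exy ws) ezx).
rewrite cat_uniq ul us andbT; apply/hasPn=> v /sx; apply: contra.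
exact: lx.
Qed.

End CycleFun.
End Walks.

(** * Degrees split between a cycle and its outside *)

Section Degrees.
Variables (V : finType) (e : rel V).

Definition outs (v : V) : {set V} := [set w : V | e v w].
Definition ins (v : V) : {set V} := [set w : V | e w v].

(** The hypotheses of the theorem with s = floor((p-1)/2), which is p/2-1 rounded up for either
    parity of p. They are put on a relation so that they pass to the converse. *)
Definition dense (s : nat) :=
  [/\ irreflexive e, (1 < s)%N, (s.*2 < #|V| <= s.*2.+2)%N,
      forall v, (s <= #|outs v|)%N /\ (s <= #|ins v|)%N
    & forall v, (#|V| <= (#|outs v| + #|ins v|).+1)%N].

Variable m : nat.
Implicit Types (x : 'I_m.+2 -> V) (v : V).

Definition inC x v : {set 'I_m.+2} := [set i : 'I_m.+2 | e (x i) v].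
Definition outC x v : {set 'I_m.+2} := [set i : 'I_m.+2 | e v (x i)].
Definition rest x : {set V} := [set v : V | v \notin codom x].

Lemma in_inC x v i : (i \in inC x v) = e (x i) v.
Proof. by rewrite /inC inE. Qed.

Lemma in_outC x v i : (i \in outC x v) = e v (x i).
Proof. by rewrite /outC inE. Qed.

Lemma card_split x (A : {set V}) : injective x ->
  #|A| = (#|[set i : 'I_m.+2 | x i \in A]| + #|A :&: rest x|)%N.
Proof.
move=> injx; rewrite -(cardsID (rest x) A) addnC; congr (_ + _)%N.
rewrite -(card_imset _ injx); congr #|pred_of_set _|; apply/setP=> v.
rewrite !inE negbK; apply/andP/imsetP => [[/codomP[i ->] Ai]|[i Ai ->]].
  by exists i; rewrite ?inE.
by rewrite codom_f; move: Ai; rewrite inE.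
Qed.

Lemma card_ins x v : injective x ->
  #|ins v| = (#|inC x v| + #|ins v :&: rest x|)%N.
Proof.
move=> /card_split->; congr (#|pred_of_set _| + _)%N.
by apply/setP=> i; rewrite !inE.
Qed.

Lemma card_outs x v : injective x ->
  #|outs v| = (#|outC x v| + #|outs v :&: rest x|)%N.
Proof.
move=> /card_split->; congr (#|pred_of_set _| + _)%N.
by apply/setP=> i; rewrite !inE.
Qed.

Lemma card_rest x : injective x -> (#|rest x| + m.+2 = #|V|)%N.
Proof.
move=> injx; rewrite -cardsT (card_split setT injx) setTI addnC; congr (_ + _)%N.
rewrite -[LHS](card_ord m.+2) -cardsT; congr #|pred_of_set _|.
by apply/setP=> i; rewrite !inE.
Qed.

End Degrees.

(** * The converse relation *)

Definition conv (V : Type) (e : rel V) : rel V := fun u v => e v u.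

Section Converse.
Variables (V : finType) (e : rel V).

Lemma dense_conv s : dense e s -> dense (conv e) s.
Proof.
case=> irr s1 sV semi deg; split=> // [v|v].
  by have [] := semi v.
by rewrite addnC; apply: deg.
Qed.

Lemma cyc_conv L : cyc (conv e) L -> cyc e L.
Proof.
move=> [c [sc /andP[cc uc]]]; exists (rev c); rewrite size_rev; split=> //.
by rewrite /ucycle rev_cycle rev_uniq uc andbT.
Qed.

Lemma cycle_fun_conv m (x : 'I_m.+2 -> V) :
  cycle_fun e x -> cycle_fun (conv e) (fun i => x (- i)).
Proof.
case=> injx ex; split=> [i j /injx/oppr_inj //|i].
by rewrite /conv opprD; have := ex (- i - 1); rewrite subrK.
Qed.

Lemma codom_opp m (x : 'I_m.+2 -> V) : codom (fun i => x (- i)) =i codom x.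
Proof.
move=> v; apply/codomP/codomP => [[i ->]|[i ->]]; first by exists (- i).
by exists (- i); rewrite opprK.
Qed.

End Converse.

(** * Exchanging cycle vertices with outside vertices *)

Section Updates.
Variables (V : finType) (e : rel V) (m : nat).
Implicit Types (x : 'I_m.+2 -> V) (a b : V) (i j : 'I_m.+2).

Definition upd x i a := fun j => if j == i then a else x j.

Lemma upd_eq x i a : upd x i a i = a.
Proof. by rewrite /upd eqxx. Qed.

Lemma upd_neq x i a j : j != i -> upd x i a j = x j.
Proof. by rewrite /upd => /negbTE->. Qed.

Lemma upd_inj x i a : injective x -> a \notin codom x -> injective (upd x i a).
Proof.
move=> injx ax j h; rewrite /upd; case: eqP => [->|_]; case: eqP => [->|_] //.
- by move/esym/eqP; rewrite notin_codom.
- by move/eqP; rewrite notin_codom.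
- exact: injx.
Qed.

Lemma upd_codom x i a v : injective x ->
  (v \notin codom (upd x i a)) = (v != a) && ((v \notin codom x) || (v == x i)).
Proof.
move=> injx; apply/idP/andP => [vx|[va vx]].
  split.
    by apply: contraNneq vx => ->; apply/codomP; exists i; rewrite upd_eq.
  apply/orP; have [/codomP[j ej]|] := boolP (v \in codom x); last by left.
  right; rewrite ej; apply: contraR vx => ij; rewrite ej.
  apply/codomP; exists j; rewrite upd_neq //.
  by apply: contraNneq ij => ->.
apply/negP=> /codomP[j]; rewrite /upd; case: eqP => [_|/eqP ji ev].
  exact/eqP.
by move: vx; rewrite ev codom_f (inj_eq injx) (negbTE ji).
Qed.

Lemma cycle_upd x i a :
    cycle_fun e x -> a \notin codom x ->
    e (x (i - 1)) a -> e a (x (i + 1)) ->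
  cycle_fun e (upd x i a).
Proof.
move=> [injx ex] ax exa eax; split; first exact: upd_inj.
move=> j; rewrite /upd; case: eqP => [->|_].
  case: eqP => // /eqP; rewrite -subr_eq0 addrAC subrr add0r.
  by rewrite oner_eq0.
case: eqP => [ej|_]; last exact: ex.
by move: exa; rewrite -ej addrK.
Qed.

(** For m = 0 the position i + 2 would be i itself, which is overwritten by a. *)
Lemma cycle_upd2 x i a b : (0 < m)%N ->
    cycle_fun e x -> a \notin codom x -> b \notin codom x -> a != b ->
    e (x (i - 1)) a -> e a b -> e b (x (i + 2%:R)) ->
  cycle_fun e (upd (upd x i a) (i + 1) b).
Proof.
move=> m0 [injx ex] ax bx ab exa eab ebx.
have i1i : i + 1 != i by apply: (@shift_neq _ 1) => //; ring.
split.
  apply: upd_inj; first exact: upd_inj.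
  by rewrite upd_codom // eq_sym ab bx.
move=> j; rewrite {1}/upd; case: eqP => [->|ji1].
  rewrite upd_neq; last by apply: (@shift_neq _ 1) => //; ring.
  rewrite upd_neq; last by apply: (@shift_neq _ 2) => //; ring.
  by rewrite -addrA.
rewrite {1}/upd; case: eqP => [->|ji]; first by rewrite upd_eq.
rewrite upd_neq; last by apply/eqP => /addIr.
have [ej|ji'] := eqVneq (j + 1) i.
  by rewrite ej upd_eq; move: exa; rewrite -ej addrK.
by rewrite upd_neq.
Qed.

End Updates.

(** * Cycles of length p-2 *)

Section Pairs.
Variables (V : finType) (e : rel V) (s m : nat).
Hypotheses (De : dense e s) (cV : #|V| = m.+4) (nocyc : ~ cyc e m.+3).
Implicit Types (x : 'I_m.+2 -> V) (a b : V) (i j : 'I_m.+2).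

Definition config x a b :=
  [/\ cycle_fun e x, a \notin codom x, b \notin codom x & a != b].

Lemma config_sym x a b : config x a b -> config x b a.
Proof. by case=> cx ax bx ab; split; rewrite // eq_sym. Qed.

Lemma order_bounds : [/\ (1 < s)%N, (s.*2 <= m.+3)%N & (m.+2 <= s.*2)%N].
Proof. by case: De => _ s1; rewrite cV => /andP[h1 h2] _ _; split. Qed.

Lemma m_gt0 : (0 < m)%N.
Proof. by have [] := order_bounds; lia. Qed.

Lemma config_rest x a b : config x a b -> rest x = [set a; b].
Proof.
case=> [[injx _]] ax bx ab; apply/esym/eqP; rewrite eqEcard cards2 ab.
rewrite subUset !sub1set !inE ax bx /=.
by have := card_rest injx; rewrite cV; lia.
Qed.

Lemma card_ins_config x a b : config x a b ->
  #|ins e a| = (#|inC e x a| + e b a)%N.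
Proof.
move=> C; have [irr _ _ _ _] := De; have [[injx _] _ _ ab] := C.
rewrite (card_ins _ _ injx) (config_rest C); congr (_ + _)%N.
rewrite setIUr cardsU; set A := _ :&: [set a]; set B := _ :&: [set b].
have A0 : A = set0.
  by apply/setP=> v; rewrite !inE; case: eqP => [->|_]; rewrite ?irr ?andbF.
rewrite A0 set0I cards0 add0n subn0 /B; case eba: (e b a).
  by rewrite (setIidPr _) ?cards1 // sub1set inE.
apply/eqP; rewrite cards_eq0 -subset0; apply/subsetP=> v; rewrite !inE.
by case/andP=> + /eqP ev; rewrite ev eba.
Qed.

Lemma card_outs_config x a b : config x a b ->
  #|outs e a| = (#|outC e x a| + e a b)%N.
Proof.
move=> C; have [irr _ _ _ _] := De; have [[injx _] _ _ ab] := C.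
rewrite (card_outs _ _ injx) (config_rest C); congr (_ + _)%N.
rewrite setIUr cardsU; set A := _ :&: [set a]; set B := _ :&: [set b].
have A0 : A = set0.
  by apply/setP=> v; rewrite !inE; case: eqP => [->|_]; rewrite ?irr ?andbF.
rewrite A0 set0I cards0 add0n subn0 /B; case eba: (e a b).
  by rewrite (setIidPr _) ?cards1 // sub1set inE.
apply/eqP; rewrite cards_eq0 -subset0; apply/subsetP=> v; rewrite !inE.
by case/andP=> + /eqP ev; rewrite ev eba.
Qed.

Lemma config_semi x a b : config x a b ->
  (s <= #|inC e x a| + e b a)%N /\ (s <= #|outC e x a| + e a b)%N.
Proof.
move=> C; rewrite -(card_ins_config C) -(card_outs_config C).
by have [_ _ _ /(_ a)[]] := De.
Qed.

Lemma config_deg x a b : config x a b ->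
  (m.+3 <= #|inC e x a| + #|outC e x a| + e a b + e b a)%N.
Proof.
move=> C; have [_ _ _ _ /(_ a)] := De.
by rewrite (card_ins_config C) (card_outs_config C) cV; lia.
Qed.

(** Three ways to gain exactly one vertex over the length m.+2 are excluded from here on: inserting
    one vertex, replacing one by two, and inserting two while skipping one. *)
Lemma no_insert x a i : cycle_fun e x -> a \notin codom x ->
  e (x i) a -> ~~ e a (x (i + 1)).
Proof.
move=> cx ax exa; apply/negP=> eax; apply: nocyc.
rewrite (_ : m.+3 = m.+3 - 1 + size [:: a])%N; last by rewrite /=; lia.
apply: (detour (d := 1%N) cx _ (walk1 e a) _ _ exa eax) => //.
by move=> v; rewrite inE => /eqP->.
Qed.

Lemma walk2 a b : e a b -> walk e a b [:: a; b].
Proof. by move=> eab; rewrite /= eab !eqxx. Qed.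

Lemma no_replace x a b i : config x a b ->
  e a b -> e (x i) a -> ~~ e b (x (i + 2%:R)).
Proof.
move=> [cx ax bx ab] eab exa; apply/negP=> ebx; apply: nocyc.
rewrite (_ : m.+3 = m.+3 - 2 + size [:: a; b])%N; last by rewrite /=; lia.
apply: (detour (d := 2%N) cx _ (walk2 eab) _ _ exa ebx) => //=; first by rewrite inE ab.
by move=> v; rewrite !inE => /orP[]/eqP->.
Qed.

Lemma no_skip x a b i j : config x a b ->
    e a b -> e (x i) a -> e b (x (i + 1)) -> j != i -> j != i + 1 ->
  ~~ e (x (j - 1)) (x (j + 1)).
Proof.
move=> [cx ax bx ab] eab exa ebx ji ji1; apply/negP=> ej; apply: nocyc.
rewrite (_ : m.+3 = m.+1 + size [:: a; b])%N; last by rewrite /=; lia.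
apply: (skip_insert cx ji ji1 ej (walk2 eab) _ _ exa ebx) => //=.
  by rewrite inE ab.
by move=> v; rewrite !inE => /orP[]/eqP->.
Qed.

Lemma config_upd x a b i : config x a b ->
    e (x (i - 1)) a -> e a (x (i + 1)) ->
  config (upd x i a) (x i) b.
Proof.
move=> [cx ax bx ab] exa eax; split.
- exact: cycle_upd.
- by case: cx => injx _; rewrite upd_codom // eqxx orbT andbT notin_codom.
- by case: cx => injx _; rewrite upd_codom // bx eq_sym ab.
- by rewrite notin_codom.
Qed.

Lemma config_upd2 x a b i : config x a b ->
    e (x (i - 1)) a -> e a b -> e b (x (i + 2%:R)) ->
  config (upd (upd x i a) (i + 1) b) (x i) (x (i + 1)).
Proof.
move=> [cx ax bx ab] exa eab ebx.
have i1i : i + 1 != i by apply: (@shift_neq _ 1) => //; ring.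
have [injx _] := cx.
have bux : b \notin codom (upd x i a) by rewrite upd_codom // eq_sym ab bx.
have injux : injective (upd x i a) by apply: upd_inj.
split.
- exact: (cycle_upd2 m_gt0).
- rewrite upd_codom // upd_codom // eqxx orbT andbT.
  by rewrite notin_codom // notin_codom.
- rewrite upd_codom // upd_neq // eqxx orbT andbT.
  by rewrite notin_codom.
- by rewrite (inj_eq injx) eq_sym.
Qed.

End Pairs.

Lemma double_run m (S : {set 'I_m.+2}) i j :
    i \in S -> i + 1 \in S -> j \notin S ->
  exists h, [/\ h - 1 \in S, h \in S & h + 1 \notin S].
Proof.
move=> Si Si1 nSj.
have [||h /andP[/andP[Sh1 Sh]]] :=
  @cyclic_change m (fun l => (l - 1 \in S) && (l \in S)) (i + 1) j.
- by rewrite addrK Si.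
- by rewrite negb_and nSj orbT.
by rewrite addrK Sh => nSh; exists h.
Qed.

Lemma alternating m (S : {set 'I_m.+2}) :
    (forall i, i \in S -> i + 1 \notin S) -> (#|S|.*2 = m.+2)%N ->
  forall i, (i + 1 \in S) = (i \notin S).
Proof.
move=> nd cS i; have Si1 : i \in S -> i + 1 \notin S by apply: nd.
apply/idP/idP => [Si|nSi]; first by apply: contraL Si.
suff /setP/(_ (i + 1)) : S :|: shift_set 1 S = setT.
  by rewrite in_setU in_setT in_shift_set addrK (negbTE nSi) orbF.
apply/eqP; rewrite eqEcard subsetT cardsT card_ord cardsU card_shift_set.
rewrite (_ : S :&: _ = set0) ?cards0; first by move: cS; rlia.
apply/setP=> j; rewrite in_setI in_set0 in_shift_set; apply/negP=> /andP[Sj /nd].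
by rewrite subrK Sj.
Qed.

(** Containment in K*_(n,n), given by one side of the bipartition. *)
Definition bipart (V : finType) (e : rel V) :=
  exists2 X : {set V}, (#|X|.*2 = #|V|)%N &
    forall u v, e u v -> (u \in X) != (v \in X).

(** * Two outside vertices joined by a single arc *)

Section SingleArc.
Variables (V : finType) (e : rel V) (s m : nat).
Hypotheses (De : dense e s) (cV : #|V| = m.+4) (nocyc : ~ cyc e m.+3).
Implicit Types (x : 'I_m.+2 -> V) (a b : V) (i j : 'I_m.+2).

(** [P] holds the possible neighbours of [a], so one side is [b] with the positions in [P] and the
    other is [a] with the rest. *)
Lemma bipart_config x a b (P : {set 'I_m.+2}) :
    config e x a b -> (#|P|.*2 = m.+2)%N ->
    inC e x a \subset P -> outC e x a \subset P ->
    inC e x b \subset ~: P -> outC e x b \subset ~: P ->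
    (forall i j, e (x i) (x j) -> (i \in P) != (j \in P)) ->
  bipart e.
Proof.
move=> C cP /subsetP ia /subsetP oa /subsetP ib /subsetP ob noP.
have [[injx _] ax bx ab] := C; have [irr _ _ _ _] := De.
have xP i : (x i \in b |: [set x j | j in P]) = (i \in P).
  by rewrite !inE notin_codom // mem_imset.
have bP : b \in b |: [set x j | j in P] by rewrite setU11.
have aP : a \notin b |: [set x j | j in P].
  rewrite !inE negb_or ab; apply: contra ax => /imsetP[j _ ->].
  exact: codom_f.
exists (b |: [set x j | j in P]).
  rewrite cardsU1 card_imset // cV.
  have -> : b \notin [set x j | j in P].
    by apply: contra bx => /imsetP[j _ ->]; apply: codom_f.
  by rlia.
have cases v : [\/ exists i, v = x i, v = a | v = b].
  have [/codomP[i ->]|vx] := boolP (v \in codom x).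
    by constructor 1; exists i.
  have : v \in rest x by rewrite inE.
  rewrite (config_rest cV C) => /set2P[]->; first by constructor 2.
  by constructor 3.
move=> u v; case: (cases u) => [[i ->]|->|->]; case: (cases v) => [[j ->]|->|->];
  rewrite ?xP ?bP ?(negbTE aP) ?irr //.
- exact: noP.
- by rewrite -in_inC => /ia->.
- by rewrite -in_inC => /ib; rewrite inE => /negbTE->.
- by rewrite -in_outC => /oa->.
- by rewrite -in_outC => /ob; rewrite inE => /negbTE->.
Qed.

Section Exact.
Variables (x : 'I_m.+2 -> V) (a b : V).
Hypotheses (C : config e x a b) (eab : e a b) (neba : ~~ e b a).

(** With one arc between them, a and b each have at least m.+2 arcs to and from the cycle, and at
    most m.+2 by [no_insert]. The in-degree of a and the out-degree of b are at least s on the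
    cycle, and their sum is at most m.+2 by [no_replace]. So all three inclusions are equalities. *)
Lemma single_exact :
  [/\ (s.*2 = m.+2)%N, #|inC e x a| = s,
      forall i, e a (x (i + 1)) = ~~ e (x i) a,
      forall i, e (x (i + 1)) b = e (x i) a
    & forall i, e b (x (i + 2%:R)) = ~~ e (x i) a].
Proof.
have [s1 s2 s3] := order_bounds De cV.
have [Sa _] := config_semi De cV C.
have [_ Sb] := config_semi De cV (config_sym C).
have da := config_deg De cV C; have db := config_deg De cV (config_sym C).
have [cx ax bx ab] := C.
rewrite eab (negbTE neba) in Sa Sb da db.
have outa : outC e x a \subset ~: shift_set 1 (inC e x a).
  apply/subsetP=> i; rewrite in_setC in_shift_set in_outC in_inC => eai.
  by apply: contraL eai => /(no_insert cV nocyc cx ax); rewrite subrK.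
have outb1 : outC e x b \subset ~: shift_set 1 (inC e x b).
  apply/subsetP=> i; rewrite in_setC in_shift_set in_outC in_inC => eai.
  by apply: contraL eai => /(no_insert cV nocyc cx bx); rewrite subrK.
have outb2 : outC e x b \subset ~: shift_set 2 (inC e x a).
  apply/subsetP=> i; rewrite in_setC in_shift_set in_outC in_inC => ebi.
  by apply: contraL ebi => /(no_replace cV nocyc C eab); rewrite subrK.
have c1 := subset_leq_card outa; have c2 := subset_leq_card outb1.
have c3 := subset_leq_card outb2.
have d1 := cardsC (shift_set 1 (inC e x a)).
have d2 := cardsC (shift_set 1 (inC e x b)).
have d3 := cardsC (shift_set 2 (inC e x a)).
rewrite !card_shift_set card_ord in d1 d2 d3.
have defa : outC e x a = ~: shift_set 1 (inC e x a).
  by apply/eqP; rewrite eqEcard outa; rlia.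
have defb1 : outC e x b = ~: shift_set 1 (inC e x b).
  by apply/eqP; rewrite eqEcard outb1; rlia.
have defb2 : outC e x b = ~: shift_set 2 (inC e x a).
  by apply/eqP; rewrite eqEcard outb2; rlia.
split; [by rlia|by rlia| move=> i..].
- by rewrite -in_outC defa in_setC in_shift_set in_inC addrK.
- rewrite -in_inC -[i + 1](addrK 1%:R) -in_shift_set -[shift_set _ _]setCK.
  rewrite -defb1 defb2 setCK in_shift_set in_inC.
  by congr (e (x _) _); ring.
- by rewrite -in_outC defb2 in_setC in_shift_set in_inC addrK.
Qed.

End Exact.

(** Exchanging x_(i+1) with a gives another pair joined by a single arc, x_(i+1) -> b. Comparing its
    exact neighbourhoods with the old ones yields a chord skipping x_i or x_(i+2), while ab can be
    inserted elsewhere. *)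
Lemma single_no_double x a b i : config e x a b -> e a b -> ~~ e b a ->
  e (x (i - 1)) a -> e (x i) a -> ~~ e (x (i + 1)) a -> False.
Proof.
move=> C eab neba Si1 Si nSi1.
have [s1 _ _] := order_bounds De cV.
have [es cS aE bE b'E] := single_exact C eab neba.
have neq (c : nat) k l : (0 < c < 4)%N -> k - l = c%:R -> k != l :> 'I_m.+2.
  by move=> c4; apply: shift_neq; lia.
have Cu : config e (upd x (i + 1) a) (x (i + 1)) b.
  apply: (config_upd C); first by rewrite addrK.
  by rewrite aE.
have eub : e (x (i + 1)) b by rewrite bE.
have nebu : ~~ e b (x (i + 1)).
  by rewrite (_ : i + 1 = i - 1 + 2%:R) ?b'E ?Si1 //; ring.
have [_ _ uE buE _] := single_exact Cu eub nebu.
have [Si2|nSi2] := boolP (e (x (i + 2%:R)) a).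
  apply: (negP (@no_skip _ _ _ cV nocyc x a b (i + 2%:R) i C eab Si2 _ _ _)).
  - have -> : i + 2%:R + 1 = i + 1 + 2%:R by ring.
    by rewrite b'E.
  - by rewrite eq_sym; apply: (@neq 2); [|ring].
  - by rewrite eq_sym; apply: (@neq 3); [|ring].
  have := buE (i - 1); rewrite subrK !upd_neq.
  - by rewrite -{1}[i](subrK 1) bE Si1.
  - by rewrite eq_sym; apply: (@neq 2); [|ring].
  - by rewrite eq_sym; apply: (@neq 1%N); [|ring].
(* At the start j + 1 of a run, ab fits between x_(j+1) and x_(j+2): b dominates x_(j+2) because x_j
   does not dominate a. *)
have [j /andP[nSj Sj]] : exists j, ~~ e (x j) a && ~~ ~~ e (x (j + 1)) a.
  apply: (@cyclic_change _ (fun j => ~~ e (x j) a) _ i nSi1).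
  by rewrite negbK.
rewrite negbK in Sj.
apply: (negP (@no_skip _ _ _ cV nocyc x a b (j + 1) (i + 2%:R) C eab Sj _ _ _)).
- have -> : j + 1 + 1 = j + 2%:R by ring.
  by rewrite b'E.
- by apply: contraNneq nSi2 => ->.
- apply: contraNneq nSi1 => ei; have -> : i + 1 = i + 2%:R - 1 by ring.
  by rewrite ei addrK.
have := uE (i + 2%:R); have := buE (i + 2%:R); rewrite !upd_neq.
- by move=> <-; rewrite bE nSi2 => e1; rewrite (_ : _ - 1 = i + 1) ?e1 //; ring.
- by apply: (@neq 1%N); [|ring].
- by apply: (@neq 2); [|ring].
Qed.

Lemma single_bipart x a b : config e x a b -> e a b -> ~~ e b a -> bipart e.
Proof.
move=> C eab neba; have [es cS aE bE b'E] := single_exact C eab neba.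
have [s1 _ _] := order_bounds De cV.
have [j nSj] : exists j, j \notin inC e x a.
  apply/neq_setT; apply: contraTneq s1 => eT.
  by move: cS; rewrite eT cardsT card_ord; lia.
have alt : forall i, (i + 1 \in inC e x a) = (i \notin inC e x a).
  apply: alternating; last by rewrite cS.
  move=> i Si; apply/negP=> Si1.
  have [h []] := double_run Si Si1 nSj; rewrite !in_inC.
  exact: (single_no_double C).
have alt' i : e (x (i + 1)) a = ~~ e (x i) a by rewrite -!in_inC alt.
have altm i : e (x (i - 1)) a = ~~ e (x i) a.
  by rewrite -[in RHS](subrK 1 i) alt' negbK.
have alt2 i : e (x (i + 2%:R)) a = e (x i) a.
  by rewrite (_ : i + 2%:R = i + 1 + 1) ?alt' ?negbK //; ring.
have altm2 i : e (x (i - 2%:R)) a = e (x i) a by rewrite -alt2 subrK.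
have aE' i : e a (x i) = e (x i) a by rewrite -[i](subrK 1) aE alt'.
have bE' i : e (x i) b = ~~ e (x i) a.
  by rewrite -[i](subrK 1) bE alt' negbK.
have b'E' i : e b (x i) = ~~ e (x i) a.
  by rewrite -[in LHS](subrK 2%:R i) b'E altm2.
apply: (bipart_config C (P := inC e x a)); first by rewrite cS.
- exact: subxx.
- by apply/subsetP=> i; rewrite in_outC in_inC aE'.
- by apply/subsetP=> i; rewrite in_setC !in_inC bE'.
- by apply/subsetP=> i; rewrite in_setC in_outC !in_inC b'E'.
move=> i l eil; rewrite !in_inC; apply/negP=> /eqP eP.
have [irr _ _ _ _] := De.
have il : i != l by apply: contraTneq eil => ->; rewrite irr.
(* For i, l outside the class of a, exchange x_i with a: then b, x_i could replace x_(l-1), between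
   x_(l-2) and x_l. If l - 2 = i, that position now holds a, which dominates b as well. Inside the
   class, x_l is exchanged with b, and x_l, a replace x_(i+1). *)
have [Si|nSi] := boolP (e (x i) a); last first.
  have Cu : config e (upd x i a) (x i) b.
    by apply: (config_upd C); rewrite ?aE' ?alt' ?altm.
  have ebu : e b (x i) by rewrite b'E'.
  have := no_replace cV nocyc (config_sym Cu) ebu (i := l - 2%:R).
  rewrite subrK (@upd_neq _ _ _ _ _ l) 1?eq_sym // eil => nh.
  apply: (negP (nh _)) => //.
  have [->|li] := eqVneq (l - 2%:R) i; first by rewrite upd_eq.
  by rewrite upd_neq // bE' altm2 -eP.
rewrite Si in eP.
have Cu : config e (upd x l b) (x l) a.
  by apply: (config_upd (config_sym C)); rewrite ?b'E' ?bE' ?alt' ?altm -eP.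
have eua : e (x l) a by rewrite -eP.
have := no_replace cV nocyc Cu eua (i := i).
rewrite upd_neq // => /(_ eil)/negP[].
have [->|li] := eqVneq (i + 2%:R) l; first by rewrite upd_eq.
by rewrite upd_neq // aE' alt2.
Qed.

End SingleArc.

(** * Outside pairs joined by both arcs: consecutive neighbours *)

Section DoubleArcs.
Variables (V : finType) (e : rel V) (s m : nat).
Hypotheses (De : dense e s) (cV : #|V| = m.+4) (nocyc : ~ cyc e m.+3).
Hypothesis both : forall (x : 'I_m.+2 -> V) a b, config e x a b -> e a b.
Implicit Types (x : 'I_m.+2 -> V) (a b : V) (i j : 'I_m.+2).

(** If a can replace x_i, then x_i and b form an outside pair of the new cycle, to which [both]
    applies. *)
Lemma twin_arcs x a b i : config e x a b ->
  e (x (i - 1)) a -> e a (x (i + 1)) -> e (x i) b /\ e b (x i).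
Proof.
move=> C exa eax; have Cu := config_upd C exa eax.
by split; [apply: both Cu | apply: both (config_sym Cu)].
Qed.

(* Indices l with x_(l-1) not dominating a and a not dominating x_l lower the
   degree of a, so there is at most one of them. *)
Lemma defect_unique x a b j l : config e x a b ->
    ~~ e (x (j - 1)) a -> ~~ e a (x j) -> l != j -> ~~ e (x (l - 1)) a ->
  e a (x l).
Proof.
move=> C nSj nTj lj nSl; apply/negPn/negP => nTl.
have [cx ax _ _] := C; have d := config_deg De cV C.
rewrite (both C) (both (config_sym C)) in d.
have dis : outC e x a :&: shift_set 1 (inC e x a) = set0.
  apply/setP=> i; rewrite in_setI in_set0 in_outC in_shift_set in_inC.
  apply/negP=> /andP[+ eia]; apply/negP.
  by have := no_insert cV nocyc cx ax eia; rewrite subrK.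
have := cardsC (outC e x a :|: shift_set 1 (inC e x a)).
rewrite cardsU dis cards0 card_shift_set card_ord.
have : (#|[set l; j]| <= #|~: (outC e x a :|: shift_set 1 (inC e x a))|)%N.
  apply/subset_leq_card/subsetP=> i /set2P ilj.
  rewrite in_setC in_setU in_outC in_shift_set in_inC negb_or.
  by case: ilj => ->; apply/andP.
rewrite cards2 lj; move: d; rlia.
Qed.

Section Run.
Variables (x : 'I_m.+2 -> V) (a b : V) (i : 'I_m.+2).
Hypotheses (C : config e x a b) (Sm : e (x (i - 1)) a) (S0 : e (x i) a)
  (nS1 : ~~ e (x (i + 1)) a).

(** Otherwise a could replace x_(i+1), so b would dominate x_(i+1), and ab could replace x_i between
    x_(i-1) and x_(i+1). Together with [nS1] this makes i + 2 the one index allowed by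
    [defect_unique]. *)
Lemma run_defect : ~~ e a (x (i + 2%:R)).
Proof.
apply/negP=> e2; have [||_ eb] := @twin_arcs x a b (i + 1) C.
- by rewrite addrK.
- by rewrite -addrA.
have := no_replace cV nocyc C (both C) Sm.
by rewrite (_ : i - 1 + 2%:R = i + 1) ?eb //; ring.
Qed.

(** Otherwise every index outside the in-neighbours S of a is followed by one in S. As i - 1 and i
    both lie in S, S exceeds half of the cycle, and the out-neighbours of a, which avoid S + 1 and i
    + 2, are too few for the semidegree. *)
Lemma gap_ge2 : ~~ e (x (i + 2%:R)) a.
Proof.
apply/negP=> S2.
have gap j : ~~ e (x j) a -> e (x (j + 1)) a.
  move=> nSj; apply/negPn/negP => nSj1.
  have [h /andP[/orP Ph]] : exists h, (e (x h) a || e (x (h + 1)) a) &&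
      ~~ (e (x (h + 1)) a || e (x (h + 1 + 1)) a).
    apply: (@cyclic_change _ (fun h => e (x h) a || e (x (h + 1)) a) i j).
      by rewrite S0.
    by rewrite negb_or nSj.
  rewrite negb_or => /andP[nSh1 nSh2]; case: Ph => [Sh|]; last first.
    by rewrite (negbTE nSh1).
  have e2 : h + 1 + 1 = h + 2%:R by ring.
  have Th2 : e a (x (h + 2%:R)).
    apply: (defect_unique (j := i + 2%:R) C).
    - by rewrite (_ : _ - 1 = i + 1) //; ring.
    - exact: run_defect.
    - apply: contraNneq nSh2 => /addIr hi.
      by rewrite e2 hi.
    - by rewrite (_ : _ - 1 = h + 1) //; ring.
  have [||Bh _] := @twin_arcs x a b (h + 1) C.
  - by rewrite addrK.
  - by rewrite e2.
  have := no_replace cV nocyc (config_sym C) (both (config_sym C)) Bh.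
  case/negP; apply: (defect_unique (j := i + 2%:R) C).
  - by rewrite (_ : _ - 1 = i + 1) //; ring.
  - exact: run_defect.
  - apply: contraNneq nSh1 => hi.
    by rewrite (_ : h + 1 = i) //; rewrite -(addrK 2%:R (h + 1)) hi addrK.
  - by rewrite (_ : _ - 1 = h + 1 + 1) //; ring.
have [_ _ s3] := order_bounds De cV.
have [_] := config_semi De cV C; rewrite (both C) => s4.
(* The successor map sends the complement of S into S and omits i, whose predecessor lies in S. *)
have c1 : (#|~: inC e x a| <= #|inC e x a :\ i|)%N.
  rewrite -(card_shift_set 1); apply/subset_leq_card/subsetP=> j.
  rewrite in_shift_set in_setC in_setD1 !in_inC => nS.
  rewrite -{2}(subrK 1 j) gap // andbT.
  by apply: contraNneq nS => ->.
have c2 := cardsC (inC e x a); rewrite card_ord in c2.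
have c3 := cardsD1 i (inC e x a); rewrite in_inC S0 in c3.
have [cx ax _ _] := C.
pose k : 'I_m.+2 := i + 2%:R.
have c4 : (#|outC e x a| <= #|~: shift_set 1 (inC e x a) :\ k|)%N.
  apply/subset_leq_card/subsetP=> j; rewrite in_setD1 in_setC in_shift_set.
  rewrite in_outC in_inC => Tj; apply/andP; split.
    by apply: contraTneq Tj => ->; apply: run_defect.
  by apply: contraL Tj => /(no_insert cV nocyc cx ax); rewrite subrK.
have := cardsD1 k (~: shift_set 1 (inC e x a)).
have := cardsC (shift_set 1 (inC e x a)); rewrite card_shift_set card_ord.
rewrite in_setC in_shift_set in_inC.
rewrite (_ : k - 1%:R = i + 1); last by rewrite /k; ring.
by rewrite nS1; rlia.
Qed.

End Run.

(** The opposite case makes the cycle rigid, see [config_rigid]. *)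
Hypothesis inserted : forall x a b, config e x a b ->
  exists j, e (x j) a && e b (x (j + 1)) || e (x j) b && e a (x (j + 1)).

(** Exchanging x_(i+1), x_(i+2) with b, a reveals the chord x_(i+1) -> x_(i+3). It skips x_(i+2), so
    any insertion of ab or ba away from x_(i+2) gives length p-1. *)
Lemma no_run x a b i : config e x a b ->
  e (x (i - 1)) a -> e (x i) a -> ~~ e (x (i + 1)) a -> False.
Proof.
move=> C Sm S0 nS1; have Cs := config_sym C.
have [eab eba] := (both C, both Cs).
have nT2 := run_defect C Sm S0; have nS2 := gap_ge2 C Sm S0 nS1.
have m0 := m_gt0 De cV; have [cx ax bx ab] := C.
have neq (c : nat) k l : (0 < c < 3)%N -> k - l = c%:R -> k != l :> 'I_m.+2.
  by move=> c4; apply: shift_neq; lia.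
have aU l : l != i + 2%:R -> ~~ e (x (l - 1)) a -> e a (x l).
  apply: (defect_unique C) => //.
  by rewrite (_ : _ - 1 = i + 1) //; ring.
have BS j : j != i -> e (x j) b -> e (x (j + 1)) a.
  move=> ji Bj; apply/negPn/negP=> nSj.
  have := no_replace cV nocyc Cs eba Bj; rewrite aU //.
    by rewrite (inj_eq (addIr _)).
  by rewrite (_ : _ - 1 = j + 1) //; ring.
have nB1 : ~~ e (x (i + 1)) b.
  apply: contra nS2 => /BS; rewrite (_ : i + 1 + 1 = i + 2%:R); last by ring.
  by apply; apply: (@neq 1%N) => //; ring.
have nb2 : ~~ e b (x (i + 2%:R)) by apply: (no_replace cV nocyc C eab S0).
have bU l : l != i + 2%:R -> ~~ e (x (l - 1)) b -> e b (x l).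
  apply: (defect_unique Cs) => //.
  by rewrite (_ : _ - 1 = i + 1) //; ring.
have SB j : j != i -> e (x j) a -> e (x (j + 1)) b.
  move=> ji Bj; apply/negPn/negP=> nSj.
  have := no_replace cV nocyc C eab Bj; rewrite bU //.
    by rewrite (inj_eq (addIr _)).
  by rewrite (_ : _ - 1 = j + 1) //; ring.
have B0 : e (x i) b.
  rewrite -(subrK 1 i); apply: SB => //; rewrite eq_sym.
  by apply: (@neq 1%N) => //; ring.
have T3 : e a (x (i + 3%:R)).
  apply: aU; first by apply: (@neq 1%N) => //; ring.
  by rewrite (_ : _ - 1 = i + 2%:R) //; ring.
have Cu : config e (upd (upd x (i + 1) b) (i + 1 + 1) a)
                 (x (i + 1)) (x (i + 1 + 1)).
  apply: (config_upd2 De cV Cs) => //; first by rewrite addrK.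
  by rewrite (_ : _ + 2%:R = i + 3%:R) //; ring.
(* On the exchanged cycle i + 2 is the defect of x_(i+1). Position i + 2 holds a, which does not
   dominate x_(i+1), so by [defect_unique] x_(i+1) dominates x_(i+3). *)
have skip : e (x (i + 2%:R - 1)) (x (i + 2%:R + 1)).
  have i12 : i + 1 != i + 1 + 1.
    by rewrite eq_sym; apply: (@neq 1%N) => //; ring.
  have := defect_unique (j := i + 2%:R) (l := i + 3%:R) Cu.
  rewrite (_ : i + 2%:R - 1 = i + 1); last by ring.
  rewrite (_ : i + 3%:R - 1 = i + 1 + 1); last by ring.
  rewrite (_ : i + 2%:R = i + 1 + 1); last by ring.
  rewrite upd_eq upd_neq // upd_eq (@upd_neq _ _ _ _ _ (i + 3%:R)); last first.
    by apply: (@neq 1%N) => //; ring.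
  rewrite upd_neq; last by apply: (@neq 2%N) => //; ring.
  rewrite (_ : i + 3%:R = i + 1 + 1 + 1); last by ring.
  apply=> //.
  - have := no_replace cV nocyc C eab Sm.
    by rewrite (_ : _ + 2%:R = i + 1) //; ring.
  - by apply: (@neq 1%N) => //; ring.
  - exact: (no_insert cV nocyc cx ax).
have noins : forall a' b' j, config e x a' b' -> e a' b' -> e (x j) a' ->
    e b' (x (j + 1)) -> i + 2%:R != j -> i + 1 != j -> False.
  move=> a' b' j C' e' Sj Tj ij i1j.
  apply: (negP (@no_skip _ _ _ cV nocyc _ _ _ _ _ C' e' Sj Tj ij _)) skip.
  apply: contraNneq i1j => ij1.
  by rewrite -(addrK 1 j) -ij1; apply/eqP; ring.
have [j /orP[]/andP[Sj Tj]] := inserted C.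
  apply: (noins a b j) => //.
    by apply: contraNneq nS2 => ->.
  by apply: contraNneq nS1 => ->.
have [ij|ij] := eqVneq (i + 2%:R) j; last first.
  apply: (noins b a j) => //.
  by apply: contraNneq nB1 => ->.
(* The insertion next to the skipped vertex is useless here. Another one exists between x_(i-1) and
   x_i, unless b also has a run ending at i, which [gap_ge2] for b excludes. *)
have [Bm|nBm] := boolP (e (x (i - 1)) b).
  have := gap_ge2 Cs Bm B0 nB1.
  by rewrite ij Sj.
apply: (noins a b (i - 1)) => //.
- rewrite subrK; apply: bU => //; rewrite eq_sym.
  by apply: (@neq 2%N) => //; ring.
- by apply: contraNneq nS2 => ->.
- by apply: (@neq 2%N) => //; ring.
Qed.

Lemma no_double x a b i : config e x a b ->
  e (x i) a -> ~~ e (x (i + 1)) a.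
Proof.
move=> C S0; apply/negP=> S1.
have [s1 _ _] := order_bounds De cV; have [cx ax bx _] := C.
have [_] := config_semi De cV C; rewrite (both C) => s2.
have [j] : exists j, j \in outC e x a by apply/card_gt0P; rlia.
rewrite in_outC => Tj.
have nSj : j - 1 \notin inC e x a.
  by rewrite in_inC; apply: contraL Tj => /(no_insert cV nocyc cx ax);
     rewrite subrK.
rewrite -!in_inC in S0 S1; have [h []] := double_run S0 S1 nSj.
by rewrite !in_inC => h1 h2 h3; apply: (no_run C h1 h2 h3).
Qed.

End DoubleArcs.

Section Alternating.
Variables (V : finType) (e : rel V) (s m : nat).
Hypotheses (De : dense e s) (cV : #|V| = m.+4) (nocyc : ~ cyc e m.+3).
Implicit Types (x : 'I_m.+2 -> V) (a b : V) (i j : 'I_m.+2).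
Hypothesis both : forall x a b, config e x a b -> e a b.
Hypothesis inserted : forall x a b, config e x a b ->
  exists j, e (x j) a && e b (x (j + 1)) || e (x j) b && e a (x (j + 1)).

Lemma config_conv x a b :
  config (conv e) x a b -> config e (fun i => x (- i)) a b.
Proof.
by move=> [cx ax bx ab]; split; rewrite ?codom_opp //; apply: cycle_fun_conv.
Qed.

Lemma no_double_in x a b i : config e x a b ->
  e (x i) a -> ~~ e (x (i + 1)) a.
Proof. exact: (no_double De). Qed.

(** The statement for in-neighbours in the converse; reversal turns the indices i, i + 1 into -(i +
    1), -i. *)
Lemma no_double_out x a b i : config e x a b ->
  e a (x i) -> ~~ e a (x (i + 1)).
Proof.
move=> C Ti; have C' : config (conv e) (fun i => x (- i)) a b.
  case: C => cx ax bx ab; split; rewrite ?codom_opp //.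
  exact: cycle_fun_conv.
have both' (y : 'I_m.+2 -> V) c d : config (conv e) y c d -> conv e c d.
  by move=> C2; apply: both (config_sym (config_conv C2)).
have ins' (y : 'I_m.+2 -> V) c d : config (conv e) y c d -> exists j,
    conv e (y j) c && conv e d (y (j + 1)) ||
    conv e (y j) d && conv e c (y (j + 1)).
  move=> C2; have [j ins] := inserted (config_conv C2); exists (- (j + 1)).
  have ej : - (j + 1) + 1 = - j by ring.
  by rewrite /conv ej orbC andbC [X in _ || X]andbC.
apply/negP=> Ti1.
have nocyc' : ~ cyc (conv e) m.+3 by move/cyc_conv.
have := no_double (dense_conv De) cV nocyc' both' ins' (i := - (i + 1)) C'.
have e2 : - (- (i + 1) + 1) = i by ring.
by rewrite /conv opprK e2 => /(_ Ti1); rewrite Ti.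
Qed.

End Alternating.

(** * Neighbours that are never consecutive, by parity of the cycle length *)

Section EvenOdd.
Variables (V : finType) (e : rel V) (s m : nat).
Hypotheses (De : dense e s) (cV : #|V| = m.+4) (nocyc : ~ cyc e m.+3).
Implicit Types (x : 'I_m.+2 -> V) (a b : V) (i j : 'I_m.+2).
Hypothesis both : forall x a b, config e x a b -> e a b.
Hypothesis inserted : forall x a b, config e x a b ->
  exists j, e (x j) a && e b (x (j + 1)) || e (x j) b && e a (x (j + 1)).

Let in1 x a b i : config e x a b -> e (x i) a -> ~~ e (x (i + 1)) a.
Proof. exact: (no_double_in De cV nocyc both inserted). Qed.

Let out1 x a b i : config e x a b -> e a (x i) -> ~~ e a (x (i + 1)).
Proof. exact: (no_double_out De cV nocyc both inserted). Qed.

Lemma card_sparse (S : {set 'I_m.+2}) :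
  (forall i, i \in S -> i + 1 \notin S) -> (#|S|.*2 <= m.+2)%N.
Proof.
move=> nd; have dis : S :&: shift_set 1 S = set0.
  apply/setP=> j; rewrite in_setI in_set0 in_shift_set; apply/negP.
  by move=> /andP[Sj /nd]; rewrite subrK Sj.
have := max_card (mem (S :|: shift_set 1 S)).
by rewrite cardsU dis cards0 card_shift_set card_ord; rlia.
Qed.

Lemma card_in x a b : config e x a b -> (#|inC e x a|.*2 <= m.+2)%N.
Proof. by move=> C; apply: card_sparse => i; rewrite !in_inC; apply: in1 C. Qed.

Lemma card_out x a b : config e x a b -> (#|outC e x a|.*2 <= m.+2)%N.
Proof. by move=> C; apply: card_sparse => i; rewrite !in_outC; apply: out1 C. Qed.

Lemma config_both x a b : config e x a b ->
  [/\ (s <= #|inC e x a|.+1)%N, (s <= #|outC e x a|.+1)%N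
    & (m.+1 <= #|inC e x a| + #|outC e x a|)%N].
Proof.
move=> C; have [] := config_semi De cV C; have := config_deg De cV C.
by rewrite (both C) (both (config_sym C)); split; rlia.
Qed.

Section Even.
Hypothesis even : s.*2 = m.+2.

Definition alternates (P : {set 'I_m.+2}) :=
  forall i, (i + 1 \in P) = (i \notin P).

Lemma alternates_eq P Q i :
  alternates P -> alternates Q -> i \in P -> i \in Q -> P = Q.
Proof.
move=> aP aQ Pi Qi; apply/setP=> j; apply/eqP.
move: j; apply: (@cyclic_ind _ (fun j => (j \in P) == (j \in Q)) i).
  by rewrite Pi Qi.
by move=> j /eqP ej; rewrite aP aQ ej.
Qed.

(** In- and out-neighbours on the cycle number at most s each and at least 2s-1 together, so one of
    the two sets has size s and alternates; [no_insert] puts the other into the same class. *)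
Lemma even_class x a b : config e x a b ->
  exists P, [/\ alternates P, #|P| = s,
    forall i, e (x i) a -> i \in P & forall i, e a (x i) -> i \in P].
Proof.
move=> C; have [cx ax _ _] := C.
have ci := card_in C; have co := card_out C; have [_ _ ca] := config_both C.
have [cs|cs] : #|inC e x a| = s \/ #|outC e x a| = s by rlia.
  have alt : alternates (inC e x a).
    apply: alternating; last by rewrite cs.
    by move=> i; rewrite !in_inC; apply: in1 C.
  exists (inC e x a); split=> // i; rewrite ?in_inC // => eai.
  rewrite -in_inC -(subrK 1 i) alt in_inC.
  by apply: contraL eai => /(no_insert cV nocyc cx ax); rewrite subrK.
have alt : alternates (outC e x a).
  apply: alternating; last by rewrite cs.
  by move=> i; rewrite !in_outC; apply: out1 C.
exists (outC e x a); split=> // i; rewrite ?in_outC // => eai.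
apply: contraLR (no_insert cV nocyc cx ax eai) => nTi.
by rewrite negbK -in_outC alt in_outC.
Qed.

(** If a can replace x_i, then on the new cycle x_i inherits the class [P], because x_(i-1)
    dominates it; so x_j with j outside [P] is not adjacent to it. If a can replace neither x_i nor
    x_j, each contributes a defect, against [defect_unique]. *)
Lemma even_no_arc x a b (P : {set 'I_m.+2}) i j :
    config e x a b -> alternates P ->
    (forall i, e (x i) a -> i \in P) -> (forall i, e a (x i) -> i \in P) ->
    i != j -> i \notin P -> j \notin P ->
  ~~ e (x i) (x j) && ~~ e (x j) (x i).
Proof.
move=> C aP iP oP.
have [[injx ex] ax bx ab] := C.
have Pm k : (k - 1 \in P) = (k \notin P).
  by rewrite -{2}(subrK 1 k) aP negbK.
have swap k l : k != l -> k \notin P -> l \notin P ->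
    e (x (k - 1)) a -> e a (x (k + 1)) ->
    ~~ e (x k) (x l) && ~~ e (x l) (x k).
  move=> kl nPk nPl h1 h2.
  have [Q [aQ _ iQ oQ]] := even_class (config_upd C h1 h2).
  have kk : k - 1 != k by rewrite eq_sym; apply: (@shift_neq _ 1) => //; ring.
  have QP : Q = P.
    apply: (alternates_eq (i := k - 1)) => //; last by rewrite Pm.
    by apply: iQ; rewrite upd_neq //; have := ex (k - 1); rewrite subrK.
  have := iQ l; have := oQ l; rewrite upd_neq 1?eq_sym // QP.
  by move=> h3 h4; apply/andP; split; apply: contra nPl.
move=> ij nPi nPj.
have defect k : k \notin P -> e (x (k - 1)) a && e a (x (k + 1)) \/
    exists2 l, l = k \/ l = k + 1 & ~~ e (x (l - 1)) a && ~~ e a (x l).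
  move=> nPk; case h1: (e (x (k - 1)) a); last first.
    right; exists k; first by left.
    by rewrite h1; apply: contra nPk; apply: oP.
  case h2: (e a (x (k + 1))); first by left.
  right; exists (k + 1); first by right.
  by rewrite addrK h2 andbT; apply: contra nPk; apply: iP.
have [/andP[]|[l el /andP[l1 l2]]] := defect i nPi; first exact: swap.
have [/andP[]|[l' el' /andP[l1' l2']]] := defect j nPj.
  by rewrite andbC; apply: swap; rewrite 1?eq_sym.
suff ll : l' != l.
  by rewrite (defect_unique De cV nocyc both C l1 l2 ll l1') in l2'.
have nxt k h : k \notin P -> h \notin P -> k + 1 != h.
  by move=> nPk nPh; apply: contraNneq nPh => <-; rewrite aP.
case: el => ->; case: el' => ->; rewrite ?(inj_eq (addIr _)).
- by rewrite eq_sym.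
- exact: nxt.
- by rewrite eq_sym; apply: nxt.
- by rewrite eq_sym.
Qed.

Lemma even_bipart x a b : config e x a b -> bipart e.
Proof.
move=> C; have Cs := config_sym C; have [s1 _ _] := order_bounds De cV.
have [P [aP cP iP oP]] := even_class C.
have [Q [aQ cQ iQ oQ]] := even_class Cs.
(* If a and b shared a class, the in-neighbours of each, shifted by 2, would be disjoint within this
   class from the out-neighbours of the other. Both pairs together contradict the degree bounds. *)
have dis i : i \in P -> i \notin Q.
  move=> Pi; apply/negP=> Qi; have QP := alternates_eq aP aQ Pi Qi.
  have [_ _ ca] := config_both C; have [_ _ cb] := config_both Cs.
  have cU c d : config e x c d -> (forall i, e (x i) c -> i \in P) ->
      (forall i, e d (x i) -> i \in P) -> (#|inC e x c| + #|outC e x d| <= s)%N.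
    move=> C' iP' oP'; rewrite -(card_shift_set 2) -cP.
    have d0 : shift_set 2 (inC e x c) :&: outC e x d = set0.
      apply/setP=> j; rewrite in_setI in_set0 in_shift_set in_inC in_outC.
      apply/negP=> /andP[/(no_replace cV nocyc C' (both C'))].
      by rewrite subrK => /negP.
    rewrite -cardsUI d0 cards0 addn0; apply/subset_leq_card/subsetP=> j.
    rewrite in_setU in_shift_set in_inC in_outC => /orP[/iP' Pj|/oP' //].
    rewrite (_ : j = j - 2%:R + 1 + 1); last by ring.
    by rewrite !aP negbK.
  have h1 : (#|inC e x a| + #|outC e x b| <= s)%N.
    by apply: cU; rewrite // QP.
  have h2 : (#|inC e x b| + #|outC e x a| <= s)%N.
    by apply: cU; rewrite // QP.
  by rlia.
have dis' i : i \notin P -> i \in Q.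
  by rewrite -aP => /dis; rewrite aQ negbK.
apply: (bipart_config De cV C (P := P)); first by rewrite cP.
- by apply/subsetP=> i; rewrite in_inC; apply: iP.
- by apply/subsetP=> i; rewrite in_outC; apply: oP.
- apply/subsetP=> i; rewrite in_inC in_setC => /iQ.
  by apply: contraL => /dis.
- apply/subsetP=> i; rewrite in_outC in_setC => /oQ.
  by apply: contraL => /dis.
move=> i j eij; apply/negP=> /eqP eP; have [irr _ _ _ _] := De.
have ij : i != j by apply: contraTneq eij => ->; rewrite irr.
have [Pi|nPi] := boolP (i \in P).
  have := even_no_arc Cs aQ iQ oQ ij (dis i Pi).
  by rewrite eij => /(_ (dis j _)); rewrite -eP => /(_ Pi).
have := even_no_arc C aP iP oP ij nPi.
by rewrite -eP eij => /(_ nPi).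
Qed.

End Even.

Section Odd.
Hypothesis odd_order : m.+3 = s.*2.

Lemma odd_cards x a b : config e x a b ->
  #|inC e x a| = s.-1 /\ #|outC e x a| = s.-1.
Proof.
move=> C; have := card_in C; have := card_out C.
by have [] := config_both C; rlia.
Qed.

(** Among 2s-1 cyclic positions, s-1 pairwise non-consecutive ones leave a single pair of
    consecutive free positions; z is the second of them. *)
Definition gap x a (z : 'I_m.+2) :=
  [/\ ~~ e (x z) a, ~~ e (x (z - 1)) a
    & forall j, j != z -> ~~ e (x j) a -> e (x (j - 1)) a].

Lemma odd_gap x a b : config e x a b -> exists z, gap x a z.
Proof.
move=> C; have [cA _] := odd_cards C; have [s1 _ _] := order_bounds De cV.
pose U := inC e x a :|: shift_set 1 (inC e x a).
have cU : #|~: U| = 1%N.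
  have := cardsC U; rewrite /U cardsU card_shift_set cA card_ord.
  rewrite (_ : _ :&: _ = set0) ?cards0; first by rlia.
  apply/setP=> j; rewrite in_setI in_set0 in_shift_set !in_inC.
  by apply/negP=> /andP[+ /(in1 C)]; rewrite subrK => ->.
have mU j : (j \in ~: U) = ~~ e (x j) a && ~~ e (x (j - 1)) a.
  by rewrite in_setC in_setU in_shift_set !in_inC negb_or.
have /cards1P[z defU] : #|~: U| == 1%N by rewrite cU.
exists z; have := mU z; rewrite defU inE eqxx => /esym/andP[z0 z1].
split=> // j jz nSj; apply/negPn/negP=> nSj1.
by have := mU j; rewrite nSj nSj1 defU inE (negbTE jz).
Qed.

(* Up to exchanging a and b, if A is the set of in-neighbours of a on the cycle
   then a has out-neighbours A, while b has in-neighbours A - 1 and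
   out-neighbours A + 1. *)
Definition offset x a b :=
  [/\ forall i, e a (x i) = e (x i) a,
      forall i, e (x i) b = e (x (i + 1)) a
    & forall i, e b (x (i + 1)) = e (x i) a].

(** Here z + 1 is the defect of a, so x_i -> a implies a -> x_(i+2). Then a can replace x_(i+1), and
    [twin_arcs] makes x_(i+1) a neighbour of b both ways. Equal cardinalities turn these inclusions
    into equalities. *)
Lemma gap_out_offset x a b z :
  config e x a b -> gap x a z -> e a (x z) -> offset x b a.
Proof.
move=> C [nz nz1 gapz] Tz; have Cs := config_sym C.
have [cA cA'] := odd_cards C; have [cB cB'] := odd_cards Cs.
have defect l : l != z + 1 -> ~~ e (x (l - 1)) a -> e a (x l).
  apply: (defect_unique De cV nocyc both C); first by rewrite addrK.
  exact: out1 C Tz.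
have A2 i : e (x i) a -> e a (x (i + 2%:R)).
  move=> Si; apply: defect; last first.
    by rewrite (_ : _ - 1 = i + 1); [apply: in1 C Si | ring].
  apply: contraNneq nz1 => /(congr1 (fun j => j - 2%:R)).
  by rewrite addrK => ei; rewrite (_ : z - 1 = i) // ei; ring.
have AB i : e (x i) a -> e (x (i + 1)) b /\ e b (x (i + 1)).
  move=> Si; apply: (twin_arcs both C); first by rewrite addrK.
  by rewrite -addrA; apply: A2.
have eB : shift_set 1 (inC e x a) = inC e x b.
  apply/eqP; rewrite eqEcard card_shift_set cA cB leqnn andbT.
  apply/subsetP=> j; rewrite in_shift_set !in_inC => /AB[].
  by rewrite subrK.
have eB' : shift_set 1 (inC e x a) = outC e x b.
  apply/eqP; rewrite eqEcard card_shift_set cA cB' leqnn andbT.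
  apply/subsetP=> j; rewrite in_shift_set in_inC in_outC => /AB[].
  by rewrite subrK.
have eA' : shift_set 2 (inC e x a) = outC e x a.
  apply/eqP; rewrite eqEcard card_shift_set cA cA' leqnn andbT.
  apply/subsetP=> j; rewrite in_shift_set in_inC in_outC => /A2.
  by rewrite subrK.
have B i : e (x i) b = e (x (i - 1)) a by rewrite -in_inC -eB in_shift_set in_inC.
split=> i.
- by rewrite -in_outC -eB' in_shift_set in_inC B.
- by rewrite B addrK.
- rewrite -in_outC -eA' in_shift_set in_inC B.
  by congr (e (x _) _); ring.
Qed.

Lemma odd_offset x a b : config e x a b -> offset x a b \/ offset x b a.
Proof.
move=> C; have Cs := config_sym C.
have [z gz] := odd_gap C; have [w gw] := odd_gap Cs.
have [Tz|nTz] := boolP (e a (x z)).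
  by right; apply: gap_out_offset gz Tz.
have [Tw|nTw] := boolP (e b (x w)).
  by left; apply: gap_out_offset gw Tw.
(* Now z and w are the defects of a and b, so in-neighbours of a and of b follow each other
   alternately until a defect is met. This forces z = w and leaves x_(z-2) as the only in-neighbour
   of a or b on the cycle, too little for an insertion. *)
exfalso; have next c d y u j : config e x c d -> gap x d u -> ~~ e d (x u) ->
    y = j + 1 -> e (x j) c -> e (x y) d \/ y + 1 = u.
  move=> C' [nu nu1 _] nTu -> Sj; have C's := config_sym C'.
  have [->|ju] := eqVneq (j + 1 + 1) u; [by right | left].
  apply/negPn/negP => nSj.
  have := no_replace cV nocyc C' (both C') Sj.
  rewrite (_ : j + 2%:R = j + 1 + 1); last by ring.
  rewrite (defect_unique De cV nocyc both C's nu1 nTu ju) ?addrK //.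
have last2 c d u : config e x c d -> gap x c u -> e (x (u - 2%:R)) c.
  move=> C' [_ nu1 gu]; have := gu (u - 1) _ nu1.
  rewrite (_ : u - 1 - 1 = u - 2%:R); last by ring.
  by apply; rewrite eq_sym; apply: (@shift_neq _ 1) => //; ring.
have Az := last2 _ _ _ C gz; have Bw := last2 _ _ _ Cs gw.
have zw : z = w.
  have e1 : z - 1 = z - 2%:R + 1 by ring.
  have e0 : z = z - 1 + 1 by rewrite subrK.
  have [Bz1|] := next a b _ w _ C gw nTw e1 Az.
  - have [] := next b a z z _ Cs gz nTz e0 Bz1.
      by case: gz => /negbTE->.
    by move/eqP; rewrite -subr_eq0 addrAC subrr add0r oner_eq0.
  - by rewrite subrK.
rewrite -zw in gw Bw nTw.
pose U j := e (x j) a || e (x j) b.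
have walkback (t : nat) : (t.+1 < m.+2)%N -> ~~ U (z - 2%:R - t.+1%:R).
  elim: t => [|t IH] tM.
    apply/norP; split; apply/negP=> h.
      by have := in1 C h; rewrite subrK Az.
    by have := in1 Cs h; rewrite subrK Bw.
  have := IH (ltnW tM); apply: contra.
  have e1 : z - 2%:R - t.+1%:R = z - 2%:R - t.+2%:R + 1.
    by rewrite -[t.+2%:R]natr1; ring.
  have ne : z - 2%:R - t.+1%:R + 1 != z.
    rewrite eq_sym; apply: (@shift_neq _ t.+2) => //.
    by rewrite -[t.+2%:R]natr1; ring.
  case/orP => h; apply/orP; [right|left].
    have [//|eu] := next a b _ z _ C gw nTw e1 h.
    by rewrite eu eqxx in ne.
  have [//|eu] := next b a _ z _ Cs gz nTz e1 h.
  by rewrite eu eqxx in ne.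
have onlyg j : U j -> j = z - 2%:R.
  have [t tM ->] := ord_shift (z - 2%:R) j.
  have [->|t0] := posnP t; first by rewrite addr0.
  have -> : z - 2%:R + t%:R = z - 2%:R - (m.+1 - t).+1%:R.
    by rewrite -subSn; [rewrite natrB ?natr_size; [ring|lia] | lia].
  by move=> Uj; have := walkback (m.+1 - t)%N; rewrite Uj => /(_ _)/negP[]; lia.
have sameT c d : config e x c d -> gap x c z -> ~~ e c (x z) ->
    forall i, e c (x i) -> e (x i) c.
  move=> C' [nz nz1 gz'] nT; have [cA cA'] := odd_cards C'.
  have sub : inC e x c \subset outC e x c.
    apply/subsetP=> j; rewrite in_inC in_outC => Sj.
    apply: (defect_unique De cV nocyc both C' nz1 nT).
      by apply: contraTneq Sj => ->.
    by apply/negP=> h; have := in1 C' h; rewrite subrK Sj.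
  have eA : inC e x c = outC e x c by apply/eqP; rewrite eqEcard sub cA cA' leqnn.
  by move=> i; rewrite -in_outC -in_inC eA.
have [j ins] := inserted C.
have Uj : U j by case/orP: ins => /andP[h _]; rewrite /U h ?orbT.
have Uj1 : U (j + 1).
  case/orP: ins => /andP[_ h]; rewrite /U.
    by rewrite (sameT _ _ Cs gw nTw _ h) orbT.
  by rewrite (sameT _ _ C gz nTz _ h).
have /eqP := onlyg _ Uj1; rewrite -(onlyg _ Uj) -subr_eq0 addrAC subrr add0r.
by rewrite oner_eq0.
Qed.

(** The out-neighbours of x_(z-1) reduce to x_z, against s > 1: every other x_j can be exchanged
    with a or b, and both offset patterns of the new pair, read near z, exclude x_(z-1) -> x_j. *)
Lemma odd_impossible x a b : config e x a b -> False.
Proof.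
wlog off : a b / offset x a b => [H C|C].
  by have [/H|/H] := odd_offset C; apply=> //; apply: config_sym.
have Cs := config_sym C; have [z [nz nz1 gz]] := odd_gap C.
case: off => T1 B1 B2; have [s1 _ _] := order_bounds De cV.
have [irr _ _ /(_ (x (z - 1)))[od _] _] := De.
have [[injx ex] ax bx ab] := C.
have zz : z - 1 != z by rewrite eq_sym; apply: (@shift_neq _ 1) => //; ring.
suff : outs e (x (z - 1)) \subset [set x z].
  by move/subset_leq_card; rewrite cards1; lia.
apply/subsetP=> v; rewrite !inE; apply: contraTT.
have [/codomP[j ->]|vx] := boolP (v \in codom x); last first.
  have : v \in rest x by rewrite inE.
  rewrite (config_rest cV C) => /set2P[]-> _ //.
  by rewrite B1 subrK.
rewrite (inj_eq injx) => jz.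
have [->|jz1] := eqVneq j (z - 1); first by rewrite irr.
have [Sj|nSj] := boolP (e (x j) a).
  have Cu : config e (upd x j b) (x j) a.
    by apply: (config_upd Cs); rewrite ?B1 ?subrK ?B2.
  have [[h1 h2 h3]|[h1 h2 h3]] := odd_offset Cu.
    have := h3 (z - 1); rewrite subrK !upd_neq 1?eq_sym // T1 (negbTE nz).
    by move/esym/negbT.
  have := h2 (z - 1); rewrite subrK !upd_neq 1?eq_sym // (negbTE nz).
  by move/negbT.
have Cu : config e (upd x j a) (x j) b.
  apply: (config_upd C); first exact: gz.
  rewrite T1 -[e _ _]negbK; apply/negP => nSj1.
  move: nSj; rewrite -{1}(addrK 1 j) gz //.
  by apply: contraNneq jz1 => <-; rewrite addrK.
have [[h1 h2 h3]|[h1 h2 h3]] := odd_offset Cu; last first.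
  have := h1 z; rewrite !upd_neq 1?eq_sym // B1 -{1}(subrK 1 z) B2 (negbTE nz1).
  have zz1 : z + 1 != z by apply: (@shift_neq _ 1) => //; ring.
  move=> /esym/negbT nz2.
  by have := gz _ zz1 nz2; rewrite addrK (negbTE nz).
have := h2 (z - 1 - 1).
rewrite subrK upd_neq; last first.
  apply: contraNneq nSj => <-; apply: gz => //.
rewrite upd_neq 1?eq_sym // B1 subrK (negbTE nz1).
by move/esym/negbT.
Qed.

End Odd.

End EvenOdd.

(** * Complete outsides with common neighbours on the cycle *)

Section Rigid.
Variables (V : finType) (e : rel V) (s m k : nat).
Hypotheses (De : dense e s) (cV : #|V| = (k + m.+2)%N) (k2 : (1 < k)%N).
Implicit Types (x : 'I_m.+2 -> V) (y z : V) (i j : 'I_m.+2).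

Definition complete_on (B : {set V}) :=
  {in B &, forall y z, y != z -> e y z}.

(** Common target of [long_rigid] for k >= 3 and of [config_rigid] for k = 2. *)
Definition rigid x :=
  [/\ cycle_fun e x, complete_on (rest x),
      {in rest x, forall y, inC e x y != set0 /\ outC e x y != set0},
      {in rest x &, forall y z, y != z -> misses k (inC e x y) (outC e x z)}
    & {in rest x, forall y, misses 1 (inC e x y) (outC e x y)}].

Lemma size_rest x : injective x -> #|rest x| = k.
Proof. by move/card_rest; rewrite cV => /addIn. Qed.

Lemma rest_deg x y : injective x -> y \in rest x ->
  (m.+3 <= #|inC e x y| + #|outC e x y| + k)%N.
Proof.
move=> injx ry; have [irr _ _ _ /(_ y)] := De.
rewrite (card_ins _ _ injx) (card_outs _ _ injx) cV.
have sub (A : {set V}) : y \notin A -> (#|A :&: rest x| <= k.-1)%N.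
  move=> yA; rewrite -(size_rest injx) (cardsD1 y (rest x)) ry /=.
  apply/subset_leq_card/subsetP=> v; rewrite in_setI in_setD1 => /andP[Av ->].
  by rewrite andbT; apply: contraNneq yA => <-.
have := sub (ins e y); have := sub (outs e y).
by rewrite !inE irr => /(_ isT) h1 /(_ isT) h2; lia.
Qed.

Section Common.
Variable x : 'I_m.+2 -> V.
Hypothesis rx : rigid x.

(** [misses_card] for (y, z) and for (z, y), added up, meets the degree bounds of y and z without
    slack. *)
Lemma rigid_cards y z : y \in rest x -> z \in rest x -> y != z ->
  [/\ (#|inC e x y| + #|outC e x z| + k = m.+3)%N,
      #|inC e x y| = #|inC e x z| & #|outC e x y| = #|outC e x z|].
Proof.
move=> ry rz yz; have [[injx _] _ ne mis _] := rx.
have [iy oy] := ne y ry; have [iz oz] := ne z rz.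
have h1 := misses_card (ltnW k2) iy oz (mis y z ry rz yz).
have h2 := misses_card (ltnW k2) iz oy (mis z y rz ry (contra_neq esym yz)).
have := rest_deg injx ry; have := rest_deg injx rz.
by split; rlia.
Qed.

Lemma interval_shift (S S' : {set 'I_m.+2}) (h h' : 'I_m.+2) (n : nat) :
    (0 < n)%N -> (n <= m)%N ->
    (forall t : nat, (t < m.+2)%N -> (h - t%:R \in S) = (t < n)%N) ->
    (forall t : nat, (t < m.+2)%N -> (h' - t%:R \in S') = (t < n)%N) ->
    (forall i, i \in S' -> (i \in S) || (i - 1 \in S)) ->
  h' = h \/ h' = h + 1.
Proof.
move=> n0 nm hS hS' sub; have [[|[|u]] uM eh] := ord_shift h' (h + 1).
- by right; rewrite eh addr0.
- by left; apply: (addIr 1); rewrite eh.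
(* Either h' and its predecessor both miss S, or h - n, just before the first element of S, belongs
   to S' although neither it nor its predecessor lies in S. *)
exfalso; have eh' : h' = h - u.+1%:R.
  by rewrite -[h'](addrK u.+2%:R) -eh -[u.+2%:R]natr1; ring.
have [nu|un] := ltnP n u.+2.
  have := sub h'; have := hS' 0%N; rewrite subr0 => -> // /(_ n0)/orP[].
    by rewrite eh' hS; lia.
  rewrite (_ : h' - 1 = h - u.+2%:R) ?hS; [lia|by []|].
  by rewrite eh' -[u.+2%:R]natr1; ring.
have := sub (h - n%:R); have -> : h - n%:R = h' - (n - u.+1)%N%:R.
  by rewrite eh' natrB; [ring | lia].
rewrite hS'; last lia.
have -> : h' - (n - u.+1)%N%:R = h - n%:R.
  by rewrite eh' natrB; [ring | lia].
have -> : h - n%:R - 1 = h - n.+1%:R by rewrite -natr1; ring.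
by rewrite !hS; lia.
Qed.

(** Without a third outside vertex, the single-vertex insertions are used: they put the
    in-neighbours of each vertex into S or S + 1 for the set S of the other. Two intervals of equal
    length cannot each be one step ahead of the other. *)
Lemma rigid_pair y z : y \in rest x -> z \in rest x -> y != z -> k = 2%N ->
  inC e x y = inC e x z.
Proof.
move=> ry rz yz ek; have [[injx _] _ ne mis ins] := rx.
have zy : z != y by rewrite eq_sym.
have [iy oy] := ne y ry; have [iz oz] := ne z rz.
have [cyz eyz _] := rigid_cards ry rz yz; have [czy _ _] := rigid_cards rz ry zy.
have [h [hS hT]] := misses_tight_run k2 iy oz (mis y z ry rz yz) cyz.
have [h' [hS' hT']] := misses_tight_run k2 iz oy (mis z y rz ry zy) czy.
have n0 : (0 < #|inC e x y|)%N by rewrite card_gt0.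
have nm : (#|inC e x y| <= m)%N.
  by move: oz; rewrite -card_gt0 => oz; move: cyz oz; rewrite ek; rlia.
have sub u v : u \in rest x -> v \in rest x -> u != v ->
    forall i, i \in inC e x v -> (i \in inC e x u) || (i - 1 \in inC e x u).
  move=> ru rv uv i Si; have [iu _] := ne u ru; have [_ ov] := ne v rv.
  have [cuv _ _] := rigid_cards ru rv uv.
  have eT := misses_tight (ltnW k2) iu ov (mis u v ru rv uv) cuv.
  have := ins v rv i 1%N Si isT; rewrite eT in_setC negbK ek.
  case/windowP=> -[|[|[|t]]] // _; first by rewrite addrK => ->.
  by rewrite (_ : i + 1%:R - 2%:R = i - 1) => [->|]; [rewrite orbT | ring].
have eh : h' = h.
  rewrite -eyz in hS'.
  have [//|e1] := interval_shift n0 nm hS hS' (sub _ _ ry rz yz).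
  have [//|e2] := interval_shift n0 nm hS' hS (sub _ _ rz ry zy).
  have : h + 1 + 1 != h by apply: (@shift_neq _ 2); [lia | ring].
  by rewrite -e1 -e2 eqxx.
apply/setP=> i; pose t : 'I_m.+2 := h - i; have tM := ltn_ord t.
have -> : i = h - (t : nat)%:R by rewrite natr_Zp /t; ring.
by rewrite hS // -{1}eh hS' // eyz.
Qed.

(** For k >= 3 choose a third vertex w: the union of the in-neighbour sets of y and z still misses
    the out-neighbours of w, so tightness for each of them makes them equal. *)
Lemma rigid_common : exists S T : {set 'I_m.+2},
  {in rest x, forall y, inC e x y = S /\ outC e x y = T}.
Proof.
have [[injx _] _ ne mis ins] := rx.
have [y0 r0] : exists y, y \in rest x.
  by apply/card_gt0P; rewrite (size_rest injx) ltnW.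
have third y z : exists2 w, w \in rest x & (2 < k)%N -> (w != y) && (w != z).
  have [k3|k3] := ltnP 2 k; last by exists y0.
  have : (0 < #|rest x :\ y :\ z|)%N.
    have := cardsD1 y (rest x); have := cardsD1 z (rest x :\ y).
    by rewrite (size_rest injx); lia.
  by case/card_gt0P=> w; rewrite !in_setD1 => /and3P[wz wy rw]; exists w; rewrite // wy.
have eqS y z : y \in rest x -> z \in rest x -> inC e x y = inC e x z.
  move=> ry rz; have [->//|yz] := eqVneq y z.
  have [k3|k3] := ltnP 2 k; last by apply: rigid_pair => //; lia.
  have [w rw /(_ k3)/andP[wy wz]] := third y z.
  rewrite eq_sym in wy; rewrite eq_sym in wz.
  have [cy _ _] := rigid_cards ry rw wy; have [cz _ _] := rigid_cards rz rw wz.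
  have [iy _] := ne y ry; have [_ ow] := ne w rw.
  have iU : inC e x y :|: inC e x z != set0.
    by apply: contraNneq iy => e0; rewrite -subset0 -e0 subsetUl.
  have mU : misses k (inC e x y :|: inC e x z) (outC e x w).
    by move=> i t /setUP[]; [apply: mis | apply: mis].
  have := misses_card (ltnW k2) iU ow mU => cU.
  have sz : (#|inC e x y :|: inC e x z| <= #|inC e x y|)%N by rlia.
  have sy : (#|inC e x y :|: inC e x z| <= #|inC e x z|)%N by rlia.
  have /eqP -> : inC e x y == inC e x y :|: inC e x z by rewrite eqEcard subsetUl.
  by apply/eqP; rewrite eq_sym eqEcard subsetUr.
have eqT y z : y \in rest x -> z \in rest x -> outC e x y = outC e x z.
  move=> ry rz; have [->//|yz] := eqVneq y z.
  have zy : z != y by rewrite eq_sym.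
  have [iy oy] := ne y ry; have [iz oz] := ne z rz.
  have [cyz _ _] := rigid_cards ry rz yz; have [czy _ _] := rigid_cards rz ry zy.
  rewrite (misses_tight (ltnW k2) iy oz (mis y z ry rz yz) cyz).
  by rewrite (misses_tight (ltnW k2) iz oy (mis z y rz ry zy) czy) (eqS y z).
exists (inC e x y0), (outC e x y0) => y ry.
by split; [apply: eqS | apply: eqT].
Qed.

(* x_h is the last in-neighbour of the outside before the k vertices having no
   arc with the outside; c separates the two kinds of the remaining ones. *)
Lemma rigid_frame : exists (h : 'I_m.+2) (c : nat),
  [/\ (c + k < m.+2)%N,
      forall y g, y \in rest x -> (g < k)%N ->
        ~~ e (x (h + g.+1%:R)) y && ~~ e y (x (h + g.+1%:R)),
      forall y g, y \in rest x -> (g + k < m.+2)%N ->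
        e (x (h + (k + g).+1%:R)) y = (c <= g)%N
    & forall y g, y \in rest x -> (g + k < m.+2)%N ->
        e y (x (h + (k + g).+1%:R)) = (g <= c)%N].
Proof.
have [[injx _] _ ne mis ins] := rx; have [S [T eST]] := rigid_common.
have [y [z [ry rz yz]]] : exists y z, [/\ y \in rest x, z \in rest x & y != z].
  have /card_gt1P[y [z [ry rz yz]]] : (1 < #|rest x|)%N.
    by rewrite (size_rest injx).
  by exists y, z.
have [iy _] := ne y ry; have [_ oz] := ne z rz.
have [cyz _ _] := rigid_cards ry rz yz; have myz := mis y z ry rz yz.
have [[eSy _] [_ eTz]] := (eST y ry, eST z rz).
rewrite eSy eTz in iy oz cyz myz.
have [h [hS hT]] := misses_tight_run k2 iy oz myz cyz.
have S0 : (0 < #|S|)%N by rewrite card_gt0.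
have T0 : (0 < #|T|)%N by rewrite card_gt0.
have hS' g : (g < m.+2)%N -> (h + g.+1%:R \in S) = (m.+2 - g.+1 < #|S|)%N.
  move=> gM; rewrite -hS; last lia.
  by congr (_ \in S); rewrite natrB ?natr_size //; ring.
(* S fills the last #|S| of the m.+2 - k positions after the gap, so it starts at position c; T ends
   at the same position. *)
exists h, (m.+2 - k - #|S|)%N; split.
- by rlia.
- move=> v g rv gk; have [eS eT] := eST v rv.
  by rewrite -in_inC -in_outC eS eT hS' ?hT; rlia.
- move=> v g rv gk; have [eS eT] := eST v rv.
  by rewrite -in_inC eS hS'; rlia.
- move=> v g rv gk; have [eS eT] := eST v rv.
  by rewrite -in_outC eT hT; rlia.
Qed.

End Common.
End Rigid.

(** * Two complete blocks attached to a common path *)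

Section Twins.
Variables (V : finType) (e : rel V) (s : nat).
Hypothesis De : dense e s.

(** The path q_0,...,q_(N-1) is the part of the cycle adjacent to the outside [B]; q_c is its only
    vertex joined to [B] in both directions. *)
Record half (N k : nat) (q : nat -> V) (B : {set V}) (c : nat) : Prop := Half {
  half_card : #|B| = k;
  half_complete : complete_on e B;
  half_lt : (c < N)%N;
  half_in : forall b g, b \in B -> (g < N)%N -> e (q g) b = (c <= g)%N;
  half_out : forall b g, b \in B -> (g < N)%N -> e b (q g) = (g <= c)%N
}.

Record twins (N k : nat) (q : nat -> V) (B R : {set V}) (c d : nat) : Prop :=
  Twins {
  twins_card : #|V| = (N + k.*2)%N;
  twins_k : (1 < k)%N;
  twins_half1 : half N k q B c;
  twins_half2 : half N k q R d;
  twins_inj : forall g h, (g < N)%N -> (h < N)%N -> q g = q h -> g = h;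
  twins_path : forall g, (g.+1 < N)%N -> e (q g) (q g.+1);
  twins_cases : forall v,
    [\/ v \in B, v \in R | exists2 g, (g < N)%N & v = q g];
  twins_disj : [disjoint B & R];
  twins_q : forall g, (g < N)%N -> (q g \notin B) && (q g \notin R);
  twins_sep : forall b r, b \in B -> r \in R -> ~~ e b r && ~~ e r b
}.

Lemma twins_sym N k q B R c d : twins N k q B R c d -> twins N k q R B d c.
Proof.
case=> h1 h2 h3 h4 h5 h6 h7 h8 h9 h10; split=> //.
- by move=> v; case: (h7 v); [constructor 2 | constructor 1 | constructor 3].
- by rewrite disjoint_sym.
- by move=> g gN; rewrite andbC; apply: h9.
- by move=> b r Rb Br; rewrite andbC; apply: h10.
Qed.

Lemma complete_walk (B : {set V}) y l :
    complete_on e B -> {subset y :: l <= B} -> uniq (y :: l) ->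
  walk e y (last y l) (y :: l).
Proof.
move=> cB; elim: l y => [|z l IH] y sub; first by move=> _; apply: walk1.
rewrite cons_uniq => /andP[yl ul]; rewrite last_cons; apply: walk_cons (IH _ _ ul).
  apply: cB; first by apply: sub; rewrite mem_head.
    by apply: sub; rewrite !inE eqxx orbT.
  by apply: contraNneq yl => ->; rewrite mem_head.
by move=> v vl; apply: sub; rewrite inE vl orbT.
Qed.

Lemma complete_list (B : {set V}) n : complete_on e B -> (0 < n <= #|B|)%N ->
  exists y z l, [/\ walk e y z l, uniq l, size l = n & {subset l <= B}].
Proof.
move=> cB /andP[n0 nB]; pose l := take n (enum B).
have sl : size l = n by rewrite size_takel // -cardE.
have ul : uniq l by rewrite take_uniq ?enum_uniq.
have lB : {subset l <= B} by move=> v /mem_take; rewrite mem_enum.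
case: l sl ul lB n0 => [|y l] sl ul lB; first by rewrite -sl.
by move=> _; exists y, (last y l), (y :: l); split=> //; apply: complete_walk lB ul.
Qed.

Section Small.
Variables (N k c d : nat) (q : nat -> V) (B R : {set V}).
Hypotheses (TW : twins N k q B R c d) (cd : (c <= d)%N).
Hypothesis nocyc : ~ cyc e #|V|.-1.

Lemma walk_block u n : (u + n < N)%N ->
  walk e (q u) (q (u + n)) [seq q t | t <- iota u n.+1].
Proof.
elim: n u => [|n IH] u uN; first by rewrite addn0; apply: walk1.
rewrite -addSnnS; apply: walk_cons; first by apply: (twins_path TW); lia.
by apply: IH; lia.
Qed.

(** All but one vertex of B, then q_0..q_g, q_h..q_(N-1), R, q_(g+1)..q_(h-1) and back to B form a
    cycle of length p-1: g < d lets R reach q_(g+1), and c < h lets q_(h-1) reach B. *)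
Lemma no_forward_chord g h :
  (g < d)%N -> (c < h)%N -> (h < N)%N -> (g.+1 < h)%N -> ~~ e (q g) (q h).
Proof.
move=> gd ch hN gh; apply/negP=> egh; apply: nocyc.
have [cV k2 HB HR injq pq _ disj nq sep] := TW.
have [y [z [lB [wB uB sB subB]]]] : exists y z l,
    [/\ walk e y z l, uniq l, size l = k.-1 & {subset l <= B}].
  by apply: complete_list (half_complete HB) _; rewrite (half_card HB); lia.
have [y' [z' [lR [wR uR sR subR]]]] : exists y z l,
    [/\ walk e y z l, uniq l, size l = k & {subset l <= R}].
  by apply: complete_list (half_complete HR) _; rewrite (half_card HR); lia.
have [By Bz] := (subB _ (walk_head wB), subB _ (walk_last wB)).
have [Ry Rz] := (subR _ (walk_head wR), subR _ (walk_last wR)).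
have dN := half_lt HR.
have [i eh] : exists i, h = (g.+1 + i).+1.
  by exists (h - g.+2)%N; move: gh; clear; lia.
have [j eN] : exists j, N = (h + j).+1.
  by exists (N - h.+1)%N; move: hN; clear; lia.
have gN : (g < N)%N by rewrite (ltn_trans _ hN) // ltnW.
have w1 : walk e (q 0) (q g) [seq q t | t <- iota 0 g.+1].
  exact: (@walk_block 0).
have w2 : walk e (q h) (q (h + j)) [seq q t | t <- iota h j.+1].
  by apply: walk_block; rewrite eN.
have w3 : walk e (q g.+1) (q (g.+1 + i)) [seq q t | t <- iota g.+1 i.+1].
  by apply: walk_block; rewrite eN eh; clear; lia.
have a1 : e z (q 0) by rewrite (half_out HB) // (leq_ltn_trans _ gN).
have a2 : e (q (h + j)) y'.
  by rewrite (half_in HR) ?eN // -ltnS -eN.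
have a3 : e z' (q g.+1) by rewrite (half_out HR) // (ltn_trans gh hN).
have a4 : e (q (g.+1 + i)) y.
  rewrite (half_in HB) //; first by move: ch; rewrite eh.
  by rewrite eN eh; clear; lia.
have W := walk_cat wB a1 (walk_cat w1 egh (walk_cat w2 a2 (walk_cat wR a3 w3))).
set l := lB ++ _ in W.
have -> : #|V|.-1 = size l.
  rewrite !size_cat !size_map !size_iota cV sB sR eN eh.
  by move: k2; clear; lia.
apply: (walk_cyc W a4).
have /perm_uniq-> : perm_eq l ([seq q t | t <- iota 0 g.+1 ++
    (iota h j.+1 ++ iota g.+1 i.+1)] ++ (lB ++ lR)).
  apply/permP=> p; rewrite /l !map_cat !count_cat.
  by move: (count p _) (count p _) (count p _) (count p lB) (count p lR); clear; lia.
have mem_idx u : u \in iota 0 g.+1 ++ (iota h j.+1 ++ iota g.+1 i.+1) ->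
    (u < N)%N.
  by rewrite eN eh !mem_cat !mem_iota; clear; lia.
rewrite cat_uniq; apply/and3P; split.
- rewrite map_inj_in_uniq; last by move=> u v /mem_idx uN /mem_idx; apply: injq.
  rewrite !cat_uniq !iota_uniq !andbT !andTb eh; clear; apply/andP; split.
    by apply/hasPn=> u; rewrite mem_cat !mem_iota; lia.
  by apply/hasPn=> u; rewrite !mem_iota; lia.
- apply/hasPn=> v vl; apply/negP=> /mapP[t /mem_idx/nq + ev].
  rewrite -ev; move: vl; rewrite mem_cat => /orP[/subB|/subR] -> //.
  by rewrite andbF.
rewrite cat_uniq uB uR andbT; apply/hasPn=> v /subR Rv; apply/negP=> /subB Bv.
by have := disjointFr disj Bv; rewrite Rv.
Qed.

Lemma card_block (A A' : {set V}) (l : seq nat) :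
    (forall v, v \in A -> v \in A' \/ exists2 g, g \in l & v = q g) ->
  (#|A| <= #|A'| + size l)%N.
Proof.
move=> hA; rewrite -(size_map q).
have : A \subset A' :|: [set v in [seq q t | t <- l]].
  apply/subsetP=> v /hA[|[g gl ->]]; rewrite !inE; first by move=> ->.
  by rewrite map_f ?orbT.
move/subset_leq_card/leq_trans; apply.
apply: leq_trans (leq_card_setU _ _) _; rewrite leq_add2l cardsE.
exact: card_size.
Qed.

(** If c > 0, the out-neighbours of q_0 are among q_1,...,q_c, and with the in-degree of a vertex of
    B, at most k-1+N-c, the sum falls below 2s; d is treated dually. Then a vertex of B has
    out-degree at most k, so s <= k, and N + 2k <= 2s+2 leaves N <= 2. *)
Lemma twins_small : [/\ c = 0%N, d = N.-1 & (N <= 2)%N].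
Proof.
have [irr s1 sV semi _] := De.
have [cV k2 HB HR injq pq cas disj nq sep] := TW.
have [b Bb] : exists b, b \in B by apply/card_gt0P; rewrite (half_card HB); lia.
have [r Rr] : exists r, r \in R by apply/card_gt0P; rewrite (half_card HR); lia.
have cN := half_lt HB; have dN := half_lt HR.
have cD (A : {set V}) v : v \in A -> #|A :\ v| = #|A|.-1.
  by move=> Av; rewrite (cardsD1 v A) Av.
have insb : (#|ins e b| <= k.-1 + (N - c))%N.
  rewrite -(half_card HB) -(cD B b Bb) -[X in (_ + X)%N](size_iota c).
  apply: card_block => v; rewrite inE => evb.
  case: (cas v) => [Bv|Rv|[g gN ev]].
  - by left; rewrite !inE Bv andbT; apply: contraTneq evb => ->; rewrite irr.
  - by case/andP: (sep b v Bb Rv) => _; rewrite evb.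
  by right; exists g => //; rewrite mem_iota -(half_in HB Bb gN) -ev evb; lia.
have outr : (#|outs e r| <= k.-1 + d.+1)%N.
  rewrite -(half_card HR) -(cD R r Rr) -[X in (_ + X)%N](size_iota 0).
  apply: card_block => v; rewrite inE => evb.
  case: (cas v) => [Bv|Rv|[g gN ev]].
  - by case/andP: (sep v r Bv Rr) => _; rewrite evb.
  - by left; rewrite !inE Rv andbT; apply: contraTneq evb => ->; rewrite irr.
  by right; exists g => //; rewrite mem_iota ltnS -(half_out HR Rr gN) -ev evb.
have c0 : c = 0%N.
  apply/eqP; rewrite -leqn0 leqNgt; apply/negP=> c0.
  suff : (#|outs e (q 0)| <= #|(set0 : {set V})| + size (iota 1 c))%N.
    rewrite cards0 size_iota; have [] := semi (q 0); have [] := semi b.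
    by move: sV insb; rewrite cV; lia.
  apply: card_block => v; rewrite inE => e0v; right.
  case: (cas v) => [Bv|Rv|[g gN ev]].
  - by move: e0v; rewrite (half_in HB) //; lia.
  - by move: e0v; rewrite (half_in HR) //; lia.
  exists g => //; rewrite mem_iota.
  have [g0|g0] := posnP g; first by move: e0v; rewrite ev g0 irr.
  rewrite add1n ltnS leqNgt; apply/negP => cg.
  by move: (@no_forward_chord 0 g); rewrite -ev e0v; lia.
have dN1 : d = N.-1.
  apply/eqP; rewrite eqn_leq; apply/andP; split; first lia.
  rewrite leqNgt; apply/negP => dN1.
  suff : (#|ins e (q N.-1)| <= #|(set0 : {set V})| + size (iota d (N.-1 - d)))%N.
    rewrite cards0 size_iota; have [] := semi (q N.-1); have [] := semi r.
    by move: sV outr; rewrite cV; lia.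
  apply: card_block => v; rewrite inE => e0v; right.
  case: (cas v) => [Bv|Rv|[g gN ev]].
  - by move: e0v; rewrite (half_out HB) //; lia.
  - by move: e0v; rewrite (half_out HR) //; lia.
  exists g => //; rewrite mem_iota subnKC; last lia.
  have [g0|g0] := eqVneq g N.-1; first by move: e0v; rewrite ev g0 irr.
  rewrite [X in _ && X](_ : _ = true) ?andbT; last lia.
  rewrite leqNgt; apply/negP => cg.
  by move: (@no_forward_chord g N.-1); rewrite -ev e0v; lia.
split=> //.
have outb : (#|outs e b| <= k.-1 + 1)%N.
  rewrite -(half_card HB) -(cD B b Bb) -[X in (_ + X)%N](size_iota 0).
  apply: card_block => v; rewrite inE => evb.
  case: (cas v) => [Bv|Rv|[g gN ev]].
  - by left; rewrite !inE Bv andbT; apply: contraTneq evb => ->; rewrite irr.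
  - by case/andP: (sep b v Bb Rv) => + _; rewrite evb.
  right; exists g => //; rewrite mem_iota.
  by have := half_out HB Bb gN; rewrite -ev evb c0; clear; lia.
by have [+ _] := semi b; move: sV outb; rewrite cV; lia.
Qed.

End Small.
End Twins.

(** * Exchanging the whole outside with the nonadjacent cycle vertices *)

Section Swap.
Variables (V : finType) (e : rel V) (s m k : nat).
Hypotheses (De : dense e s) (cV : #|V| = (k + m.+2)%N) (k2 : (1 < k)%N).
Variables (x : 'I_m.+2 -> V) (h : 'I_m.+2) (c : nat).
Hypothesis rx : rigid e k x.

(** The conclusion of [rigid_frame], restated for use as a hypothesis. *)
Definition frame (y : 'I_m.+2 -> V) (h : 'I_m.+2) (c : nat) :=
  [/\ (c + k < m.+2)%N,
      forall v g, v \in rest y -> (g < k)%N ->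
        ~~ e (y (h + g.+1%:R)) v && ~~ e v (y (h + g.+1%:R)),
      forall v g, v \in rest y -> (g + k < m.+2)%N ->
        e (y (h + (k + g).+1%:R)) v = (c <= g)%N
    & forall v g, v \in rest y -> (g + k < m.+2)%N ->
        e v (y (h + (k + g).+1%:R)) = (g <= c)%N].

Hypothesis fx : frame x h c.

Definition swapped (j : 'I_m.+2) : V :=
  let g : 'I_m.+2 := j - (h + 1) in
  if (g < k)%N then nth (x h) (enum (rest x)) g else x j.

Lemma swappedE g : (g < m.+2)%N -> swapped (h + g.+1%:R) =
  if (g < k)%N then nth (x h) (enum (rest x)) g else x (h + g.+1%:R).
Proof.
move=> gM; rewrite /swapped.
have -> : h + g.+1%:R - (h + 1) = g%:R by rewrite -natr1; ring.
by rewrite Zp_nat /= modn_small.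
Qed.

Lemma ord_pos j : exists2 g : nat, (g < m.+2)%N & j = h + g.+1%:R.
Proof.
have [g gM ->] := ord_shift (h + 1) j; exists g => //.
by rewrite -natr1; ring.
Qed.

Let injx : injective x. Proof. by case: rx => -[]. Qed.

Lemma size_enum_rest : size (enum (rest x)) = k.
Proof. by rewrite -cardE (size_rest cV injx). Qed.

Lemma nth_rest g : (g < k)%N -> nth (x h) (enum (rest x)) g \in rest x.
Proof. by move=> gk; rewrite -mem_enum mem_nth // size_enum_rest. Qed.

Lemma nth_rest_neq g j : (g < k)%N -> nth (x h) (enum (rest x)) g != x j.
Proof.
by move/nth_rest; rewrite inE => /(notin_codom j) xj; rewrite eq_sym xj.
Qed.

Lemma k_lt : (k < m.+2)%N.
Proof. by case: fx => ck _ _ _; apply: leq_ltn_trans ck; apply: leq_addl. Qed.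

(** x_h dominates the outside and the outside dominates x_(h+k+1); as the outside is complete, any
    order of its vertices fits in between. *)
Lemma cycle_swapped : cycle_fun e swapped.
Proof.
have [[_ ex] cB _ _ _] := rx; have [ck _ inx outx] := fx; have kM := k_lt.
split=> [i j|i].
  have [g gM ->] := ord_pos i; have [g' gM' ->] := ord_pos j.
  rewrite !swappedE //; case: ltnP => gk; case: ltnP => gk'.
  - move/eqP; rewrite nth_uniq ?size_enum_rest ?enum_uniq //.
    by move/eqP->.
  - by move/eqP; rewrite (negbTE (nth_rest_neq _ gk)).
  - by move/esym/eqP; rewrite (negbTE (nth_rest_neq _ gk')).
  - exact: injx.
have [g gM ei] := ord_pos i.
have [g1|g1] := ltnP g.+1 m.+2; last first.
  have eg : g = m.+1 by move: gM g1; clear; lia.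
  have -> : i + 1 = h + 1%:R.
    by rewrite ei eg -addrA natr1 -natr1 natr_size add0r.
  rewrite ei !swappedE // (ltnW k2) ltnNge -ltnS eg kM /=.
  have := inx _ (m.+1 - k)%N (nth_rest (ltnW k2)).
  rewrite subnK // subnKC // => -> //.
  by move: ck; clear; lia.
have e1 : i + 1 = h + g.+2%:R by rewrite ei -addrA natr1.
rewrite e1 ei !swappedE //; have [gk1|gk1] := ltnP g.+1 k.
  rewrite (ltnW gk1); apply: cB; try by apply: nth_rest => //; apply: ltnW.
  rewrite nth_uniq ?size_enum_rest ?enum_uniq //; last exact: ltnW.
  by rewrite neq_ltn ltnSn.
have [gk|gk] := ltnP g k.
  have eg : g.+1 = (k + 0)%N by rewrite addn0; apply/eqP; rewrite eqn_leq gk.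
  by rewrite eg outx //; apply: nth_rest.
by have := ex (h + g.+1%:R); rewrite -addrA natr1.
Qed.

Lemma rest_swapped v :
  (v \in rest swapped) <-> exists2 g, (g < k)%N & v = x (h + g.+1%:R).
Proof.
have kM := k_lt; rewrite inE; split=> [nv|[g gk ->]].
  have vx : v \in codom x.
    apply: contraR nv => nvx; have : v \in enum (rest x) by rewrite mem_enum inE.
    move=> /(nthP (x h))[g]; rewrite size_enum_rest => gk <-.
    apply/codomP; exists (h + g.+1%:R).
    by rewrite swappedE ?gk // (ltn_trans gk).
  have /codomP[j ej] := vx; have [g gM ejg] := ord_pos j.
  exists g; last by rewrite -ejg.
  rewrite ltnNge; apply: contra nv => kg; apply/codomP; exists j.
  by rewrite ejg swappedE // ltnNge kg -ejg.
apply/negP=> /codomP[j]; have [g' gM ->] := ord_pos j.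
rewrite swappedE //; case: ltnP => [gk'|gk'].
  by move/esym/eqP; rewrite (negbTE (nth_rest_neq _ gk')).
move/injx/addrI => /eqP; rewrite -!natr1 (inj_eq (addIr _)).
rewrite natr_ord_inj ?(ltn_trans gk) // => /eqP eg.
by move: gk; rewrite eg ltnNge gk'.
Qed.

Hypothesis rs : rigid e k swapped.

Lemma rigid_twins : exists (q : nat -> V) (R : {set V}) (d : nat),
  twins e (m.+2 - k) k q (rest x) R c d.
Proof.
have [[_ ex] cB _ _ _] := rx; have [ck sepx inx outx] := fx; have kM := k_lt.
have [[injs es] cR _ _ _] := rs.
have [h' [d [dk seps ins' outs']]] := rigid_frame De cV k2 rs.
(* x_h dominates x_(h+1), which is now outside, while the next vertex of the new cycle, formerly
   outside, does not. In the new frame h' is the only in-neighbour of the outside followed by a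
   position that is not one. *)
have eh : h' = h.
  have r0 : x (h + 1%:R) \in rest swapped.
    by apply/rest_swapped; exists 0%N => //; apply: ltnW.
  have xh : swapped h = x h.
    have eh : h = h + m.+2%:R by rewrite natr_size addr0.
    by rewrite {1}eh swappedE // ltnNge -ltnS kM /= -eh.
  have [t tM et] : exists2 t : nat, (t < m.+2)%N & h = h' + t.+1%:R.
    have [t tM ->] := ord_shift (h' + 1) h; exists t => //.
    by rewrite -natr1; ring.
  have eh1 : e (swapped h) (x (h + 1%:R)) by rewrite xh; apply: ex.
  have eh2 : ~~ e (swapped (h + 1)) (x (h + 1%:R)).
    rewrite -[1]/(1%:R) swappedE // (ltnW k2).
    have := sepx (nth (x h) (enum (rest x)) 0) 0%N.
    by rewrite nth_rest ?(ltnW k2) // => /(_ isT isT)/andP[].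
  have [tk|kt] := ltnP t k.
    by have /andP[+ _] := seps _ t r0 tk; rewrite -et eh1.
  have [t1|t1] := ltnP t.+1 m.+2.
    have := ins' _ (t - k)%N r0; rewrite subnK // subnKC // -et eh1 => /(_ tM).
    have := ins' _ (t.+1 - k)%N r0; rewrite (subnK (leqW kt)) (subnKC (leqW kt)).
    move=> /(_ t1).
    rewrite -[t.+2%:R]natr1 addrA -et (negbTE eh2) => /esym/negbT h1 /esym h2.
    by case/negP: h1; apply: leq_trans h2 _; apply: leq_sub2r.
  have -> : h' = h' + m.+2%:R by rewrite natr_size addr0.
  by rewrite et (_ : t = m.+1) //; move: tM t1; clear; lia.
pose q g := x (h + (k + g).+1%:R).
have qs g : (g < m.+2 - k)%N -> q g = swapped (h + (k + g).+1%:R).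
  move=> gN; rewrite swappedE; last by rewrite -ltn_subRL.
  by rewrite ltnNge leq_addr.
have gNk g : (g < m.+2 - k)%N = (g + k < m.+2)%N by rewrite ltn_subRL addnC.
exists q, (rest swapped), d; split.
- by rewrite cV -addnn addnA subnK ?(ltnW kM) // addnC.
- exact: k2.
- split=> //; first exact: (size_rest cV injx).
  + by rewrite gNk.
  + by move=> b g Bb; rewrite gNk; apply: inx.
  + by move=> b g Bb; rewrite gNk; apply: outx.
- split=> //; first exact: (size_rest cV injs).
  + by rewrite gNk.
  + by move=> r g Rr gN; rewrite qs // -eh ins' // -gNk.
  + by move=> r g Rr gN; rewrite qs // -eh outs' // -gNk.
- move=> g g' gN g'N /injx/addrI/eqP; rewrite -!natr1 (inj_eq (addIr _)).
  rewrite natr_ord_inj; [|by rewrite addnC -gNk|by rewrite addnC -gNk].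
  by rewrite eqn_add2l => /eqP.
- move=> g gN; rewrite /q; have := ex (h + (k + g).+1%:R).
  by rewrite -addrA natr1 addnS.
- move=> v; have [nvx|] := boolP (v \in rest x); first by constructor 1.
  rewrite inE negbK => /codomP[j ->]; have [g gM ej] := ord_pos j.
  have [gk|kg] := ltnP g k.
    by constructor 2; apply/rest_swapped; exists g; rewrite // ej.
  constructor 3; exists (g - k)%N; first by rewrite ltn_sub2r.
  by rewrite /q subnKC // -ej.
- rewrite disjoint_subset; apply/subsetP=> b; rewrite !inE => nbx.
  rewrite negbK; have : b \in enum (rest x) by rewrite mem_enum inE.
  move=> /(nthP (x h))[g]; rewrite size_enum_rest => gk <-.
  apply/codomP; exists (h + g.+1%:R).
  by rewrite swappedE ?gk // (ltn_trans gk).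
- move=> g gN; rewrite !inE !negbK {2}qs // !codom_f //.
- move=> b r Bb /rest_swapped[g gk ->].
  by have := sepx b g Bb gk; rewrite andbC.
Qed.

End Swap.

(** * Conclusion for two outside vertices *)

Section PairConclusion.
Variables (V : finType) (e : rel V) (s m : nat).
Hypotheses (De : dense e s) (cV : #|V| = m.+4) (nocyc : ~ cyc e m.+3).
Implicit Types (x : 'I_m.+2 -> V) (a b : V) (i j : 'I_m.+2).

Definition twinned := exists N k q B R c d, @twins V e N k q B R c d.

Definition insertion x a b :=
  [exists j : 'I_m.+2, e (x j) a && e b (x (j + 1)) ||
                       e (x j) b && e a (x (j + 1))].

(** Shift 1 is excluded by the absence of an insertion and shift 2 by [no_replace]: the k shifts
    needed for k = 2. *)
Lemma config_rigid x a b : config e x a b -> e a b -> e b a ->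
  ~~ insertion x a b -> rigid e 2 x.
Proof.
move=> C eab eba /existsPn nins; have Cs := config_sym C.
have [cx ax bx ab] := C; have er := config_rest cV C.
have [s1 _ _] := order_bounds De cV.
have ne c d : config e x c d -> e c d -> e d c ->
    inC e x c != set0 /\ outC e x c != set0.
  move=> C' ecd edc; have [] := config_semi De cV C'.
  by rewrite ecd edc -!card_gt0; move: s1; split; rlia.
have mis c d : config e x c d -> e c d ->
    (forall j, ~~ (e (x j) c && e d (x (j + 1)))) ->
    misses 2 (inC e x c) (outC e x d).
  move=> C' ecd nins' i [|[|[|t]]] //; rewrite in_inC in_outC => Si _.
    by have := nins' i; rewrite Si.
  exact: (no_replace cV nocyc C' ecd Si).
have nins1 j : ~~ (e (x j) a && e b (x (j + 1))).
  by have := nins j; rewrite negb_or => /andP[].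
have nins2 j : ~~ (e (x j) b && e a (x (j + 1))).
  by have := nins j; rewrite negb_or => /andP[].
split=> //.
- move=> y z; rewrite er => /set2P[]-> /set2P[]->; rewrite ?eqxx //.
- by move=> y; rewrite er => /set2P[]->; [apply: ne C _ _ | apply: ne Cs _ _].
- move=> y z; rewrite er => /set2P[]-> /set2P[]->; rewrite ?eqxx // => _.
    exact: mis.
  exact: mis Cs eba nins2.
- move=> y ry i [|[|t]] //; rewrite in_inC in_outC => Si _.
  by apply: (no_insert cV nocyc cx _ Si); rewrite inE in ry.
Qed.

(** Otherwise all of the at least m.+3 arcs at a would join it to the cycle, where [no_insert]
    admits only m.+2. *)
Lemma config_arc x a b : config e x a b -> e a b || e b a.
Proof.
move=> C; apply: contraT; rewrite negb_or => /andP[nab nba].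
have [cx ax _ _] := C; have := config_deg De cV C.
rewrite (negbTE nab) (negbTE nba).
have dis : outC e x a :&: shift_set 1 (inC e x a) = set0.
  apply/setP=> i; rewrite in_setI in_set0 in_outC in_shift_set in_inC.
  apply/negP=> /andP[+ eia]; apply/negP.
  by have := no_insert cV nocyc cx ax eia; rewrite subrK.
have := max_card (mem (outC e x a :|: shift_set 1 (inC e x a))).
by rewrite cardsU dis cards0 card_shift_set card_ord; rlia.
Qed.

Lemma rigid_config_twinned x a b : config e x a b -> e a b -> e b a ->
  ~~ insertion x a b -> bipart e \/ twinned.
Proof.
move=> C eab eba nins; have rx := config_rigid C eab eba nins.
have cV2 : #|V| = (2 + m.+2)%N by rewrite cV.
have [h [c fx]] := rigid_frame De cV2 isT rx.
have [ck sepx inx outx] := fx; have [[injx ex] _ _ _ _] := rx.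
have cs := cycle_swapped cV2 isT rx fx.
set sw := swapped _ _ _ in cs.
have rest_sw v := rest_swapped cV2 rx fx v.
pose v := x (h + 1%:R); pose w := x (h + 2%:R).
have rv : v \in rest sw by apply/rest_sw; exists 0%N.
have rw : w \in rest sw by apply/rest_sw; exists 1%N.
have vw : v != w.
  by rewrite (inj_eq injx) eq_sym; apply: (@shift_neq _ 1) => //; ring.
have Cs : config e sw v w.
  by split=> //; [move: rv | move: rw]; rewrite inE.
have [evw|nevw] := boolP (e v w); last first.
  left; apply: (single_bipart De cV nocyc (config_sym Cs)) => //.
  by have := config_arc Cs; rewrite (negbTE nevw).
have [ewv|newv] := boolP (e w v); last first.
  by left; apply: (single_bipart De cV nocyc Cs).

right; have rs : rigid e 2 sw.
  apply: (config_rigid Cs evw ewv); apply/existsP=> -[j].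
  (* x_h dominates both former outside vertices, so the first can be skipped. They are not adjacent
     to v and w, so an insertion of v and w would take place elsewhere and give length p-1. *)
  have skip : e (sw (h + 1 - 1)) (sw (h + 1 + 1)).
    rewrite addrK; have r2 := nth_rest cV2 h rx (isT : (1 < 2)%N).
    rewrite (_ : h + 1 + 1 = h + 2%:R); last by ring.
    rewrite /sw (@swappedE _ _ 2 x h 1) //=.
    have eh : h = h + m.+2%:R by rewrite natr_size addr0.
    rewrite {2}eh (@swappedE _ _ 2 x h m.+1) //=.
    have m0 : (m.+1 < 2)%N = false by have := m_gt0 De cV; clear; lia.
    rewrite m0.
    have := inx _ (m.+1 - 2)%N r2; rewrite subnK ?subnKC; last 2 first.
    - by have := m_gt0 De cV; clear; lia.
    - by have := m_gt0 De cV; clear; lia.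
    by move=> ->//; move: ck; clear; lia.
  have sepb u g : u \in rest sw -> (g < 2)%N ->
      ~~ e (sw (h + g.+1%:R)) u && ~~ e u (sw (h + g.+1%:R)).
    move=> /rest_sw[g' g'2 ->] g2; rewrite /sw swappedE ?g2; last first.
      by rewrite (leq_trans g2).
    have := sepx _ g' (nth_rest cV2 h rx g2) g'2.
    by rewrite andbC.
  have noins u u' : config e sw u u' -> u \in rest sw -> u' \in rest sw ->
      e u u' -> e (sw j) u -> e u' (sw (j + 1)) -> False.
    move=> C' ru ru' euu Sj Tj.
    apply: (negP (@no_skip _ _ _ cV nocyc _ _ _ _ _ C' euu Sj Tj _ _)) skip.
      apply: contraTneq Sj => <-.
      by have /andP[] := sepb u 0%N ru isT.
    apply: contraTneq Tj => <-.
    by have /andP[] := sepb u' 0%N ru' isT.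
  case/orP=> /andP[]; first exact: noins Cs rv rw evw.
  exact: noins (config_sym Cs) rw rv ewv.
have [q [R [d TW]]] := rigid_twins De cV2 isT rx fx rs.
by exists (m.+2 - 2)%N, 2%N, q, (rest x), R, c, d.
Qed.

(** Denying both outcomes supplies [both] and [inserted] for all configurations at once, as the
    exchange arguments require. *)
Lemma pairs_conclusion x a b : config e x a b -> bipart e \/ twinned.
Proof.
move=> C; have [?|nbip] := classic (bipart e); first by left.
have [?|ntw] := classic twinned; first by right.
have both (y : 'I_m.+2 -> V) c d : config e y c d -> e c d.
  move=> C'; apply/negPn/negP => ncd; have := config_arc C'.
  rewrite (negbTE ncd) /= => edc; apply: nbip.
  exact: (single_bipart De cV nocyc (config_sym C')).
have inserted (y : 'I_m.+2 -> V) c d : config e y c d ->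
    exists j, e (y j) c && e d (y (j + 1)) || e (y j) d && e c (y (j + 1)).
  move=> C'; apply/existsP; apply: contraT => nins.
  by have [/nbip|/ntw] := rigid_config_twinned C' (both _ _ _ C')
                  (both _ _ _ (config_sym C')) nins.
have [_ s2 s3] := order_bounds De cV.
have [ev|od] : (s.*2 = m.+2 \/ m.+3 = s.*2)%N by move: s2 s3; clear; lia.
  by left; apply: (even_bipart De cV nocyc both inserted ev C).
by case: (odd_impossible De cV nocyc both inserted od C).
Qed.

End PairConclusion.

(** * Cycles with at least three vertices outside *)

Section Long.
Variables (V : finType) (e : rel V) (s m k : nat).
Hypotheses (De : dense e s) (cV : #|V| = (k + m.+2)%N) (k3 : (2 < k)%N).
Hypothesis sM : (s < m.+2)%N.
Hypothesis maxc : forall L, (m.+2 < L < #|V|)%N -> ~ cyc e L.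
Variable x : 'I_m.+2 -> V.
Hypothesis cx : cycle_fun e x.

Definition in_rest v := #|ins e v :&: rest x|.
Definition out_rest v := #|outs e v :&: rest x|.
Definition rest_walk a b l := [/\ walk e a b l, uniq l & {subset l <= rest x}].

Let injx : injective x. Proof. by case: cx. Qed.
Let irr : irreflexive e. Proof. by case: De. Qed.
Let cR : #|rest x| = k. Proof. exact: (size_rest cV injx). Qed.

Lemma k_le : (k <= s.+1)%N.
Proof. by case: De => _ _ + _ _; rewrite cV; move: sM; clear; lia. Qed.

Lemma long_bounds : (s.*2 < k + m.+2 <= s.*2.+2)%N.
Proof. by case: De => _ _ + _ _; rewrite cV. Qed.

Lemma in_rest_semi v : (s <= #|inC e x v| + in_rest v)%N.
Proof. by rewrite -(card_ins _ _ injx); case: De => _ _ _ /(_ v)[]. Qed.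

Lemma out_rest_semi v : (s <= #|outC e x v| + out_rest v)%N.
Proof. by rewrite -(card_outs _ _ injx); case: De => _ _ _ /(_ v)[]. Qed.

Lemma rest_total v : (k + m.+1 <=
  (#|inC e x v| + in_rest v) + (#|outC e x v| + out_rest v))%N.
Proof.
rewrite -(card_ins _ _ injx) -(card_outs _ _ injx).
by case: De => _ _ _ _ /(_ v); rewrite cV; clear; lia.
Qed.

Lemma in_rest_le v (l : seq V) : uniq l -> {subset l <= rest x} ->
  (forall z, z \in l -> ~~ e z v) -> (in_rest v + size l <= k)%N.
Proof.
move=> ul lR nl; rewrite -cR -(card_uniqP ul) /in_rest.
rewrite -cardUI [X in (_ + X)%N](_ : _ = 0%N) ?addn0.
  apply/subset_leq_card/subsetP=> z.
  by rewrite !inE => /orP[/andP[]//|/lR]; rewrite inE.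
apply: eq_card0 => z; rewrite !inE; apply/negP=> /andP[/andP[ez _] /nl].
by rewrite ez.
Qed.

Lemma out_rest_le v (l : seq V) : uniq l -> {subset l <= rest x} ->
  (forall z, z \in l -> ~~ e v z) -> (out_rest v + size l <= k)%N.
Proof.
move=> ul lR nl; rewrite -cR -(card_uniqP ul) /out_rest.
rewrite -cardUI [X in (_ + X)%N](_ : _ = 0%N) ?addn0.
  apply/subset_leq_card/subsetP=> z.
  by rewrite !inE => /orP[/andP[]//|/lR]; rewrite inE.
apply: eq_card0 => z; rewrite !inE; apply/negP=> /andP[/andP[ez _] /nl].
by rewrite ez.
Qed.

(** The detour has length m.+3 - t + size l; the two inequalities on [size l] place it strictly
    between m.+2 and p. *)
Lemma rest_walk_avoid a b l i t : rest_walk a b l -> (0 < t <= m.+2)%N ->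
    (t <= size l)%N -> (size l + 1 < t + k)%N ->
  e (x i) a -> ~~ e b (x (i + t%:R)).
Proof.
move=> [wl ul lR] tM tl lt_k exa; apply/negP=> ebx.
apply: (maxc (L := (m.+3 - t + size l)%N)).
  by rewrite cV; move: tM tl lt_k; clear; lia.
by apply: (detour cx tM wl ul _ exa ebx) => v /lR; rewrite inE.
Qed.

Lemma insert_card v : v \in rest x -> (#|inC e x v| + #|outC e x v| <= m.+2)%N.
Proof.
move=> rv; have w1 : rest_walk v v [:: v].
  by split; rewrite ?walk1 // => z; rewrite inE => /eqP->.
have dis : outC e x v :&: shift_set 1 (inC e x v) = set0.
  apply/setP=> i; rewrite in_setI in_set0 in_outC in_shift_set in_inC.
  apply/negP=> /andP[+ eia]; apply/negP.
  have := rest_walk_avoid (t := 1%N) w1 isT isT _ eia; rewrite subrK; apply.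
  by move: k3 => /=; clear; lia.
have := max_card (mem (outC e x v :|: shift_set 1 (inC e x v))).
by rewrite cardsU dis cards0 card_shift_set card_ord; rlia.
Qed.

Lemma short_walk_card a b l : rest_walk a b l -> (size l < k)%N ->
    inC e x a != set0 -> outC e x b != set0 ->
  (#|inC e x a| + #|outC e x b| + size l <= m.+3)%N.
Proof.
move=> wl lk Sa Tb; apply: misses_card => //.
  by case: wl => /walk_head; case: (l).
move=> i t; rewrite in_inC in_outC => Si tl.
apply: (rest_walk_avoid wl) => //; move: tl lk k_le sM; clear; lia.
Qed.

(** Only the shifts 2,...,k are excluded. Moving the in-neighbours forward by one turns them into
    1,...,k-1, and the bound is weaker by one than in [two_walks_card]. *)
Lemma ham_walk_card a b l : rest_walk a b l -> size l = k ->
    inC e x a != set0 -> outC e x b != set0 ->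
  (#|inC e x a| + #|outC e x b| + k <= m.+4)%N.
Proof.
move=> wl lk Sa Tb.
have Sa' : shift_set 1 (inC e x a) != set0.
  by rewrite -card_gt0 card_shift_set card_gt0.
have := @misses_card _ k.-1 (shift_set 1 (inC e x a)) (outC e x b) _ Sa' Tb.
rewrite card_shift_set => h; have {}h : (#|inC e x a| + #|outC e x b| + k.-1 <= m.+3)%N.
  apply: h; first by move: k3; clear; lia.
  move=> i t; rewrite in_shift_set in_inC in_outC => Si tl.
  have := rest_walk_avoid (t := t.+1) wl _ _ _ Si.
  rewrite lk -[t.+1%:R]natr1 (_ : i - 1%:R + (t%:R + 1) = i + t%:R); last by ring.
  by apply; move: tl k_le sM; clear; lia.
by move: h k3; rlia.
Qed.

(** The shorter walk excludes shift 1 and the longer one the shifts 2,...,k. *)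
Lemma two_walks_miss a b l l' : rest_walk a b l -> size l = k ->
    rest_walk a b l' -> size l' = k.-1 ->
  misses k (inC e x a) (outC e x b).
Proof.
move=> wl lk wl' lk' i t; rewrite in_inC in_outC => Si tk.
have [t1|t1] := leqP t 1.
  apply: (rest_walk_avoid wl') => //; rewrite ?lk';
  by move: tk t1 k3 k_le sM; clear; lia.
apply: (rest_walk_avoid wl) => //; rewrite ?lk;
by move: tk t1 k3 k_le sM; clear; lia.
Qed.

Lemma two_walks_card a b l l' : rest_walk a b l -> size l = k ->
    rest_walk a b l' -> size l' = k.-1 ->
    inC e x a != set0 -> outC e x b != set0 ->
  (#|inC e x a| + #|outC e x b| + k <= m.+3)%N.
Proof.
move=> wl lk wl' lk' Sa Tb; apply: misses_card => //.
  by move: k3; clear; lia.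
exact: (two_walks_miss wl lk wl' lk').
Qed.

Lemma ham_walk_mem a b l : rest_walk a b l -> size l = k -> l =i rest x.
Proof.
move=> [_ ul lR] lk z; apply/idP/idP=> [/lR //|Rz].
have : (#|l| = #|rest x|)%N by rewrite (card_uniqP ul) lk cR.
by move/subset_cardP => /(_ _)/(_ z) ->//; apply/subsetP.
Qed.

(* A walk of maximal length missing a vertex would close up to a cycle, and a
   neighbour of the missing vertex on it would extend it. *)
Lemma ham_walk : exists a b l, rest_walk a b l /\ size l = k.
Proof.
have /card_gt0P[v0 Rv0] : (0 < #|rest x|)%N by rewrite cR; move: k3; clear; lia.
have [a [b [l [wab ul lR maxl']]]] := longest_walk e Rv0.
have wl : rest_walk a b l by split.
have maxl a' b' l' : rest_walk a' b' l' -> (size l' <= size l)%N.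
  by case; apply: maxl'.
exists a, b, l; split=> //.
have lk : (size l <= k)%N.
  by rewrite -cR -(card_uniqP ul); apply/subset_leq_card/subsetP.
apply/eqP; rewrite eqn_leq lk leqNgt; apply/negP=> {}lk.
have [la lb] := (walk_head wab, walk_last wab).
have memin z : z \in rest x -> e z a -> z \in l.
  move=> Rz ez; apply: contraT => zl.
  have /maxl : rest_walk z b (z :: l).
    split; [exact: (walk_cons ez wab) | by rewrite /= zl |].
    by move=> v; rewrite inE => /orP[/eqP->|/lR].
  by rewrite /= ltnn.
have memout z : z \in rest x -> e b z -> z \in l.
  move=> Rz ez; apply: contraT => zl.
  have /maxl : rest_walk a z (rcons l z).
    split; [exact: (walk_rcons wab ez) | by rewrite rcons_uniq zl |].
    by move=> v; rewrite mem_rcons inE => /orP[/eqP->|/lR].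
  by rewrite size_rcons ltnn.
have subin : ins e a :&: rest x \subset [set v in l] :\ a.
  apply/subsetP=> z; rewrite in_setI => /andP[]; rewrite !inE => ez Rz.
  by rewrite memin ?inE // andbT; apply: contraTneq ez => ->; rewrite irr.
have subout : outs e b :&: rest x \subset [set v in l] :\ b.
  apply/subsetP=> z; rewrite in_setI => /andP[]; rewrite !inE => ez Rz.
  by rewrite memout ?inE // andbT; apply: contraTneq ez => ->; rewrite irr.
have cl z : z \in l -> #|[set v in l] :\ z|.+1 = size l.
  move=> zl; have := cardsD1 z [set v in l].
  by rewrite inE zl cardsE (card_uniqP ul).
have ia : (in_rest a < size l)%N by rewrite -(cl a) // ltnS subset_leq_card.
have ob : (out_rest b < size l)%N by rewrite -(cl b) // ltnS subset_leq_card.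
have [Sa Tb] : inC e x a != set0 /\ outC e x b != set0.
  have := in_rest_semi a; have := out_rest_semi b.
  by rewrite -!card_gt0; move: k_le; split; rlia.
have cab := short_walk_card wl lk Sa Tb.
(* The semidegrees of a and b against [cab] give size l >= k-1. Nothing is then left over, so every
   other vertex of l dominates a, in particular b. *)
have lk1 : size l = k.-1.
  have := in_rest_semi a; have := out_rest_semi b; have := long_bounds.
  by move: cab ia ob lk; rlia.
have iaE : ins e a :&: rest x = [set v in l] :\ a.
  apply/eqP; rewrite eqEcard subin -ltnS cl //.
  have := in_rest_semi a; have := out_rest_semi b; have := long_bounds.
  by move: cab ia ob lk; rewrite /in_rest; rlia.
have ab : b != a.
  apply: contraTneq wab => eb; apply/negP=> /walkP[q [el pq lq]].
  move: lk1 ul; rewrite el /=; case: q pq lq el => [|y q] pq lq el.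
    by move: k3 => /=; clear; lia.
  by move=> _ /andP[/negP[]]; rewrite -[X in X \in _]eb -lq /= mem_last.
have eba : e b a.
  have : b \in ins e a :&: rest x by rewrite iaE !inE ab.
  by rewrite !inE => /andP[].
have cyl := walk_cycle wab eba.
have [w Rw wl'] : exists2 w, w \in rest x & w \notin l.
  have : (0 < #|rest x :\: [set v in l]|)%N.
    have := cardsID [set v in l] (rest x); rewrite cR.
    have : (#|rest x :&: [set v in l]| <= size l)%N.
      rewrite -(card_uniqP ul); apply/subset_leq_card/subsetP=> v.
      by rewrite in_setI => /andP[_]; rewrite inE.
    by move: lk; clear; lia.
  by case/card_gt0P=> w; rewrite !inE => /andP[wl' Rw]; exists w; rewrite ?inE.
have rest_l z : z \in rest x -> z != w -> z \in l.
  move=> Rz zw; apply: contraT => zl.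
  have : (#|[set v in w :: z :: l]| <= k)%N.
    rewrite -cR; apply/subset_leq_card/subsetP=> v; rewrite inE !in_cons.
    by case/or3P=> [/eqP->|/eqP->|/lR].
  rewrite cardsE; have /card_uniqP-> : uniq [:: w, z & l].
    by rewrite /= !inE negb_or eq_sym zw wl' zl.
  by rewrite /= lk1; move: k3; clear; lia.
(* At most m.+2 arcs join w to the cycle, fewer than its degree. *)
have [z lz adj] : exists2 z, z \in l & e w z || e z w.
  have : (0 < in_rest w + out_rest w)%N.
    by move: (insert_card Rw) (rest_total w) k3; clear; lia.
  rewrite addn_gt0 => /orP[]/card_gt0P[z]; rewrite in_setI => /andP[];
  rewrite inE => ez Rz; exists z; rewrite ?ez ?orbT //; apply: rest_l => //;
  by apply: contraTneq ez => ->; rewrite irr.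
have [i q erot] := rot_to lz.
have cyq : cycle e (z :: q) by rewrite -erot rot_cycle.
have uq : uniq (z :: q) by rewrite -erot rot_uniq.
have mq v : (v \in z :: q) = (v \in l) by rewrite -erot mem_rot.
have sq : size (z :: q) = size l by rewrite -erot size_rot.
case/orP: adj => ez.
  have /maxl : rest_walk w (last z q) [:: w, z & q].
    split; last 1 first.
    - move=> v; rewrite inE => /orP[/eqP->//|]; rewrite mq; exact: lR.
    - apply: (walk_cons ez); apply/walkP; exists q; split=> //.
      by move: cyq; rewrite /= rcons_path => /andP[].
    - by rewrite cons_uniq mq wl'.
  by rewrite -[size _]/(size (z :: q)).+1 sq ltnn.
case: q {erot} cyq uq mq sq => [|y q] cyq uq mq sq.
  by move: sq lk1 k3 => /=; clear; lia.
have /maxl : rest_walk y w (rcons (rcons (y :: q) z) w).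
  split; last 1 first.
  - move=> v; rewrite mem_rcons inE => /orP[/eqP->//|].
    by rewrite mem_rcons mq; apply: lR.
  - apply: (fun h => walk_rcons h ez); apply: (@walk_rcons _ _ _ (last y q)).
      by apply/walkP; exists q; split=> //; move: cyq; rewrite /= rcons_path => /and3P[].
    by move: cyq; rewrite /= rcons_path => /and3P[].
  - by rewrite rcons_uniq mem_rcons mq wl' rcons_uniq.
rewrite !size_rcons -[size (y :: q)]/(size (z :: y :: q)).-1 sq /=.
by move: lk1 k3; clear; lia.
Qed.

Section Hamiltonian.
Variables (n : nat) (y : 'I_n.+2 -> V).
Hypotheses (cy : cycle_fun e y) (ry : codom y =i rest x).

Let nk : n.+2 = k.
Proof.
have [injy _] := cy.
by rewrite -cR -[LHS]card_ord -(card_codom injy); apply: eq_card.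
Qed.

Let Ry i : y i \in rest x. Proof. by rewrite -ry codom_f. Qed.

Lemma around i : exists2 l, rest_walk (y (i + 1)) (y i) l & size l = k.
Proof.
have [l [wl ul sl ly]] := walk_around i cy.
exists l; last by rewrite sl nk.
by split=> // v /ly; rewrite ry.
Qed.

Lemma around_skip i j : j != i -> j != i + 1 -> e (y (j - 1)) (y (j + 1)) ->
  exists2 l, rest_walk (y (i + 1)) (y i) l & size l = k.-1.
Proof.
move=> ji ji1 ej; have [l [wl ul sl ly]] := walk_skip cy ji ji1 ej.
exists l; last by rewrite sl -nk.
by split=> // v /ly; rewrite ry.
Qed.

(** The in-degree of y_i comes from the outside alone, so k = s+1 and all other outside vertices
    dominate y_i. The chord y_(i-2) -> y_i gives the shorter walk from y_(i+1) to y_i, and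
    [two_walks_card] then leaves no room for an in-neighbour of y_(i+1). *)
Lemma empty_in_step i : inC e x (y i) = set0 -> inC e x (y (i + 1)) = set0.
Proof.
move=> S0; apply/eqP; apply: contraT => Sne.
have irest : (in_rest (y i) + 1 <= k)%N.
  apply: (@in_rest_le _ [:: y i]) => // z; rewrite inE => /eqP-> //.
  by rewrite irr.
have orest : (out_rest (y i) + 1 <= k)%N.
  apply: (@out_rest_le _ [:: y i]) => // z; rewrite inE => /eqP-> //.
  by rewrite irr.
have h1 := in_rest_semi (y i); have h2 := rest_total (y i).
rewrite S0 cards0 in h1 h2.
have Tne : outC e x (y i) != set0.
  rewrite -card_gt0; move: k_le sM k3 h1 h2 irest orest; clear; lia.
have [l wl sl] := around i.
have c1 := ham_walk_card wl sl Sne Tne.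
have [l' wl' sl'] : exists2 l', rest_walk (y (i + 1)) (y i) l' & size l' = k.-1.
  apply: (@around_skip i (i - 1)).
  - by rewrite eq_sym; apply: (@shift_neq _ 1) => //; ring.
  - by rewrite eq_sym; apply: (@shift_neq _ 2); [rewrite nk | ring].
  rewrite subrK; apply: contraT => nskip; exfalso.
  have : (in_rest (y i) + 2 <= k)%N.
    apply: (@in_rest_le _ [:: y i; y (i - 1 - 1)]).
    - case: cy => injy _; rewrite /= inE (inj_eq injy) andbT.
      by apply: (@shift_neq _ 2); [rewrite nk | ring].
    - by move=> z; rewrite !in_cons => /or3P[/eqP->|/eqP->|].
    - by move=> z; rewrite !in_cons => /or3P[/eqP->|/eqP->|//]; rewrite ?irr.
  move: Sne; rewrite -card_gt0; move: sM k3 h1 h2 orest c1 long_bounds; clear; rlia.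
have := two_walks_card wl sl wl' sl' Sne Tne.
have [S1 T1] : (0 < #|inC e x (y (i + 1)%R)|)%N /\ (0 < #|outC e x (y i)|)%N.
  by rewrite !card_gt0.
move: S1 T1 k_le sM long_bounds h1 irest.
move: #|inC e x (y (i + 1)%R)| #|outC e x (y i)| (in_rest (y i)).
by clear; lia.
Qed.

Lemma empty_in i : inC e x (y i) = set0 -> {in rest x, forall v, inC e x v = set0}.
Proof.
move=> S0 v; rewrite -ry => /codomP[j ->]; apply/eqP; move: j.
apply: (@cyclic_ind _ (fun j => inC e x (y j) == set0) i); first by rewrite S0.
by move=> j /eqP/empty_in_step->.
Qed.

Hypothesis ne : forall i, inC e x (y i) != set0 /\ outC e x (y i) != set0.

Let skip j := e (y (j - 1)) (y (j + 1)).
(** No chord over a single vertex shortens the Hamiltonian walk from y_(i+1) to y_i. *)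
Let bad i := [forall j : 'I_n.+2, skip j ==> ((j == i) || (j == i + 1))].

(** A bad index leaves at most two vertices that can be skipped, and each of these leaves at most
    two bad indices. For k >= 3 the inequality then forces two skippable vertices, each the
    predecessor of the other, which is impossible. *)
Lemma few_bad :
    (#|[set j : 'I_n.+2 | ~~ skip j]|.*2 <= #|[set i : 'I_n.+2 | bad i]|)%N ->
  #|[set i : 'I_n.+2 | bad i]| = 0%N.
Proof.
set G := [set j | _]; set B := [set i | _] => GB.
have cB : (#|B| <= k)%N.
  by rewrite -nk -[X in (_ <= X)%N]card_ord; apply: max_card.
apply/eqP; rewrite -leqn0 leqNgt; apply/negP=> B0.
have cG : (#|~: G| + #|G| = k)%N by rewrite addnC cardsC card_ord nk.
have badP i j : i \in B -> j \in ~: G -> (j == i) || (j == i + 1).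
  by rewrite !inE negbK => /forallP/(_ j)/implyP.
have subB j : j \in ~: G -> B \subset [set j - 1; j].
  move=> Gj; apply/subsetP=> i /badP/(_ Gj); rewrite !inE.
  by case/orP=> /eqP ->; rewrite ?eqxx ?orbT // addrK eqxx.
have c2 (i j : 'I_n.+2) : (#|[set i; j]| <= 2)%N by rewrite cards2; case: eqP.
have /card_gt0P[i Bi] := B0.
have [j Gj] : exists j, j \in ~: G.
  apply/card_gt0P; move: B0 GB cG cB k3; clear; lia.
have cB2 := leq_trans (subset_leq_card (subB j Gj)) (c2 _ _).
have [j' G'] : exists j', j' \in ~: G :\ j.
  apply/card_gt0P; have := cardsD1 j (~: G); rewrite Gj.
  by move: cB2 GB cG k3; clear; lia.
have [j'j Gj'] : j' != j /\ j' \in ~: G.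
  by move: G'; rewrite in_setD1 => /andP[].
have cGle : (#|~: G| <= 2)%N.
  apply: leq_trans (c2 i (i + 1)); apply/subset_leq_card/subsetP=> h Gh.
  by rewrite !inE; apply: badP.
have B2 : #|B| = 2%N by move: cGle cG GB cB2 k3; clear; lia.
have defB g : g \in ~: G -> B = [set g - 1; g].
  by move=> Gg; apply/eqP; rewrite eqEcard subB //= B2.
have : j \in B by rewrite (defB j Gj) !inE eqxx orbT.
rewrite (defB j' Gj') !inE [X in _ || X]eq_sym (negbTE j'j) orbF => /eqP ej.
have : j' \in B by rewrite (defB j' Gj') !inE eqxx orbT.
rewrite (defB j Gj) !inE (negbTE j'j) orbF => /eqP ej'.
have : j - 2%:R != j.
  by rewrite eq_sym; apply: (@shift_neq _ 2); [rewrite nk | ring].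
by case/eqP; rewrite {2}ej ej'; ring.
Qed.

(** Double counting: summed around the cycle y, the degree bounds and the bounds for the pairs
    (y_(i+1), y_i) show that the missing arcs, counted at both ends, are at most as many as the bad
    indices. Each missing chord over one vertex is counted twice, so [few_bad] applies and no arc is
    missing. *)
Lemma rest_complete : complete_on e (rest x).
Proof.
have [injy ey] := cy.
have neq (c : nat) (i j : 'I_n.+2) : (0 < c < 3)%N -> i - j = c%:R -> i != j.
  by move=> c3; apply: shift_neq; rewrite nk; move: c3 k3; clear; lia.
have le1 (i : 'I_n.+2) : (in_rest (y i) + ~~ skip (i - 1)%R < k)%N.
  case sk: (skip _); [suff : (in_rest (y i) + 1 <= k)%N by clear; lia |
    suff : (in_rest (y i) + 2 <= k)%N by clear; lia].
    apply: (@in_rest_le _ [:: y i]) => // z; rewrite inE => /eqP->; rewrite ?irr //.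
  apply: (@in_rest_le _ [:: y i; y (i - 1 - 1)]).
  - by rewrite /= inE (inj_eq injy) andbT; apply: (@neq 2) => //; ring.
  - by move=> z; rewrite !in_cons => /or3P[/eqP->|/eqP->|].
  - move=> z; rewrite !in_cons => /or3P[/eqP->|/eqP->|//]; rewrite ?irr //.
    by move: sk; rewrite /skip subrK => ->.
have le2 (i : 'I_n.+2) : (out_rest (y i) + ~~ skip (i + 1)%R < k)%N.
  case sk: (skip _); [suff : (out_rest (y i) + 1 <= k)%N by clear; lia |
    suff : (out_rest (y i) + 2 <= k)%N by clear; lia].
    apply: (@out_rest_le _ [:: y i]) => // z; rewrite inE => /eqP->; rewrite ?irr //.
  apply: (@out_rest_le _ [:: y i; y (i + 1 + 1)]).
  - rewrite /= inE (inj_eq injy) andbT eq_sym.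
    by apply: (@neq 2) => //; ring.
  - by move=> z; rewrite !in_cons => /or3P[/eqP->|/eqP->|].
  - move=> z; rewrite !in_cons => /or3P[/eqP->|/eqP->|//]; rewrite ?irr //.
    by move: sk; rewrite /skip addrK => ->.
(* [miss i] counts the missing arcs between y_i and the other outside vertices. *)
have [miss [missT missS miss0]] : exists miss : 'I_n.+2 -> nat,
   [/\ forall i, (m.+3 + miss i <= #|inC e x (y i)| + #|outC e x (y i)| + k)%N,
       forall i, (~~ skip (i + 1)%R + ~~ skip (i - 1)%R <= miss i)%N
     & forall i, miss i = 0%N -> (k <= in_rest (y i) + 1)%N].
  exists (fun i => k.-1 - in_rest (y i) + (k.-1 - out_rest (y i)))%N.
  split=> i; move: (rest_total (y i)) (le1 i) (le2 i) k3.
  - move: #|inC e x (y i)| #|outC e x (y i)| (in_rest _) (out_rest _).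
    by case: (skip _); case: (skip _); clear; lia.
  - move: (in_rest _) (out_rest _).
    by case: (skip _); case: (skip _); clear; lia.
  - by move: (in_rest _) (out_rest _); clear; lia.
have cpair i : (#|inC e x (y (i + 1)%R)| + #|outC e x (y i)| + k <= m.+3 + bad i)%N.
  have [l wl sl] := around i; have [Sne _] := ne (i + 1); have [_ Tne] := ne i.
  case bi: (bad i); first by rewrite addn1; apply: ham_walk_card wl sl Sne Tne.
  move/negbT: bi => /forallPn[j]; rewrite negb_imply negb_or.
  move=> /and3P[skj ji ji1]; have [l' wl' sl'] := around_skip ji ji1 skj.
  by rewrite addn0; apply: two_walks_card wl sl wl' sl' Sne Tne.
have csum : (\sum_i miss i <= #|[set i : 'I_n.+2 | bad i]|)%N.
  have h1 : (\sum_i (#|inC e x (y (i + 1)%R)| + #|outC e x (y i)| + k) <=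
             \sum_(i : 'I_n.+2) (m.+3 + bad i))%N by apply: leq_sum.
  have h2 : (\sum_(i : 'I_n.+2) (m.+3 + miss i) <=
      \sum_i (#|inC e x (y i)| + #|outC e x (y i)| + k))%N.
    by apply: leq_sum => i _; apply: missT.
  have e1 : (\sum_i #|inC e x (y (i + 1)%R)| = \sum_i #|inC e x (y i)|)%N.
    by rewrite [RHS](reindex_inj (addIr (1 : 'I_n.+2))).
  have e2 : (\sum_(i : 'I_n.+2) bad i = #|[set i : 'I_n.+2 | bad i]|)%N.
    by rewrite -sum1dep_card [RHS]big_mkcond; apply: eq_bigr => i _; case: (bad i).
  move: h1 h2; rewrite !big_split /= e1 e2.
  move: (\sum_i #|inC e x (y i)|)%N (\sum_i #|outC e x (y i)|)%N
    (\sum_(i : 'I_n.+2) k)%N (\sum_(i : 'I_n.+2) m.+3)%N (\sum_i miss i)%N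
    #|[set i : 'I_n.+2 | bad i]|.
  by clear; lia.
have cmiss : (#|[set j : 'I_n.+2 | ~~ skip j]|.*2 <= \sum_i miss i)%N.
  have e2 : (#|[set j : 'I_n.+2 | ~~ skip j]| = \sum_(j : 'I_n.+2) ~~ skip j)%N.
    by rewrite -sum1dep_card big_mkcond; apply: eq_bigr => i _; case: (skip i).
  have e3 : (\sum_(j : 'I_n.+2) ~~ skip j = \sum_(j : 'I_n.+2) ~~ skip (j + 1)%R)%N.
    by rewrite [LHS](reindex_inj (addIr (1 : 'I_n.+2))).
  have e4 : (\sum_(j : 'I_n.+2) ~~ skip j = \sum_(j : 'I_n.+2) ~~ skip (j - 1)%R)%N.
    by rewrite [LHS](reindex_inj (addIr (-1 : 'I_n.+2))).
  rewrite -addnn e2 {1}e3 e4 -big_split /=; apply: leq_sum => i _.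
  exact: missS.
have nbad := few_bad (leq_trans cmiss csum).
move=> v w; rewrite -!ry => /codomP[i ->] /codomP[j ->] ij.
apply: contraT => nij; move: csum; rewrite nbad leqn0 sum_nat_eq0.
move=> /forallP/(_ j); rewrite implyTb => /eqP/miss0.
have : (in_rest (y j) + 2 <= k)%N.
  apply: (@in_rest_le _ [:: y j; y i]).
  - by rewrite /= inE eq_sym ij.
  - by move=> z; rewrite !in_cons => /or3P[/eqP->|/eqP->|].
  - by move=> z; rewrite !in_cons => /or3P[/eqP->|/eqP->|//]; rewrite ?irr.
by clear; lia.
Qed.

End Hamiltonian.

Lemma ham_walk_neq a b l : rest_walk a b l -> size l = k -> b != a.
Proof.
move=> [/walkP[q [el pq lq]] ul _] lk; apply/eqP => eb.
move: lk ul; rewrite el /=; case: q lq {el pq} => [|z q] lq.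
  by move: k3 => /=; clear; lia.
by move=> _ /andP[/negP[]]; rewrite -eb -lq /= mem_last.
Qed.

Lemma ham_cycle a b l : rest_walk a b l -> size l = k -> e b a ->
  exists n (y : 'I_n.+2 -> V), cycle_fun e y /\ codom y =i rest x.
Proof.
move=> wl lk eba; have lR := ham_walk_mem wl lk; have [wab ul _] := wl.
have sl : size l = (k - 2).+2 by rewrite lk; move: k3; clear; lia.
have [|y cy ey] := fun_of_ucycle sl (e := e).
  by apply/andP; rewrite (walk_cycle wab).
by exists (k - 2)%N, y; split=> // v; rewrite ey lR.
Qed.

Lemma empty_in_all a b l : rest_walk a b l -> size l = k ->
  inC e x a = set0 -> {in rest x, forall v, inC e x v = set0}.
Proof.
move=> wl lk S0; have [wab ul lR] := wl; have ba := ham_walk_neq wl lk.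
have [la lb] := (walk_head wab, walk_last wab).
have eba : e b a.
  apply: contraT => nba; have : (in_rest a + 2 <= k)%N.
    apply: (@in_rest_le _ [:: a; b]).
    - by rewrite /= inE eq_sym ba.
    - by move=> z; rewrite !in_cons => /or3P[/eqP->|/eqP->|//]; apply: lR.
    - by move=> z; rewrite !in_cons => /or3P[/eqP->|/eqP->|//]; rewrite ?irr.
  by have := in_rest_semi a; rewrite S0 cards0; move: k_le; clear; lia.
have [n [y [cy ey]]] := ham_cycle wl lk eba.
have /codomP[i ei] : a \in codom y by rewrite ey lR.
by apply: (empty_in cy ey (i := i)); rewrite -ei.
Qed.

Hypothesis ne : forall a b l, rest_walk a b l -> size l = k ->
  inC e x a != set0 /\ outC e x b != set0.

(** If b does not dominate a, the bounds for a and b are all tight. Rerouting the walk through y2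
    gives a second Hamiltonian walk that does not close, and its bounds contradict the degree of
    a. *)
Lemma ham_walk_closed a b l : rest_walk a b l -> size l = k -> e b a.
Proof.
move=> wl lk; have [wab ul lR] := wl; have ba := ham_walk_neq wl lk.
have [la lb] := (walk_head wab, walk_last wab).
have [Sa Tb] := ne wl lk; apply: contraT => nba.
have ia : (in_rest a + 2 <= k)%N.
  apply: (@in_rest_le _ [:: a; b]).
  - by rewrite /= inE eq_sym ba.
  - by move=> z; rewrite !in_cons => /or3P[/eqP->|/eqP->|//]; apply: lR.
  - by move=> z; rewrite !in_cons => /or3P[/eqP->|/eqP->|//]; rewrite ?irr.
have ob : (out_rest b + 2 <= k)%N.
  apply: (@out_rest_le _ [:: a; b]).
  - by rewrite /= inE eq_sym ba.
  - by move=> z; rewrite !in_cons => /or3P[/eqP->|/eqP->|//]; apply: lR.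
  - by move=> z; rewrite !in_cons => /or3P[/eqP->|/eqP->|//]; rewrite ?irr.
have cab := ham_walk_card wl lk Sa Tb.
have ia1 := in_rest_semi a; have ob1 := out_rest_semi b.
have /walkP[[|y2 [|y3 q]] [el pq lq]] := wab;
  try by move: lk k3; rewrite el /=; clear; lia.
have lsub v : v \in l -> v \in rest x by apply: lR.
have [l2 l3] : y2 \in l /\ y3 \in l by rewrite el !inE !eqxx !orbT.
have uq : uniq [:: a, y2, y3 & q] by rewrite -el.
have [a2 a3 y23] : [/\ a != y2, a != y3 & y2 != y3].
  by move: uq; rewrite /= !inE !negb_or => /and3P[/and3P[-> -> _] /andP[-> _] _].
have y2b : y2 != b.
  have : y2 \notin y3 :: q by have /and3P[] := uq.
  by apply: contraNneq => ->; rewrite -lq /= mem_last.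
have /and3P[ea2 e23 pq3] := pq.
(* This chord would give a walk on k-1 vertices with the same ends, hence the bound that is stronger
   by one. *)
have nskip : ~~ e a y3.
  apply/negP=> ea3; have wl' : rest_walk a b [:: a, y3 & q].
    split.
    - by apply/walkP; exists (y3 :: q); split=> //=; rewrite ea3.
    - by move: uq; rewrite /= !inE !negb_or => /and3P[/and3P[_ -> ->] _ ->].
    - move=> v; rewrite in_cons => /orP[/eqP->|vq]; apply: lR => //.
      by rewrite el !in_cons; move: vq; rewrite in_cons => ->; rewrite !orbT.
  have sl' : size [:: a, y3 & q] = k.-1 by rewrite -lk el.
  have := two_walks_card wl lk wl' sl' Sa Tb.
  move: ia ob ia1 ob1 long_bounds; move: (in_rest a) (out_rest b).
  by move: #|inC e x a| #|outC e x b|; clear; lia.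
have e2a : e y2 a.
  apply: contraT => n2a; have : (in_rest a + 3 <= k)%N.
    apply: (@in_rest_le _ [:: a; b; y2]).
    - by rewrite /= !inE negb_or eq_sym ba a2 eq_sym y2b.
    - move=> z; rewrite !in_cons => /or4P[/eqP->|/eqP->|/eqP->|//];
      exact: lR.
    - move=> z; rewrite !in_cons => /or4P[/eqP->|/eqP->|/eqP->|//];
      by rewrite ?irr.
  move: cab ob ia1 ob1 long_bounds; move: (in_rest a) (out_rest b).
  by move: #|inC e x a| #|outC e x b|; clear; lia.
have eb2 : e b y2.
  apply: contraT => n2a; have : (out_rest b + 3 <= k)%N.
    apply: (@out_rest_le _ [:: a; b; y2]).
    - by rewrite /= !inE negb_or eq_sym ba a2 eq_sym y2b.
    - move=> z; rewrite !in_cons => /or4P[/eqP->|/eqP->|/eqP->|//];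
      exact: lR.
    - move=> z; rewrite !in_cons => /or4P[/eqP->|/eqP->|/eqP->|//];
      by rewrite ?irr.
  move: cab ia ia1 ob1 long_bounds; move: (in_rest a) (out_rest b).
  by move: #|inC e x a| #|outC e x b|; clear; lia.
have wl' : rest_walk y3 a ((y3 :: q) ++ [:: y2; a]).
  split.
  - apply: (walk_cat (z := b) _ eb2).
      by apply/walkP; exists q.
    by rewrite /= e2a !eqxx.
  - rewrite -(perm_uniq (_ : perm_eq l _)) //.
    by apply/permP=> p; rewrite el count_cat /=; clear; lia.
  - move=> v; rewrite mem_cat => vl; apply: lR; rewrite el !in_cons.
    by move: vl; rewrite !in_cons in_nil orbF => /orP[/orP[]|/orP[]] ->; rewrite ?orbT.
have sl' : size ((y3 :: q) ++ [:: y2; a]) = k.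
  by rewrite -lk el size_cat /=; clear; lia.
have [S3 Ta] := ne wl' sl'.
have c3 := ham_walk_card wl' sl' S3 Ta.
have i3 : (in_rest y3 + 2 <= k)%N.
  apply: (@in_rest_le _ [:: a; y3]).
  - by rewrite /= inE a3.
  - by move=> z; rewrite !in_cons => /or3P[/eqP->|/eqP->|//]; apply: lR.
  - by move=> z; rewrite !in_cons => /or3P[/eqP->|/eqP->|//]; rewrite ?irr.
have oa : (out_rest a + 2 <= k)%N.
  apply: (@out_rest_le _ [:: a; y3]).
  - by rewrite /= inE a3.
  - by move=> z; rewrite !in_cons => /or3P[/eqP->|/eqP->|//]; apply: lR.
  - by move=> z; rewrite !in_cons => /or3P[/eqP->|/eqP->|//]; rewrite ?irr.
have s3 := in_rest_semi y3; have ta := rest_total a.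
move: cab ia ob ia1 ob1 c3 i3 oa s3 ta long_bounds.
move: (in_rest a) (out_rest b) (in_rest y3) (out_rest a).
move: #|inC e x a| #|outC e x b| #|inC e x y3| #|outC e x a|.
by clear; lia.
Qed.

Lemma complete_path (B : {set V}) y z n : complete_on e B ->
    y \in B -> z \in B -> y != z -> (1 < n <= #|B|)%N ->
  exists l, [/\ walk e y z l, uniq l, size l = n & {subset l <= B}].
Proof.
move=> cB By Bz yz /andP[n1 nB].
pose t := take (n - 2) (enum (B :\ y :\ z)).
have st : size t = (n - 2)%N.
  rewrite size_takel // -cardE.
  have := cardsD1 y B; have := cardsD1 z (B :\ y).
  by rewrite By !inE eq_sym yz Bz; move: nB; clear; lia.
have tB v : v \in t -> [&& v != z, v != y & v \in B].
  by move=> /mem_take; rewrite mem_enum !inE.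
have ut : uniq (y :: rcons t z).
  rewrite cons_uniq rcons_uniq take_uniq ?enum_uniq // mem_rcons in_cons.
  rewrite negb_or yz andbT; apply/andP; split.
    by apply/negP=> /tB; rewrite eqxx andbF.
  by apply/negP=> /tB; rewrite eqxx.
have sB : {subset y :: rcons t z <= B}.
  move=> v; rewrite in_cons mem_rcons in_cons.
  by case/or3P=> [/eqP->//|/eqP->//|/tB/and3P[]].
exists (y :: rcons t z); split=> //.
  by have := complete_walk cB sB ut; rewrite last_rcons.
by rewrite /= size_rcons st; move: n1; clear; lia.
Qed.

Lemma long_rigid : rigid e k x.
Proof.
have [a [b [l [wl lk]]]] := ham_walk.
have [n [y [cy ey]]] := ham_cycle wl lk (ham_walk_closed wl lk).
have ney i : inC e x (y i) != set0 /\ outC e x (y i) != set0.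
  have [l1 w1 s1] := around cy ey i; have [_ ->] := ne w1 s1.
  have [l2 w2 s2] := around cy ey (i - 1); rewrite subrK in w2.
  by have [-> _] := ne w2 s2.
have cR' := rest_complete cy ey ney.
split=> //.
- by move=> v; rewrite -ey => /codomP[i ->]; apply: ney.
- move=> v w Rv Rw vw.
  have [|l1 [w1 u1 s1 r1]] := @complete_path _ v w k cR' Rv Rw vw.
    by rewrite cR leqnn; move: k3; clear; lia.
  have [|l2 [w2 u2 s2 r2]] := @complete_path _ v w k.-1 cR' Rv Rw vw.
    by rewrite cR; move: k3; clear; lia.
  by apply: (@two_walks_miss _ _ l1 l2).
- move=> v Rv i t; rewrite in_inC in_outC => Si t1.
  apply: (@rest_walk_avoid v v [:: v]) => //; last 2 first.
  - by move: t1; clear => /=; lia.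
  - by move: t1 k3; clear => /=; lia.
  - split; rewrite ?walk1 //.
    by move=> z; rewrite inE => /eqP->.
  - by move: t1; clear; lia.
Qed.

End Long.

Section LongConclusion.
Variables (V : finType) (e : rel V) (s m k : nat).
Hypotheses (De : dense e s) (cV : #|V| = (k + m.+2)%N) (k3 : (2 < k)%N).
Hypothesis sM : (s < m.+2)%N.
Hypothesis maxc : forall L, (m.+2 < L < #|V|)%N -> ~ cyc e L.
Variable x : 'I_m.+2 -> V.
Hypothesis cx : cycle_fun e x.

Lemma rest_opp : rest (fun i => x (- i)) = rest x.
Proof. by apply/setP=> v; rewrite !inE codom_opp. Qed.

Lemma walk_rev a b l : walk e a b l -> walk (conv e) b a (rev l).
Proof.
elim: l a => // c l IH a /walkP[q [[-> el] pq lq]].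
case: q el pq lq => [|d q] el; first by rewrite el /= => _ ->; rewrite !eqxx.
rewrite /= => /andP[ead pq] lq; rewrite rev_cons.
apply: (@walk_rcons _ _ _ d); last exact: ead.
by apply: IH; rewrite el; apply/walkP; exists q.
Qed.

Lemma long_cases :
  [\/ {in rest x, forall v, inC e x v = set0},
      {in rest x, forall v, outC e x v = set0} | rigid e k x].
Proof.
have [[a [b [l [wl lk S0]]]]|nin] := classic (exists a b l,
    [/\ rest_walk e x a b l, size l = k & inC e x a = set0]).
  by constructor 1; apply: (empty_in_all De cV k3 sM maxc cx wl lk S0).
have [[a [b [l [wl lk T0]]]]|nout] := classic (exists a b l,
    [/\ rest_walk e x a b l, size l = k & outC e x b = set0]).
  (* Out-neighbours become in-neighbours in the converse, where the walk is read backwards. *)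
  constructor 2; have cx' := cycle_fun_conv cx.
  have maxc' L : (m.+2 < L < #|V|)%N -> ~ cyc (conv e) L.
    by move=> h /cyc_conv; apply: maxc.
  have e0 v : (inC (conv e) (fun i => x (- i)) v == set0) = (outC e x v == set0).
    apply/eqP/eqP=> /setP E; apply/setP=> i; have := E (- i);
    by rewrite !in_set0 ?in_inC ?in_outC /conv ?opprK.
  have wl' : rest_walk (conv e) (fun i => x (- i)) b a (rev l).
    case: wl => wl ul lR; split; rewrite ?rev_uniq //; first exact: walk_rev.
    by move=> v; rewrite mem_rev rest_opp => /lR.
  have S0 : inC (conv e) (fun i => x (- i)) b = set0.
    by apply/eqP; rewrite e0 T0.
  move=> v Rv; apply/eqP; rewrite -e0; apply/eqP.
  apply: (empty_in_all (dense_conv De) cV k3 sM maxc' cx' wl' _ S0).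
    by rewrite size_rev.
  by rewrite rest_opp.
constructor 3; apply: (long_rigid De cV k3 sM maxc cx) => a b l wl lk.
split; apply/eqP=> E; [apply: nin | apply: nout]; exists a, b, l; split=> //.
Qed.

End LongConclusion.

(** * The exceptional digraphs *)

Lemma iso_of_inj (V W : finType) (D : digraph V) (E : digraph W) (g : W -> V) :
    injective g -> #|W| = #|V| -> (forall u v, E u v = D (g u) (g v)) ->
  isomorphic D E.
Proof.
move=> injg cW Eg; have [|f fK gK] := inj_card_bij injg; first by rewrite cW.
exists f; first by exists g.
by move=> u v; rewrite Eg !gK.
Qed.

Lemma iso_complete (V : finType) (D : digraph V) (n : nat) :
    #|V| = n -> (forall u v, D u v = (u != v)) ->
  isomorphic D (symdigraph (complete n)).
Proof.
move=> cV DE; pose f v := cast_ord cV (enum_rank v); exists f.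
  exists (enum_val \o cast_ord (esym cV)) => v.
    by rewrite /f /= cast_ordK enum_rankK.
  by rewrite /f /= enum_valK cast_ordKV.
move=> u v; rewrite DE /= /complete_rel.
by rewrite !(inj_eq (@cast_ord_inj _ _ _)) (inj_eq enum_rank_inj).
Qed.

Section Exceptions.
Variables (V : finType) (D : digraph V).

Let irr : irreflexive D. Proof. exact: arc_irr. Qed.

Lemma complete_onE (A : {set V}) u v : complete_on D A -> u \in A -> v \in A ->
  D u v = (u != v).
Proof.
move=> cA Au Av; have [->|uv] := eqVneq u v; first by rewrite irr.
by rewrite (cA u v Au Av uv).
Qed.

Lemma iso_induced_complete (n : nat) (A : {set V}) : #|A| = n ->
  complete_on D A -> isomorphic (induced D A) (symdigraph (complete n)).
Proof.
move=> cA DA; apply: iso_complete; first by rewrite card_sig -cA; apply: eq_card.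
move=> [u Au] [v Av] /=; rewrite /induced_rel /=.
by rewrite (complete_onE DA Au Av) -val_eqE.
Qed.

(** In-neighbours of a in A are among the s other vertices of A, so the semidegree makes A complete;
    dually for the complement. As p-1 > 2s, every vertex needs one more arc, which must go from A to
    the complement. *)
Lemma Hnn_of_no_arcs s (A : {set V}) : dense D s -> #|V| = s.*2.+2 ->
    #|A| = s.+1 -> (forall b a, b \notin A -> a \in A -> ~~ D b a) ->
  in_Hnn s.+1 D.
Proof.
move=> [_ _ _ semi deg] cV cA noarc.
have cB : #|~: A| = s.+1 by have := cardsC A; rewrite cV cA; lia.
have cD (S : {set V}) v : v \in S -> #|S| = s.+1 -> #|S :\ v| = s.
  by move=> Sv; rewrite (cardsD1 v S) Sv => -[].
have subA a : a \in A -> ins D a \subset A :\ a.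
  move=> Aa; apply/subsetP=> b; rewrite !inE => ba; apply/andP; split.
    by apply: contraTneq ba => ->; rewrite irr.
  by apply: contraTT ba => /noarc; apply.
have subB b : b \in ~: A -> outs D b \subset ~: A :\ b.
  rewrite inE => Ab; apply/subsetP=> a; rewrite !inE => ba; apply/andP; split.
    by apply: contraTneq ba => ->; rewrite irr.
  by apply: contraL ba; apply: noarc.
have eqA a : a \in A -> ins D a = A :\ a.
  move=> Aa; apply/eqP; rewrite eqEcard subA // cD //.
  by have [] := semi a.
have eqB b : b \in ~: A -> outs D b = ~: A :\ b.
  move=> Ab; apply/eqP; rewrite eqEcard subB // cD //.
  by have [] := semi b.
have comA : complete_on D A.
  move=> u v Au Av uv; have : u \in ins D v by rewrite eqA // !inE uv.
  by rewrite inE.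
have comB : complete_on D (~: A).
  move=> u v Au Av uv; have : v \in outs D u by rewrite eqB // in_setD1 eq_sym uv.
  by rewrite inE.
split; first by rewrite cV; lia.
exists A, (~: A); split.
- by rewrite setUCr -setI_eq0 setICr.
- by split; apply: iso_induced_complete.
- by move=> b a; rewrite inE; apply: noarc.
- move=> a Aa; have : ~~ (outs D a \subset A :\ a).
    apply/negP=> /subset_leq_card; rewrite cD //.
    by have := deg a; rewrite eqA // cD // cV; lia.
  case/subsetPn=> b; rewrite !inE negb_and negbK => ab.
  case/orP=> [/eqP eb|Ab]; first by rewrite eb irr in ab.
  by exists b; rewrite ?inE.
- move=> b Ab; have : ~~ (ins D b \subset ~: A :\ b).
    apply/negP=> /subset_leq_card; rewrite cD //.
    by have := deg b; rewrite eqB // cD // cV; lia.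
  case/subsetPn=> a; rewrite !inE negb_and !negbK => ab.
  case/orP=> [/eqP eb|Aa]; first by rewrite eb irr in ab.
  by exists a.
Qed.

Definition listing (A : {set V}) (v0 : V) i := nth v0 (enum A) i.

Lemma listing_in (A : {set V}) v0 i : (i < #|A|)%N -> listing A v0 i \in A.
Proof. by move=> iA; rewrite -mem_enum mem_nth // -cardE. Qed.

Lemma listing_eq (A : {set V}) v0 i j : (i < #|A|)%N -> (j < #|A|)%N ->
  (listing A v0 i == listing A v0 j) = (i == j).
Proof. by move=> iA jA; rewrite nth_uniq ?enum_uniq -?cardE. Qed.

Section FromTwins.
Variables (k : nat) (q : nat -> V) (B R : {set V}).

Lemma iso_join_complete : twins D 1 k q B R 0 0 ->
  isomorphic D (symdigraph (gjoin (gunion (complete k) (complete k))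
                                  (complete 1))).
Proof.
case=> cV _ HB HR _ _ _ disj nq sep.
have [[/andP[qB qR] cB] cR] := (nq 0%N isT, half_card HB, half_card HR).
pose g (u : 'I_k + 'I_k + 'I_1) := match u with
  | inl (inl i) => listing B (q 0) i
  | inl (inr i) => listing R (q 0) i
  | inr _ => q 0
  end.
have lB (i : 'I_k) : listing B (q 0) i \in B by apply: listing_in; rewrite cB.
have lR (i : 'I_k) : listing R (q 0) i \in R by apply: listing_in; rewrite cR.
have BR b r : b \in B -> r \in R -> (b == r) = false.
  by move=> Bb Rr; apply: contraTF Rr => /eqP <-; rewrite (disjointFr disj Bb).
have qb b : b \in B -> (q 0 == b) = false.
  by move=> Bb; apply: contraNF qB => /eqP->.
have qr r : r \in R -> (q 0 == r) = false.
  by move=> Rr; apply: contraNF qR => /eqP->.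
apply: (@iso_of_inj _ _ _ _ g).
- move=> [[i|i]|i] [[j|j]|j] /= /eqP; rewrite ?(BR _ _ (lB _) (lR _)) //.
  + by rewrite listing_eq ?cB // => /eqP/val_inj->.
  + by rewrite eq_sym (qb _ (lB _)).
  + by rewrite eq_sym (BR _ _ (lB _) (lR _)).
  + by rewrite listing_eq ?cR // => /eqP/val_inj->.
  + by rewrite eq_sym (qr _ (lR _)).
  + by rewrite (qb _ (lB _)).
  + by rewrite (qr _ (lR _)).
  + by rewrite (ord1 i) (ord1 j).
- by rewrite cV !card_sum !card_ord; lia.
- move=> [[i|i]|i] [[j|j]|j] /=; rewrite /complete_rel.
  + by rewrite (complete_onE (half_complete HB) (lB _) (lB _)) listing_eq ?cB.
  + by have /andP[/negbTE-> _] := sep _ _ (lB i) (lR j).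
  + by rewrite (half_out HB).
  + by have /andP[_ /negbTE->] := sep _ _ (lB j) (lR i).
  + by rewrite (complete_onE (half_complete HR) (lR _) (lR _)) listing_eq ?cR.
  + by rewrite (half_out HR).
  + by rewrite (half_in HB).
  + by rewrite (half_in HR).
  + by rewrite irr (ord1 i) (ord1 j).
Qed.

(** [q 0] and [q 1] are the vertices x and y of H(2n), with n - 1 = k. Only the arc from y to x is
    left open, which separates H(2n) from H'(2n). *)
Lemma iso_H2n : twins D 2 k q B R 0 1 ->
  isomorphic D (Digraph (@H2n_irr k.+1 (D (q 1) (q 0)))).
Proof.
case=> cV _ HB HR injq path _ disj nq sep.
have [/andP[q0B q0R] /andP[q1B q1R]] := (nq 0%N isT, nq 1%N isT).
have [cB cR] := (half_card HB, half_card HR).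
pose g (u : H2n_vertex k.+1) := match u with
  | inl (inl i) => listing B (q 0) i
  | inl (inr i) => listing R (q 0) i
  | inr true => q 0
  | inr false => q 1
  end.
have lB (i : 'I_k) : listing B (q 0) i \in B by apply: listing_in; rewrite cB.
have lR (i : 'I_k) : listing R (q 0) i \in R by apply: listing_in; rewrite cR.
have BR b r : b \in B -> r \in R -> (b == r) = false.
  by move=> Bb Rr; apply: contraTF Rr => /eqP <-; rewrite (disjointFr disj Bb).
have qb h b : (h < 2)%N -> b \in B -> (q h == b) = false.
  move=> h2 Bb; have /andP[qB _] := nq h h2.
  by apply: contraNF qB => /eqP->.
have qr h r : (h < 2)%N -> r \in R -> (q h == r) = false.
  move=> h2 Rr; have /andP[_ qR] := nq h h2.
  by apply: contraNF qR => /eqP->.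
have q01 : (q 0 == q 1) = false by apply/eqP=> /injq; move/(_ isT isT).
apply: (@iso_of_inj _ _ _ _ g).
- move=> [[i|i]|[]] [[j|j]|[]] //= /eqP; rewrite ?(BR _ _ (lB _) (lR _)) //.
  + by rewrite listing_eq ?cB // => /eqP/val_inj->.
  + by rewrite eq_sym qb.
  + by rewrite eq_sym qb.
  + by rewrite eq_sym (BR _ _ (lB _) (lR _)).
  + by rewrite listing_eq ?cR // => /eqP/val_inj->.
  + by rewrite eq_sym qr.
  + by rewrite eq_sym qr.
  + by rewrite qb.
  + by rewrite qr.
  + by rewrite q01.
  + by rewrite qb.
  + by rewrite qr.
  + by rewrite eq_sym q01.
- by rewrite cV !card_sum !card_ord card_bool; lia.
- move=> [[i|i]|[]] [[j|j]|[]] /=.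
  + by rewrite (complete_onE (half_complete HB) (lB _) (lB _)) listing_eq ?cB.
  + by have /andP[/negbTE-> _] := sep _ _ (lB i) (lR j).
  + by rewrite (half_out HB).
  + by rewrite (half_out HB).
  + by have /andP[_ /negbTE->] := sep _ _ (lB j) (lR i).
  + by rewrite (complete_onE (half_complete HR) (lR _) (lR _)) listing_eq ?cR.
  + by rewrite (half_out HR).
  + by rewrite (half_out HR).
  + by rewrite (half_in HB).
  + by rewrite (half_in HR).
  + by rewrite irr.
  + by rewrite (path 0%N).
  + by rewrite (half_in HB).
  + by rewrite (half_in HR).
  + by [].
  + by rewrite irr.
Qed.

End FromTwins.

Definition exceptional (n : nat) :=
  in_Hnn n D \/
  isomorphic D (symdigraph (gjoin (gunion (complete n) (complete n))
                                  (complete 1))) \/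
  (2 <= n /\ (isomorphic D (H2n n) \/ isomorphic D (H2n' n)))%N \/
  isomorphic D (symdigraph C5) \/
  (#|V| = (2 * n)%N /\ embeds_spanning D (symdigraph (complete_bip n n))).

Lemma twinned_exceptional s : dense D s -> ~ cyc D #|V|.-1 -> twinned D ->
  exists2 n, (0 < n)%N & exceptional n.
Proof.
move=> De nocyc [N [k [q [B [R [c [d TW]]]]]]].
wlog cd : B R c d TW / (c <= d)%N.
  move=> H; have [/(H _ _ _ _ TW)//|/ltnW] := leqP c d.
  exact: H (twins_sym TW).
have [c0 dN N2] := twins_small De TW cd nocyc.
have [N0 k2] := (half_lt (twins_half1 TW), twins_k TW).
case: N c0 dN N2 N0 TW => [|[|[|//]]] // -> -> _ _ TW.
  exists k; first exact: ltnW.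
  by right; left; apply: iso_join_complete TW.
exists k.+1 => //; right; right; left; split; first exact: ltnW.
by have := iso_H2n TW; case: (D _ _); [right | left].
Qed.

Lemma bipart_exceptional : bipart D -> (0 < #|V|)%N ->
  exists2 n, (0 < n)%N & exceptional n.
Proof.
move=> [X cX bip] V0; exists #|X|; first by lia.
right; right; right; right; split; first by lia.
have [v0 _] : exists v : V, v \in V by apply/card_gt0P.
have cC : #|~: X| = #|X| by have := cardsC X; lia.
pose g (u : 'I_#|X| + 'I_#|X|) := match u with
  | inl i => listing X v0 i
  | inr i => listing (~: X) v0 i
  end.
have gX u : (g u \in X) = (if u is inl _ then true else false).
  case: u => i /=; first exact: listing_in.
  have := @listing_in (~: X) v0 i; rewrite cC => /(_ (ltn_ord i)).
  by rewrite inE => /negbTE.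
have injg : injective g.
  move=> u v guv; have := gX u; rewrite guv gX; move: guv.
  case: u v => [i|i] [j|j] //= /eqP; rewrite listing_eq ?cC // => /eqP.
    by move/val_inj->.
  by move/val_inj->.
have irr' : irreflexive (fun u v => D (g u) (g v)) by move=> u; apply: irr.
exists (Digraph irr').
  move=> u v /= /bip; rewrite !gX /complete_bip_rel.
  by case: u v => [i|i] [j|j].
by apply: (@iso_of_inj _ _ _ _ g) => //; rewrite card_sum !card_ord; lia.
Qed.

End Exceptions.

(** * A cycle longer than s *)

Section Start.
Variables (V : finType) (D : rel V) (s : nat).
Hypothesis De : dense D s.

Let irr : irreflexive D. Proof. by case: De. Qed.

(** All out-neighbours of the end b of a longest path lie on it, so the cycle closed at the first of
    them contains b and at least s other vertices. *)
Lemma long_cycle : exists2 L, (s < L <= #|V|)%N & cyc D L.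
Proof.
have [_ s1 /andP[sV _] semi _] := De.
have /card_gt0P[v0 _] : (0 < #|[set: V]|)%N by rewrite cardsT; lia.
have [a [b [l [wl ul _ maxl]]]] := longest_walk D (in_setT v0).
have outl v : D b v -> v \in l.
  move=> bv; apply: contraT => vl.
  have := maxl a v _ (walk_rcons wl bv); rewrite rcons_uniq vl size_rcons ltnn.
  by move=> /(_ ul) -> // z; rewrite inE.
have hasb : has (D b) l.
  have [sb _] := semi b.
  have /card_gt0P[v] := leq_trans (ltnW s1) sb; rewrite inE => bv.
  by apply/hasP; exists v => //; apply: outl.
have [l1 [c [l2 [el bc nl1]]]] : exists l1 c l2,
    [/\ l = l1 ++ c :: l2, D b c & ~~ has (D b) l1].
  by case/split_find: hasb => c l1 l2 bc nl; exists l1, c, l2; rewrite cat_rcons.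
have wc : walk D c b (c :: l2).
  have /walkP[q [eq pq lq]] := wl; apply/walkP; exists l2; split=> //.
    move: eq pq; rewrite el; case: (l1) => [[-> <-] //|a1 l1' [_ <-]].
    by rewrite cat_path => /andP[_ /=] /andP[].
  move: eq lq; rewrite el; case: (l1) => [[-> <-] //|a1 l1' [_ <-]].
  by rewrite last_cat.
have uc : uniq (c :: l2) by move: ul; rewrite el cat_uniq => /and3P[].
exists (size (c :: l2)); last exact: walk_cyc wc bc uc.
rewrite -(card_uniqP uc) max_card andbT.
have [sb _] := semi b; apply: leq_ltn_trans sb _.
have -> : #|c :: l2| = #|[set v in c :: l2] :\ b|.+1.
  have := cardsD1 b [set v in c :: l2]; rewrite cardsE in_set.
  by have -> := walk_last wc.
rewrite ltnS.
apply/subset_leq_card/subsetP=> v; rewrite !inE => bv; apply/andP; split.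
  by apply: contraTneq bv => ->; rewrite irr.
have := outl v bv; rewrite el mem_cat => /orP[vl1|]; last by rewrite inE.
by case/negP: nl1; apply/hasP; exists v.
Qed.

Section Spanning.
Variables (m : nat) (h : 'I_m.+2 -> V).
Hypotheses (ch : cycle_fun D h) (cV : #|V| = m.+2).
Hypothesis nolong : forall L, (s < L < m.+2)%N -> ~ cyc D L.

Let injh : injective h. Proof. by case: ch. Qed.

Lemma backward_chord (i : 'I_m.+2) (t : nat) :
  (0 < t < m.+1)%N -> D (h i) (h (i - t%:R)) -> (t < s)%N.
Proof.
move=> /andP[t0 tm] it; rewrite ltnNge; apply/negP=> st.
apply: (nolong (L := t.+1)); first by lia.
rewrite -[t.+1](size_iota 0) -(size_pts h (i - t%:R)).
have := walk_pts (i - t%:R) 0 t ch; rewrite addr0 add0n subrK => w.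
apply: (walk_cyc w it); apply: (uniq_pts _ ch); first exact: iota_uniq.
by apply/allP=> u; rewrite mem_iota; lia.
Qed.

(** A chord going back t steps closes a cycle on t.+1 vertices, so t < s. This leaves the successor
    and s-1 predecessors as candidates, and the semidegree takes them all. *)
Lemma spanning_outs (i : 'I_m.+2) : outs D (h i) =
  h (i + 1) |: [set v in [seq h (i - u%:R) | u <- iota 1 s.-1]]
  /\ #|outs D (h i)| = s.
Proof.
have [_ s1 sV semi _] := De.
set F := _ |: _.
have sub : outs D (h i) \subset F.
  apply/subsetP=> v; rewrite /F inE => hv.
  have : v \in codom h.
    have c : #|codom h| = #|V| by rewrite card_codom // card_ord.
    by have /(subset_cardP c) -> : codom h \subset V by apply/subsetP.
  case/codomP=> j ej; have [u uM eu] := ord_shift j i.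
  have {}ej : v = h (i - u%:R) by rewrite ej eu addrK.
  have u0 : (0 < u)%N.
    by rewrite lt0n; apply: contraTneq hv => u0; rewrite ej u0 subr0 irr.
  have [um|um] := ltnP u m.+1; last first.
    have -> : v = h (i + 1).
      by rewrite ej (_ : u = m.+1) ?natr_pred ?opprK //; lia.
    by rewrite setU11.
  rewrite in_setU1 inE; apply/orP; right; apply/mapP; exists u => //.
  rewrite mem_iota; have := @backward_chord i u; rewrite -ej hv u0 um.
  by move=> /(_ isT isT); lia.
have cF : (#|F| <= s)%N.
  apply: leq_trans (_ : 1 + s.-1 <= _)%N; last by rewrite add1n prednK // ltnW.
  apply: leq_trans (leq_card_setU _ _) _; rewrite cards1 leq_add2l cardsE.
  by apply: leq_trans (card_size _) _; rewrite size_map size_iota.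
have [so _] := semi (h i).
have eF : outs D (h i) = F by apply/eqP; rewrite eqEcard sub (leq_trans cF).
by split=> //; apply/eqP; rewrite eqn_leq so eF cF.
Qed.

End Spanning.
End Start.

Section SpanningCycle.
Variables (V : finType) (D : digraph V) (s m : nat) (h : 'I_m.+2 -> V).
Hypotheses (De : dense D s) (ch : cycle_fun D h) (cV : #|V| = m.+2).
Hypothesis nolong : forall L, (s < L < m.+2)%N -> ~ cyc D L.

(** Applied to the converse too, [spanning_outs] gives degree exactly 2s, so p-1 <= 2s. *)
Lemma spanning_order : m.+1 = s.*2.
Proof.
have [_ _ sV _ /(_ (h 0))] := De; rewrite cV in sV *.
have [_ ->] := spanning_outs De ch cV nolong 0.
have nolong' L : (s < L < m.+2)%N -> ~ cyc (conv D) L.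
  by move=> h1 /cyc_conv; apply: nolong.
have [_] := spanning_outs (dense_conv De) (cycle_fun_conv ch) cV nolong' 0.
rewrite oppr0 => e1; have -> : #|ins D (h 0)| = s by rewrite -[RHS]e1.
by move: sV; lia.
Qed.

Lemma spanning_C5 : isomorphic D (symdigraph C5).
Proof.
have [irr s1 sV semi _] := De; have [injh eh] := ch.
have back (i : 'I_m.+2) t : (0 < t < s)%N -> D (h i) (h (i - t%:R)).
  move=> ts; have [eo _] := spanning_outs De ch cV nolong i.
  have : h (i - t%:R) \in outs D (h i); last by rewrite inE.
  rewrite eo in_setU1 inE; apply/orP; right; apply/mapP; exists t => //.
  by rewrite mem_iota; lia.
have es := spanning_order.
have s2 : s = 2%N.
  (* For s >= 3 all arcs going back one or two steps exist, so the reversed cycle with one vertex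
     skipped has length p-1. *)
  apply/eqP; rewrite eqn_leq s1 andbT leqNgt; apply/negP=> s3.
  have cb : cycle_fun D (fun i => h (- i)).
    split=> [i j /injh/oppr_inj //|i].
    by rewrite opprD; apply: (back (- i) 1%N).
  apply: (nolong (L := m.+1)); first by lia.
  rewrite -[m.+1](size_iota 0) -(size_pts (fun i => h (- i)) 0).
  have w := walk_pts 0 0 m cb.
  apply: (walk_cyc w); last first.
    apply: (uniq_pts _ cb); first exact: iota_uniq.
    by apply/allP=> u; rewrite mem_iota; lia.
  have := back (- (0 + (0 + m)%N%:R)) 2%N; rewrite s3 => /(_ isT).
  congr (D _ (h _)); rewrite !add0r !add0n -opprD -natrD addn2 natr_size.
  by [].
rewrite s2 in es; case: es => em.
subst m; apply: (@iso_of_inj _ _ _ _ h) => //; first by rewrite cV card_ord.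
move=> i j /=.
have -> : D (h i) (h j) = (h j \in outs D (h i)) by rewrite inE.
have [-> _] := spanning_outs De ch cV nolong i.
rewrite in_setU1 inE s2 /= in_cons in_nil orbF !(inj_eq injh) /C5_rel.
congr (_ || _).
  by rewrite eq_sym -val_eqE /= addn1.
by rewrite [RHS]eq_sym subr_eq [RHS]eq_sym -[RHS]val_eqE /= addn1.
Qed.

End SpanningCycle.

(** * Assembling the cases *)

Section Main.
Variables (V : finType) (D : digraph V) (s : nat).
Hypothesis De : dense D s.

Let irr : irreflexive D. Proof. exact: arc_irr. Qed.

Lemma maximal_cycle L : (s < L < #|V|)%N -> cyc D L ->
  exists M, [/\ (s < M < #|V|)%N, cyc D M
    & forall L', (M < L' < #|V|)%N -> ~ cyc D L'].
Proof.
have [n] := ubnP (#|V| - L); elim: n L => // n IH L nL sL cL.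
have [[L' [LL' cL']]|no] := classic (exists L', (L < L' < #|V|)%N /\ cyc D L').
  by apply: IH cL'; lia.
by exists L; split=> // L' LL' cL'; apply: no; exists L'.
Qed.

Section Longest.
Variables (m k : nat).
Hypotheses (cV : #|V| = (k + m.+2)%N) (sM : (s < m.+2)%N).
Hypothesis maxc : forall L, (m.+2 < L < #|V|)%N -> ~ cyc D L.

(** One semidegree of an outside vertex lies entirely outside, so k = s+1 and the cycle also has s+1
    vertices. The part without entering arcs is the outside in the first case and the cycle in the
    second. *)
Lemma long_Hnn (x : 'I_m.+2 -> V) : (2 < k)%N -> cycle_fun D x ->
    {in rest x, forall v, inC D x v = set0} \/
    {in rest x, forall v, outC D x v = set0} ->
  in_Hnn s.+1 D.
Proof.
move=> k3 cx E; have [injx _] := cx.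
have cR : #|rest x| = k := size_rest cV injx.
have ek : k = s.+1.
  have := k_le De cV sM.
  have /card_gt0P[v Rv] : (0 < #|rest x|)%N by rewrite cR; lia.
  have nv : forall z, z \in [:: v] -> ~~ D z v.
    by move=> z; rewrite inE => /eqP->; rewrite irr.
  have nv' : forall z, z \in [:: v] -> ~~ D v z.
    by move=> z; rewrite inE => /eqP->; rewrite irr.
  have sv : {subset [:: v] <= rest x} by move=> z; rewrite inE => /eqP->.
  case: E => /(_ v Rv) E.
    have := in_rest_semi De cx v; have := in_rest_le cV cx (l := [:: v]) isT sv nv.
    by rewrite E cards0 /=; lia.
  have := out_rest_semi De cx v; have := out_rest_le cV cx (l := [:: v]) isT sv nv'.
  by rewrite E cards0 /=; lia.
have cV' : #|V| = s.*2.+2 by have := long_bounds De cV; lia.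
case: E => E.
  apply: (Hnn_of_no_arcs De cV' (A := rest x)); first by rewrite cR.
  move=> b a; rewrite inE negbK => /codomP[i ->] /E/setP/(_ i).
  by rewrite in_inC in_set0 => ->.
apply: (Hnn_of_no_arcs De cV' (A := ~: rest x)).
  by have := cardsC (rest x); rewrite cR; lia.
move=> b a; rewrite inE negbK => /E/setP Eb; rewrite !inE negbK => /codomP[i ->].
by have := Eb i; rewrite in_outC in_set0 => ->.
Qed.

Lemma long_exceptional (x : 'I_m.+2 -> V) : (2 < k)%N -> cycle_fun D x ->
  in_Hnn s.+1 D \/ twinned D.
Proof.
move=> k3 cx; case: (long_cases De cV k3 sM maxc cx) => [E|E|rx].
- by left; apply: (long_Hnn k3 cx); left.
- by left; apply: (long_Hnn k3 cx); right.
have k2 := ltnW k3; have [h [c fx]] := rigid_frame De cV k2 rx.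
have cs := cycle_swapped cV k2 rx fx.
case: (long_cases De cV k3 sM maxc cs) => [E|E|rs].
- by left; apply: (long_Hnn k3 cs); left.
- by left; apply: (long_Hnn k3 cs); right.
have [q [R [d TW]]] := rigid_twins De cV k2 rx fx rs.
by right; exists (m.+2 - k)%N, k, q, (rest x), R, c, d.
Qed.

End Longest.

Lemma dense_exceptional : ~ cyc D #|V|.-1 ->
  exists2 n, (0 < n)%N & exceptional D n.
Proof.
move=> nocyc; have [_ s1 sV _ _] := De.
have [[L [sL cL]]|no] := classic (exists L, (s < L < #|V|)%N /\ cyc D L); last first.
  have [L /andP[sL LV] cL] := long_cycle De.
  have eL : L = #|V|.
    apply/eqP; rewrite eqn_leq LV leqNgt; apply/negP=> lt.
    by apply: no; exists L; rewrite sL.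
  have eV : #|V| = (#|V| - 2).+2 by move: s1 sV; clear; lia.
  have [c [sc cc]] := cL; rewrite eL eV in sc.
  have [h ch _] := fun_of_ucycle sc cc.
  exists 1%N => //; right; right; right; left.
  apply: (spanning_C5 De ch eV) => L'; rewrite -eV => sL' cL'.
  by apply: no; exists L'.
have [M [/andP[sM MV] cM maxM]] := maximal_cycle sL cL.
have M1 : M != #|V|.-1 by apply: contra_not_neq nocyc => <-.
have eM : M = (M - 2).+2 by move: s1 sM; clear; lia.
have [c [sc cc]] := cM; rewrite eM in sc; have [x cx _] := fun_of_ucycle sc cc.
have cV : #|V| = (#|V| - M + (M - 2).+2)%N by move: MV eM; clear; lia.
rewrite eM in sM maxM.
have [k3|k2] := ltnP 2 (#|V| - M)%N.
  case: (long_exceptional cV sM maxM k3 cx) => [H|]; last first.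
    exact: twinned_exceptional De nocyc.
  by exists s.+1 => //; left.
(* M = p-1 is ruled out by [M1], so exactly two vertices are outside. *)
have cV4 : #|V| = (M - 2).+4 by move: MV M1 eM k2; clear; lia.
have [a [b [ax bx ab]]] : exists a b, [/\ a \in rest x, b \in rest x & a != b].
  have [injx _] := cx.
  have /card_gt1P[a [b [ax bx ab]]] : (1 < #|rest x|)%N.
    by have := card_rest injx; lia.
  by exists a, b.
have C : config D x a b by split=> //; [move: ax | move: bx]; rewrite inE.
have nc : ~ cyc D (M - 2).+3 by move: nocyc; rewrite cV4.
case: (pairs_conclusion De cV4 nc C) => [bp|]; last first.
  exact: twinned_exceptional De nocyc.
by apply: bipart_exceptional bp _; rewrite cV4.
Qed.

End Main.

Lemma leq_bigmin (I : finType) (n : nat) (F : I -> nat) (i : I) :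
  (\big[minn/n]_j F j <= F i)%N.
Proof.
rewrite unlock; have := mem_index_enum i; elim: (index_enum I) => //= j r IH.
by rewrite inE geq_min => /orP[/eqP->|/IH->]; rewrite ?leqnn ?orbT.
Qed.

Lemma dense_of_degrees (V : finType) (D : digraph V) : (4 < #|V|)%N ->
    (#|V|.-1 <= min_degree D)%N -> (#|V| <= (min_semidegree D).*2.+2)%N ->
  dense D (#|V|.-1)./2.
Proof.
move=> p5 md ms; split.
- exact: arc_irr.
- by lia.
- by lia.
- move=> v; have := leq_bigmin #|V| (fun v => minn (outdeg D v) (indeg D v)) v.
  rewrite -/(min_semidegree D) /outdeg /indeg /outn /inn /outs /ins.
  by move: #|_| #|_| p5 ms; lia.
- move=> v; have := leq_trans md (leq_bigmin _ (deg D) v).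
  by rewrite /deg /outdeg /indeg /outn /inn /outs /ins; lia.
Qed.
Close Scope ring_scope.
Theorem theorem1 (V : finType) (D : digraph V) (p : nat)
    (card_V : #|V| = p) (p_ge5 : 5 <= p)
    (min_deg : p - 1 <= min_degree D)
    (min_semideg : (p%:R / 2 - 1 <= (min_semidegree D)%:R :> rat)%R) :
  has_cycle D (p - 1) \/
  exists2 n : nat, 0 < n &
    in_Hnn n D \/
    isomorphic D (symdigraph (gjoin (gunion (complete n) (complete n))
                                    (complete 1))) \/
    (2 <= n /\ (isomorphic D (H2n n) \/ isomorphic D (H2n' n))) \/
    isomorphic D (symdigraph C5) \/
    (p = 2 * n /\ embeds_spanning D (symdigraph (complete_bip n n))).
Proof.
subst p; rewrite subn1 in min_deg *.
have [|nocyc] := classic (has_cycle D #|V|.-1); [by left | right].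
have ms : #|V| <= (min_semidegree D).*2.+2.
  have -> : (min_semidegree D).*2.+2 = min_semidegree D * 2 + 2 by lia.
  rewrite -(Num.Theory.ler_nat rat) natrD natrM; move: min_semideg; lra.
exact: dense_exceptional (dense_of_degrees p_ge5 min_deg ms) nocyc.
Qed.
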